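(* Let $N\ge 2$ and $T=\bigcup_{k=1}^N[a_k,b_k]\subset\mathbb R$ with $a_k<b_k<a_{k+1}<b_{k+1}$ for $k=1,\dots,N-1$. For a complex-valued potential $q\in C(T)$ and $j=0,1$, let $L_j=L_j(q)$ be the boundary value problem $$-y^{\Delta\Delta}(x)+q(x)y(\sigma(x))=\lambda y(\sigma(x)),\ x\in T,\qquad y^{\Delta^j}(a_1)=y(b_N)=0,$$ and let $\{\lambda_{nj}\}_{n\ge1}$ be its spectrum. Specification of the two spectra $\{\lambda_{nj}\}_{n\ge1}$, $j=0,1$, uniquely determines the potential $q$ on $T$; that is, if $q,\tilde q\in C(T)$ are complex-valued and for each $j=0,1$ the spectra (counted with multiplicity) of $L_j(q)$ and $L_j(\tilde q)$ coincide, then $q=\tilde q$ on $T$.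
   Context: Time-scale notions on $T=\bigcup_{k=1}^N[a_k,b_k]$. The jump function is $\sigma(x)=\inf\{s\in T: s>x\}$ for $x\in T$, $x\neq\sup T$, and $\sigma(\sup T)=\sup T=b_N$; so $\sigma(b_k)=a_{k+1}$ for $k=1,\dots,N-1$ and $\sigma(x)=x$ for all other $x\in T$. A function $f$ on $T$ is $\Delta$-differentiable at $t\in T$ with $\Delta$-derivative $f^\Delta(t)$ if for every $\varepsilon>0$ there is $\delta>0$ such that $|f(\sigma(t))-f(s)-f^{\Delta}(t)(\sigma(t)-s)|\le\varepsilon|\sigma(t)-s|$ for all $s\in(t-\delta,t+\delta)\cap T$. Put $f^{\Delta\Delta}=(f^\Delta)^\Delta$, $f^{\Delta^0}=f$, $f^{\Delta^1}=f^\Delta$. $C(T)$ denotes the continuous functions on $T$. A solution of $-y^{\Delta\Delta}(x)+q(x)y(\sigma(x))=\lambda y(\sigma(x))$ on $T$ is a function $y$ on $T$ that is twice $\Delta$-differentiable on $T$ and satisfies the equation for all $x\in T$. Equivalently, $-y''+qy=\lambda y$ on each $[a_k,b_k]$, $k=1,\dots,N$, (one-sided derivatives at the endpoints) and, for $k=1,\dots,N-1$, $$y(a_{k+1})=y(b_k)+(a_{k+1}-b_k)y'(b_k),\qquad y'(a_{k+1})=y'(b_k)+(a_{k+1}-b_k)(q(b_k)-\lambda)y(a_{k+1}),$$ where $y'(b_k)$ is the left derivative and $y'(a_{k+1})$ the right derivative; in this case $y^\Delta(x)=y'(x)$ on $T$ with this convention. Let $S(x,\lambda)$ and $C(x,\lambda)$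 be the solutions with $S(a_1,\lambda)=C^\Delta(a_1,\lambda)=0$ and $S^\Delta(a_1,\lambda)=C(a_1,\lambda)=1$; for fixed $x$ they are entire in $\lambda$. The characteristic functions of $L_0$ and $L_1$ are the entire functions $\Delta_0(\lambda)=S(b_N,\lambda)$ and $\Delta_1(\lambda)=C(b_N,\lambda)$. The eigenvalues of $L_j$ are the zeros of $\Delta_j$, and the spectrum $\{\lambda_{nj}\}_{n\ge1}$ is the (countably infinite) collection of zeros of $\Delta_j$ counted with multiplicity. *)

(* Defs.v *)
(* Stdlib world: concrete reals [R], with Coquelicot's complex numbers [C]. *)
From Stdlib Require Import Reals ClassicalEpsilon.
From Coquelicot Require Import Coquelicot.

Open Scope R_scope.

(* The endpoint families are 1-based: only the values a 1, ..., a N and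
   b 1, ..., b N matter. *)
Definition time_scale (N : nat) (a b : nat -> R) (x : R) : Prop :=
  exists k : nat, (1 <= k <= N)%nat /\ a k <= x <= b k.

(* [Lub_Rbar] and [Glb_Rbar] are the supremum and the infimum in the extended
   reals. For x in a time scale T as above both are finite where used, so the
   projection [real] loses nothing. *)
Definition ts_jump (T : R -> Prop) (x : R) : R :=
  let M := real (Lub_Rbar T) in
  if Req_EM_T x M then M else real (Glb_Rbar (fun s => T s /\ x < s)).

(* Functions on T are represented by total functions on R; nothing below
   depends on their values outside T. *)
Definition is_delta_derive (T : R -> Prop) (f : R -> C) (t : R) (l : C) : Prop :=
  forall eps : R, 0 < eps -> exists delta : R, 0 < delta /\
    forall s : R, T s -> t - delta < s < t + delta ->
      Cmod (f (ts_jump T t) - f s - l * RtoC (ts_jump T t - s))%C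
        <= eps * Rabs (ts_jump T t - s).

Definition ex_delta_derive (T : R -> Prop) (f : R -> C) (t : R) : Prop :=
  exists l : C, is_delta_derive T f t l.

(* Arbitrary at the points where f is not delta-differentiable. *)
Definition delta_derive (T : R -> Prop) (f : R -> C) (t : R) : C :=
  epsilon (inhabits (RtoC 0)) (is_delta_derive T f t).

Definition is_solution (T : R -> Prop) (q : R -> C) (lambda : C) (y : R -> C)
  : Prop :=
  (forall x, T x -> ex_delta_derive T y x) /\
  (forall x, T x -> ex_delta_derive T (delta_derive T y) x) /\
  (forall x, T x ->
     (- delta_derive T (delta_derive T y) x + q x * y (ts_jump T x)
      = lambda * y (ts_jump T x))%C).

(* The solution is unique only as a function on T, which is what matters. *)
Definition S_sol (N : nat) (a b : nat -> R) (q : R -> C) (x : R) (lambda : C)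
  : C :=
  let T := time_scale N a b in
  epsilon (inhabits (fun _ : R => RtoC 0))
    (fun y => is_solution T q lambda y /\
              y (a 1%nat) = RtoC 0 /\ delta_derive T y (a 1%nat) = RtoC 1) x.

Definition C_sol (N : nat) (a b : nat -> R) (q : R -> C) (x : R) (lambda : C)
  : C :=
  let T := time_scale N a b in
  epsilon (inhabits (fun _ : R => RtoC 0))
    (fun y => is_solution T q lambda y /\
              y (a 1%nat) = RtoC 1 /\ delta_derive T y (a 1%nat) = RtoC 0) x.

(* Characteristic functions of the problems with y(a_1) = y(b_N) = 0 and
   y^Delta(a_1) = y(b_N) = 0 respectively. *)
Definition Delta0 (N : nat) (a b : nat -> R) (q : R -> C) (lambda : C) : C :=
  S_sol N a b q (b N) lambda.

Definition Delta1 (N : nat) (a b : nat -> R) (q : R -> C) (lambda : C) : C :=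
  C_sol N a b q (b N) lambda.

Definition entire (g : C -> C) : Prop :=
  forall z : C, @ex_derive C_AbsRing C_NormedModule g z.

(* z is a zero of multiplicity exactly m of the entire function f. *)
Definition zero_of_mult (f : C -> C) (z : C) (m : nat) : Prop :=
  (1 <= m)%nat /\
  exists g : C -> C, entire g /\ g z <> RtoC 0 /\
    forall w : C, f w = ((w - z) ^ m * g w)%C.

(* The zeros of f and of g, counted with multiplicity, coincide. *)
Definition same_zeros (f g : C -> C) : Prop :=
  forall (z : C) (m : nat), zero_of_mult f z m <-> zero_of_mult g z m.

(* Main.v *)
(* Let psi be the solution vanishing at b_N, with psi^Delta(b_N) = -1. The Wronskian of two solutions is
   constant on T, so Delta_0 = psi(a_1) and Delta_1 = - psi^Delta(a_1).

   Both are entire of order at most 1/2, hence determined by their zeros up to a constant: if f = h g with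
   h entire and zero-free, then ln |h| is harmonic, its circle means are O(sqrt r) by the growth of f and g
   and Jensen's inequality for g, and its first Fourier coefficient on a circle of radius r about p is
   pi r h'(p) / h(p); so h' = 0. As psi^Delta(a_1) / psi(a_1) ~ - k for lambda = - k^2, k -> +oo, the two
   constants agree, and psi^Delta / psi at a_1 is the same for both potentials.

   On one interval [a_k, b_k] this common quotient determines the potential. Let C, S, Ct, St be the solutions
   normalized at a_k. The entire function C(x) St(x) - S(x) Ct(x) equals
   (psi(x) / psi(a_k)) St(x) - S(x) (psit(x) / psit(a_k)), which tends to 0 as lambda -> - oo because
   psi(x) / psi(a_k) decays like exp (- k (x - a_k)). It is bounded for lambda > 0 and of order 1/2, so it
   vanishes by Phragmen-Lindelof and Liouville; then (Ct, St) = p (C, S) with p^2 = 1. Finally the equality of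
   the quotients is transported to b_k and, across the gap, to a_(k+1), where the argument is repeated. *)
Require Import Defs.
From Stdlib Require Import Reals Lra Lia Psatz ClassicalEpsilon FunctionalExtensionality.
From Coquelicot Require Import Coquelicot.

Open Scope R_scope.

(** For complex [q] the problem is not self-adjoint: eigenvalues may be non-real and multiple, so
    the spectra enter only through entire functions and their orders of vanishing. The data of psi
    are carried from [b N] to the left because the component growing to the left then dominates.
    Each gap restores this dominance: the term with [lam] in the jump condition and the length of
    the gap make [k * y] large against [v]. Hence every interval meets the same hypotheses and the
    one-interval argument can be repeated. Constancy of Wronskians does the work of a uniqueness
    theorem, also for the solutions that Delta_0 and Delta_1 select by [epsilon]. The equation on
    [[a_k, b_k]] is solved on the whole line for the potential extended by constants, which removes
    one-sided derivatives. Regularity in the parameter comes from Lagrange's identity with explicit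
    remainders. The function theory rests on circle means: differentiation in the radius and
    periodicity in the angle give the mean value property, Fourier coefficients and Jensen's
    inequality. *)

Ltac req := match goal with |- ?a = ?b => change (@eq R a b); cbv beta end; unfold Rminus.

(** * Elementary inequalities for complex numbers *)

Lemma Cmod_le_Rabs (z : C) : Cmod z <= Rabs (Re z) + Rabs (Im z).
Proof.
  destruct z as [x y]; unfold Cmod, Re, Im; simpl fst; simpl snd.
  apply Rsqr_incr_0_var.
  - rewrite Rsqr_sqrt by nra.
    unfold Rsqr. pose proof (Rabs_pos x). pose proof (Rabs_pos y).
    replace (x ^ 2 + y ^ 2) with (Rabs x ^ 2 + Rabs y ^ 2) by (rewrite !pow2_abs; ring).
    nra.
  - pose proof (Rabs_pos x). pose proof (Rabs_pos y). lra.
Qed.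

Lemma im_le_Cmod (z : C) : Rabs (Im z) <= Cmod z.
Proof.
  apply Rle_trans with (2 := Rmax_Cmod z). apply Rmax_r.
Qed.

Lemma Cmod_sqr (z : C) : Cmod z * Cmod z = Re z * Re z + Im z * Im z.
Proof. pose proof (Cmod2_alt z). nra. Qed.

Lemma Cmod_minus_sym (z w : C) : Cmod (z - w) = Cmod (w - z).
Proof. rewrite <- Cmod_opp. f_equal. ring. Qed.

Lemma Cmod_triangle_minus (z w : C) : Cmod (z - w) <= Cmod z + Cmod w.
Proof.
  unfold Cminus. apply Rle_trans with (1 := Cmod_triangle _ _).
  rewrite Cmod_opp. lra.
Qed.

Lemma Cmod_triangle_rev (z w : C) : Cmod z - Cmod w <= Cmod (z - w).
Proof.
  pose proof (Cmod_triangle (z - w) w) as H.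
  replace (z - w + w)%C with z in H by ring. lra.
Qed.

Lemma Re_Im_eq (z w : C) : Re z = Re w -> Im z = Im w -> z = w.
Proof. destruct z, w; unfold Re, Im; simpl; intros; subst; reflexivity. Qed.

Lemma Cmod_le_0_eq (z : C) : Cmod z <= 0 -> z = RtoC 0.
Proof. intro H. apply Cmod_eq_0. pose proof (Cmod_ge_0 z). lra. Qed.

Lemma Ceq_minus (z w : C) : (z - w)%C = RtoC 0 -> z = w.
Proof. intro H. replace z with (z - w + w)%C by ring. rewrite H. ring. Qed.

Lemma Rle_0_of_all_eps (x : R) : (forall eps, 0 < eps -> x <= eps) -> x <= 0.
Proof.
  intro H. destruct (Rle_dec x 0) as [Hx|Hx]; [exact Hx|].
  specialize (H (x / 2)). lra.
Qed.

(** * Complex-valued functions of a real variable *)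

(** Componentwise, so that theorems on real functions apply to each part; [cderiv_eps] gives the
    equivalent estimate in the modulus. *)
Definition cderiv (f : R -> C) (x : R) (l : C) : Prop :=
  is_derive (fun t => Re (f t)) x (Re l) /\ is_derive (fun t => Im (f t)) x (Im l).

Definition ccont (f : R -> C) : Prop :=
  forall x, continuous (fun t => Re (f t)) x /\ continuous (fun t => Im (f t)) x.

Lemma is_derive_eq (f : R -> R) (x l l' : R) :
  is_derive f x l -> l = l' -> is_derive f x l'.
Proof. intros H e; rewrite <- e; exact H. Qed.

Lemma cderiv_eq (f : R -> C) (x : R) (l l' : C) :
  cderiv f x l -> l = l' -> cderiv f x l'.
Proof. intros H e; rewrite <- e; exact H. Qed.

Lemma cderiv_ext_loc (f g : R -> C) (x : R) (l : C) :
  locally x (fun t => f t = g t) -> cderiv f x l -> cderiv g x l.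
Proof.
  intros H [h1 h2]; split.
  - refine (is_derive_ext_loc _ _ _ _ _ h1). revert H. apply filter_imp. intros t e; now rewrite e.
  - refine (is_derive_ext_loc _ _ _ _ _ h2). revert H. apply filter_imp. intros t e; now rewrite e.
Qed.

Lemma cderiv_ext (f g : R -> C) (x : R) (l : C) :
  (forall t, f t = g t) -> cderiv f x l -> cderiv g x l.
Proof.
  intros H. apply cderiv_ext_loc. now apply filter_forall.
Qed.

Lemma cderiv_const (c : C) (x : R) : cderiv (fun _ => c) x (RtoC 0).
Proof. split; apply (is_derive_const (K := R_AbsRing) (V := R_NormedModule)). Qed.

Lemma cderiv_id (x : R) : cderiv (fun t => RtoC t) x (RtoC 1).
Proof.
  split; simpl.
  - apply (is_derive_id (K := R_AbsRing)).
  - apply (is_derive_const (K := R_AbsRing) (V := R_NormedModule)).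
Qed.

Lemma cderiv_plus (f g : R -> C) (x : R) (l m : C) :
  cderiv f x l -> cderiv g x m -> cderiv (fun t => f t + g t)%C x (l + m)%C.
Proof.
  intros [a1 a2] [b1 b2]; split; simpl.
  - exact (is_derive_plus _ _ _ _ _ a1 b1).
  - exact (is_derive_plus _ _ _ _ _ a2 b2).
Qed.

Lemma cderiv_opp (f : R -> C) (x : R) (l : C) :
  cderiv f x l -> cderiv (fun t => - f t)%C x (- l)%C.
Proof.
  intros [a1 a2]; split; simpl.
  - exact (is_derive_opp _ _ _ a1).
  - exact (is_derive_opp _ _ _ a2).
Qed.

Lemma cderiv_minus (f g : R -> C) (x : R) (l m : C) :
  cderiv f x l -> cderiv g x m -> cderiv (fun t => f t - g t)%C x (l - m)%C.
Proof.
  intros a b. apply cderiv_plus; [exact a | now apply cderiv_opp].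
Qed.

Lemma is_derive_Rmult (f g : R -> R) (x l m : R) :
  is_derive f x l -> is_derive g x m ->
  is_derive (fun t => f t * g t) x (l * g x + f x * m).
Proof.
  intros a b. exact (is_derive_mult _ _ _ _ _ a b Rmult_comm).
Qed.

Lemma cderiv_mult (f g : R -> C) (x : R) (l m : C) :
  cderiv f x l -> cderiv g x m ->
  cderiv (fun t => f t * g t)%C x (l * g x + f x * m)%C.
Proof.
  intros [a1 a2] [b1 b2]; split.
  - apply is_derive_ext with (fun t => Re (f t) * Re (g t) - Im (f t) * Im (g t)).
    { intro t; now rewrite re_mult. }
    eapply is_derive_eq.
    + exact (is_derive_minus _ _ _ _ _ (is_derive_Rmult _ _ _ _ _ a1 b1)
               (is_derive_Rmult _ _ _ _ _ a2 b2)).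
    + rewrite re_plus, !re_mult. unfold minus, plus, opp; simpl. ring.
  - apply is_derive_ext with (fun t => Re (f t) * Im (g t) + Im (f t) * Re (g t)).
    { intro t; now rewrite im_mult. }
    eapply is_derive_eq.
    + exact (is_derive_plus _ _ _ _ _ (is_derive_Rmult _ _ _ _ _ a1 b2)
               (is_derive_Rmult _ _ _ _ _ a2 b1)).
    + rewrite im_plus, !im_mult. unfold plus; simpl. ring.
Qed.

Lemma cderiv_scal (f : R -> C) (c : C) (x : R) (l : C) :
  cderiv f x l -> cderiv (fun t => c * f t)%C x (c * l)%C.
Proof.
  intro H. eapply cderiv_eq.
  - exact (cderiv_mult _ _ _ _ _ (cderiv_const c x) H).
  - cbv beta; ring.
Qed.

Lemma is_derive_continuous (f : R -> R) (x l : R) : is_derive f x l -> continuous f x.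
Proof. intro H. apply (@ex_derive_continuous R_AbsRing R_NormedModule). now exists l. Qed.

Lemma ccont_cderiv (f f' : R -> C) : (forall x, cderiv f x (f' x)) -> ccont f.
Proof.
  intros H x; destruct (H x) as [a b]; split; eapply is_derive_continuous; eassumption.
Qed.

Lemma cderiv_unique (f : R -> C) (x : R) (l m : C) : cderiv f x l -> cderiv f x m -> l = m.
Proof.
  intros [a1 a2] [b1 b2]. apply Re_Im_eq.
  - rewrite <- (is_derive_unique _ _ _ a1). now apply is_derive_unique.
  - rewrite <- (is_derive_unique _ _ _ a2). now apply is_derive_unique.
Qed.

Lemma ccont_const (c : C) : ccont (fun _ => c).
Proof. intro x; split; apply continuous_const. Qed.

Lemma ccont_plus (f g : R -> C) : ccont f -> ccont g -> ccont (fun t => f t + g t)%C.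
Proof.
  intros F G x; destruct (F x) as [a1 a2], (G x) as [b1 b2]; split; simpl.
  - exact (continuous_plus _ _ _ a1 b1).
  - exact (continuous_plus _ _ _ a2 b2).
Qed.

Lemma ccont_opp (f : R -> C) : ccont f -> ccont (fun t => - f t)%C.
Proof.
  intros F x; destruct (F x) as [a1 a2]; split; simpl.
  - exact (continuous_opp _ _ a1).
  - exact (continuous_opp _ _ a2).
Qed.

Lemma ccont_minus (f g : R -> C) : ccont f -> ccont g -> ccont (fun t => f t - g t)%C.
Proof. intros F G. apply ccont_plus; [exact F | now apply ccont_opp]. Qed.

Lemma ccont_mult (f g : R -> C) : ccont f -> ccont g -> ccont (fun t => f t * g t)%C.
Proof.
  intros F G x; destruct (F x) as [a1 a2], (G x) as [b1 b2]; split; simpl.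
  - exact (continuous_minus _ _ _ (continuous_mult _ _ _ a1 b1) (continuous_mult _ _ _ a2 b2)).
  - exact (continuous_plus _ _ _ (continuous_mult _ _ _ a1 b2) (continuous_mult _ _ _ a2 b1)).
Qed.

Definition CInt (f : R -> C) (a b : R) : C :=
  (RInt (fun t => Re (f t)) a b, RInt (fun t => Im (f t)) a b).

Lemma is_derive_RInt_cont (f : R -> R) (a x : R) :
  (forall t, continuous f t) -> is_derive (fun t => RInt f a t) x (f x).
Proof.
  intro F. apply (is_derive_RInt (V := R_NormedModule)) with a.
  - apply filter_forall. intro t. apply (RInt_correct (V := R_CompleteNormedModule)).
    apply (@ex_RInt_continuous R_CompleteNormedModule). intros; apply F.
  - apply F.
Qed.

Lemma cderiv_CInt (f : R -> C) (a x : R) : ccont f -> cderiv (CInt f a) x (f x).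
Proof.
  intro F; split; unfold CInt; simpl.
  - exact (is_derive_RInt_cont _ a x (fun t => proj1 (F t))).
  - exact (is_derive_RInt_cont (fun t => Im (f t)) a x (fun t => proj2 (F t))).
Qed.

Lemma RInt_of_derive (F f : R -> R) (a b : R) :
  (forall x, is_derive F x (f x)) -> (forall x, continuous f x) -> RInt f a b = F b - F a.
Proof.
  intros H K.
  apply (is_RInt_unique (V := R_CompleteNormedModule)).
  exact (is_RInt_derive (V := R_CompleteNormedModule) F f a b
           (fun x _ => H x) (fun x _ => K x)).
Qed.

Lemma CInt_of_cderiv (F f : R -> C) (a b : R) :
  (forall x, cderiv F x (f x)) -> ccont f -> CInt f a b = (F b - F a)%C.
Proof.
  intros H K. apply Re_Im_eq; simpl.
  - exact (RInt_of_derive (fun t => Re (F t)) (fun t => Re (f t)) a b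
             (fun x => proj1 (H x)) (fun x => proj1 (K x))).
  - exact (RInt_of_derive (fun t => Im (F t)) (fun t => Im (f t)) a b
             (fun x => proj2 (H x)) (fun x => proj2 (K x))).
Qed.

Lemma CInt_point (f : R -> C) (a : R) : CInt f a a = RtoC 0.
Proof. unfold CInt. now rewrite !RInt_point. Qed.

Lemma CInt_ext (f g : R -> C) (a b : R) : (forall t, f t = g t) -> CInt f a b = CInt g a b.
Proof. intro H. unfold CInt. f_equal; apply RInt_ext; intros x _; now rewrite H. Qed.

(** Linearity is read off from the fundamental theorem: as a function of the upper limit, the right
    side is a primitive of the integrand that vanishes at [a]. *)
Lemma CInt_minus (f g : R -> C) (a b : R) : ccont f -> ccont g ->
  CInt (fun t => f t - g t)%C a b = (CInt f a b - CInt g a b)%C.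
Proof.
  intros F G.
  replace (CInt f a b - CInt g a b)%C
    with (CInt f a b - CInt g a b - (CInt f a a - CInt g a a))%C by (rewrite !CInt_point; ring).
  apply (CInt_of_cderiv (fun x => CInt f a x - CInt g a x)%C).
  - intro x. apply cderiv_minus; now apply cderiv_CInt.
  - now apply ccont_minus.
Qed.

Lemma CInt_scal (f : R -> C) (c : C) (a b : R) : ccont f ->
  CInt (fun t => c * f t)%C a b = (c * CInt f a b)%C.
Proof.
  intros F.
  replace (c * CInt f a b)%C with (c * CInt f a b - c * CInt f a a)%C
    by (rewrite !CInt_point; ring).
  apply (CInt_of_cderiv (fun x => c * CInt f a x)%C).
  - intro x. apply cderiv_scal; now apply cderiv_CInt.
  - apply ccont_mult; [apply ccont_const | exact F].
Qed.

Lemma RInt_abs_le_fun (f g : R -> R) (a b : R) : a <= b ->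
  (forall x, continuous f x) -> (forall x, continuous g x) ->
  (forall x, a <= x <= b -> Rabs (f x) <= g x) -> Rabs (RInt f a b) <= RInt g a b.
Proof.
  intros ab F G H.
  assert (E : forall h : R -> R, (forall x, continuous h x) -> ex_RInt h a b).
  { intros h Hh. apply (@ex_RInt_continuous R_CompleteNormedModule). intros; apply Hh. }
  apply (norm_RInt_le (V := R_NormedModule) f g a b); [exact ab | exact H | |];
    apply (RInt_correct (V := R_CompleteNormedModule)); now apply E.
Qed.

(** The factor 2 comes from estimating the two components separately. It recurs in all later bounds
    and is harmless there. *)
Lemma CInt_bound_fun (f : R -> C) (g : R -> R) (a b : R) : a <= b -> ccont f ->
  (forall x, continuous g x) ->
  (forall x, a <= x <= b -> Cmod (f x) <= g x) -> Cmod (CInt f a b) <= 2 * RInt g a b.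
Proof.
  intros ab F G H.
  apply Rle_trans with (1 := Cmod_le_Rabs _). simpl.
  assert (Rabs (RInt (fun t => Re (f t)) a b) <= RInt g a b).
  { apply RInt_abs_le_fun; [exact ab | exact (fun t => proj1 (F t)) | exact G |].
    intros x Hx. apply Rle_trans with (2 := H x Hx). apply re_le_Cmod. }
  assert (Rabs (RInt (fun t => Im (f t)) a b) <= RInt g a b).
  { apply RInt_abs_le_fun; [exact ab | exact (fun t => proj2 (F t)) | exact G |].
    intros x Hx. apply Rle_trans with (2 := H x Hx). apply im_le_Cmod. }
  lra.
Qed.

Lemma CInt_bound (f : R -> C) (K a b : R) : a <= b -> ccont f ->
  (forall x, a <= x <= b -> Cmod (f x) <= K) -> Cmod (CInt f a b) <= 2 * K * (b - a).
Proof.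
  intros ab F H.
  apply Rle_trans with (1 := CInt_bound_fun f (fun _ => K) a b ab F
     (fun x => continuous_const K x) H).
  rewrite RInt_const. unfold scal; simpl; unfold mult; simpl. lra.
Qed.

(** * Monotonicity and differential inequalities *)

Lemma nonincreasing_of_derive (f df : R -> R) (a b : R) : a <= b ->
  (forall x, a <= x <= b -> is_derive f x (df x)) ->
  (forall x, a <= x <= b -> df x <= 0) -> f b <= f a.
Proof.
  intros ab D N.
  destruct (MVT_gen f a b df) as [c [Hc E]].
  - intros x Hx. rewrite Rmin_left, Rmax_right in Hx by exact ab. apply D; lra.
  - intros x Hx. rewrite Rmin_left, Rmax_right in Hx by exact ab.
    apply continuity_pt_filterlim. apply is_derive_continuous with (df x). apply D; lra.
  - rewrite Rmin_left, Rmax_right in Hc by exact ab.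
    specialize (N c Hc). nra.
Qed.

Lemma const_of_derive_0 (f : R -> R) (a b : R) :
  (forall x, a < x < b -> is_derive f x 0) -> (forall x, a <= x <= b -> continuous f x) ->
  forall x, a <= x <= b -> f x = f a.
Proof.
  intros D K x Hx.
  destruct (MVT_gen f a x (fun _ => 0)) as [c [Hc E]].
  - intros y Hy. rewrite Rmin_left, Rmax_right in Hy by lra. apply D; lra.
  - intros y Hy. rewrite Rmin_left, Rmax_right in Hy by lra.
    apply continuity_pt_filterlim. apply K; lra.
  - lra.
Qed.

Lemma const_of_cderiv_0 (f : R -> C) (a b : R) :
  (forall x, a < x < b -> cderiv f x (RtoC 0)) -> ccont f ->
  forall x, a <= x <= b -> f x = f a.
Proof.
  intros D K x Hx. apply Re_Im_eq.
  - exact (const_of_derive_0 (fun t => Re (f t)) a b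
             (fun y Hy => proj1 (D y Hy)) (fun y _ => proj1 (K y)) x Hx).
  - exact (const_of_derive_0 (fun t => Im (f t)) a b
             (fun y Hy => proj2 (D y Hy)) (fun y _ => proj2 (K y)) x Hx).
Qed.

Lemma is_derive_exp_lin (w x : R) : is_derive (fun t => exp (w * t)) x (w * exp (w * x)).
Proof. auto_derive; [exact I | ring]. Qed.

(** The product of [E] and [exp (- w * x)] does not increase. Later uses take a negative [w], to
    obtain decay, and an [E] of unknown sign. *)
Lemma gronwall (E dE : R -> R) (w a b : R) : a <= b ->
  (forall x, a <= x <= b -> is_derive E x (dE x)) ->
  (forall x, a <= x <= b -> dE x <= w * E x) -> E b <= E a * exp (w * (b - a)).
Proof.
  intros ab D N.
  assert (H : E b * exp (- w * b) <= E a * exp (- w * a)).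
  { apply (nonincreasing_of_derive (fun x => E x * exp (- w * x))
      (fun x => dE x * exp (- w * x) + E x * (- w * exp (- w * x)))); [exact ab | |].
    - intros x Hx. exact (is_derive_Rmult _ (fun t => exp (- w * t)) _ _ _ (D x Hx) (is_derive_exp_lin (- w) x)).
    - intros x Hx. specialize (N x Hx). pose proof (exp_pos (- w * x)). nra. }
  apply Rmult_le_reg_r with (exp (- w * b)); [apply exp_pos |].
  rewrite Rmult_assoc, <- exp_plus.
  replace (w * (b - a) + - w * b) with (- w * a) by ring. exact H.
Qed.

(** * Geometric convergence *)

Lemma half_pow_small (c eps : R) : 0 < eps -> exists n : nat, c * (1 / 2) ^ n <= eps.
Proof.
  intro He.
  destruct (pow_lt_1_zero (1 / 2)) with (y := eps / (Rabs c + 1)) as [n Hn].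
  - rewrite Rabs_pos_eq; lra.
  - apply Rdiv_lt_0_compat; [exact He |]. pose proof (Rabs_pos c); lra.
  - exists n. specialize (Hn n (le_n _)).
    rewrite Rabs_pos_eq in Hn by (apply pow_le; lra).
    pose proof (Rabs_pos c). pose proof (Rle_abs c).
    assert (0 < (1 / 2) ^ n) by (apply pow_lt; lra).
    apply Rlt_div_r in Hn; [| lra]. nra.
Qed.

Lemma le_0_of_half_pow (x c : R) : (forall n : nat, x <= c * (1 / 2) ^ n) -> x <= 0.
Proof.
  intro H. apply Rle_0_of_all_eps. intros eps He.
  destruct (half_pow_small c eps He) as [n Hn]. specialize (H n). lra.
Qed.

(** The bound is the exact geometric sum, kept as a difference of two powers, so that each induction
    step adds precisely [c * (1 / 2) ^ (n + k)]. *)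
Lemma geometric_steps (r : nat -> R) (c : R) :
  (forall n, Rabs (r (S n) - r n) <= c * (1 / 2) ^ n) ->
  forall n k, Rabs (r (n + k)%nat - r n) <= 2 * c * (1 / 2) ^ n - 2 * c * (1 / 2) ^ (n + k).
Proof.
  intros H n k. induction k as [|k IH].
  - rewrite Nat.add_0_r. rewrite Rminus_diag, Rabs_R0. lra.
  - replace (n + S k)%nat with (S (n + k)) by lia.
    specialize (H (n + k)%nat).
    replace (r (S (n + k)) - r n)
      with ((r (S (n + k)) - r (n + k)%nat) + (r (n + k)%nat - r n)) by ring.
    apply Rle_trans with (1 := Rabs_triang _ _). simpl. lra.
Qed.

Lemma geometric_limit (r : nat -> R) (c : R) :
  (forall n, Rabs (r (S n) - r n) <= c * (1 / 2) ^ n) ->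
  exists l, forall n, Rabs (l - r n) <= 2 * c * (1 / 2) ^ n.
Proof.
  intro H.
  assert (Hc : 0 <= c).
  { specialize (H 0%nat). pose proof (Rabs_pos (r 1%nat - r 0%nat)). simpl in H. lra. }
  assert (B : forall n k, Rabs (r (n + k)%nat - r n) <= 2 * c * (1 / 2) ^ n).
  { intros n k. apply Rle_trans with (1 := geometric_steps r c H n k).
    assert (0 <= (1 / 2) ^ (n + k)) by (apply pow_le; lra). nra. }
  destruct (Rcomplete.R_complete r) as [l Hl].
  { intros eps He. destruct (half_pow_small (2 * c) (eps / 3)) as [n Hn]; [lra |].
    exists n. intros i j Hi Hj. unfold Rdist.
    pose proof (B n (i - n)%nat) as Bi. pose proof (B n (j - n)%nat) as Bj.
    replace (n + (i - n))%nat with i in Bi by lia.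
    replace (n + (j - n))%nat with j in Bj by lia.
    replace (r i - r j) with ((r i - r n) - (r j - r n)) by ring.
    apply Rle_lt_trans with (1 := Rabs_triang _ _). rewrite Rabs_Ropp. lra. }
  exists l. intro n.
  apply le_epsilon. intros eps He.
  destruct (Hl eps He) as [m Hm].
  specialize (Hm (n + m)%nat ltac:(lia)). unfold Rdist in Hm.
  specialize (B n m).
  replace (l - r n) with ((r (n + m)%nat - r n) - (r (n + m)%nat - l)) by ring.
  apply Rle_trans with (1 := Rabs_triang _ _). rewrite Rabs_Ropp. lra.
Qed.

Lemma geometric_limit_C (r : nat -> C) (c : R) :
  (forall n, Cmod (r (S n) - r n) <= c * (1 / 2) ^ n) ->
  exists l : C, forall n, Cmod (l - r n) <= 4 * c * (1 / 2) ^ n.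
Proof.
  intro H.
  destruct (geometric_limit (fun n => Re (r n)) c) as [x Hx].
  { intro n. apply Rle_trans with (2 := H n).
    apply (re_le_Cmod (r (S n) - r n)%C). }
  destruct (geometric_limit (fun n => Im (r n)) c) as [y Hy].
  { intro n. apply Rle_trans with (2 := H n).
    apply (im_le_Cmod (r (S n) - r n)%C). }
  exists (x, y). intro n. apply Rle_trans with (1 := Cmod_le_Rabs _).
  specialize (Hx n). specialize (Hy n). simpl.
  change (Rabs (x - Re (r n)) + Rabs (y - Im (r n)) <= 4 * c * (1 / 2) ^ n). lra.
Qed.

(** Convergence that is uniform relative to a continuous weight [e] is locally uniform, because [e]
    stays below [e x + 1] near [x]. *)
Lemma continuous_uniform_limit (f : nat -> R -> R) (g e : R -> R) (c : nat -> R) (x : R) :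
  (forall n t, Rabs (g t - f n t) <= c n * e t) -> (forall n t, continuous (f n) t) ->
  continuous e x -> (forall eps, 0 < eps -> exists n, 0 <= c n <= eps) -> (forall t, 0 <= e t) ->
  continuous g x.
Proof.
  intros B F E S0 Epos. apply continuity_pt_filterlim. intros eps He.
  set (k := e x + 1). assert (kpos : 0 < k) by (unfold k; specialize (Epos x); lra).
  destruct (S0 (eps / (4 * k))) as [n Hn].
  { apply Rdiv_lt_0_compat; lra. }
  assert (Hk : c n * k <= eps / 4).
  { apply Rle_trans with (eps / (4 * k) * k); [nra | right; field; lra]. }
  destruct (proj2 (continuity_pt_filterlim e x) E 1 ltac:(lra)) as [d1 [d1p H1]].
  destruct (proj2 (continuity_pt_filterlim (f n) x) (F n x) (eps / 4) ltac:(lra)) as [d2 [d2p H2]].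
  exists (Rmin d1 d2). split; [now apply Rmin_glb_lt |].
  intros t [Ht1 Ht2]. simpl in *. unfold Rdist in *.
  specialize (H1 t). specialize (H2 t).
  assert (a1 : Rabs (e t - e x) < 1).
  { apply H1. split; [exact Ht1 |]. apply Rlt_le_trans with (1 := Ht2). apply Rmin_l. }
  assert (a2 : Rabs (f n t - f n x) < eps / 4).
  { apply H2. split; [exact Ht1 |]. apply Rlt_le_trans with (1 := Ht2). apply Rmin_r. }
  pose proof (B n t) as Bt. pose proof (B n x) as Bx.
  apply Rabs_def2 in a1.
  assert (c n * e t <= c n * k) by (apply Rmult_le_compat_l; unfold k; lra).
  assert (c n * e x <= c n * k) by (apply Rmult_le_compat_l; unfold k; lra).
  replace (g t - g x) with ((g t - f n t) + (f n t - f n x) - (g x - f n x)) by ring.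
  apply Rle_lt_trans with (1 := Rabs_triang _ _). rewrite Rabs_Ropp.
  pose proof (Rabs_triang (g t - f n t) (f n t - f n x)). lra.
Qed.

Lemma CInt_swap (f : R -> C) (a b : R) : ccont f -> CInt f b a = (- CInt f a b)%C.
Proof.
  intro F. pose proof (CInt_of_cderiv (CInt f a) f b a (fun x => cderiv_CInt f a x F) F) as H.
  rewrite H, CInt_point. ring.
Qed.

(** * Linear equations on the whole line *)

Lemma RInt_exp_shift (w a x : R) : w <> 0 ->
  RInt (fun t => exp (w * (t - a))) a x = (exp (w * (x - a)) - 1) / w.
Proof.
  intro Hw.
  rewrite (RInt_of_derive (fun t => exp (w * (t - a)) / w) (fun t => exp (w * (t - a)))).
  - rewrite Rminus_diag, Rmult_0_r, exp_0. req. field. exact Hw.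
  - intro t. auto_derive; [exact I | req; field; exact Hw].
  - intro t. apply is_derive_continuous with (w * exp (w * (t - a))). auto_derive; [exact I | req; ring].
Qed.

(** Integration from [a] divides the weight [exp (w * |t - a|)] by [w]. This gain turns the Picard
    operator into a contraction on the whole line at once, without gluing of local solutions. *)
Lemma CInt_exp_bound (f : R -> C) (a c w x : R) : 0 < w -> 0 <= c -> ccont f ->
  (forall t, Cmod (f t) <= c * exp (w * Rabs (t - a))) ->
  Cmod (CInt f a x) <= 2 * c / w * exp (w * Rabs (x - a)).
Proof.
  intros Hw Hc F B.
  destruct (Rle_dec a x) as [Hx|Hx].
  - assert (K : Cmod (CInt f a x) <= 2 * RInt (fun t => scal c (exp (w * (t - a)))) a x).
    { apply CInt_bound_fun; [exact Hx | exact F | |].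
      - intro t. apply is_derive_continuous with (c * (w * exp (w * (t - a)))).
        unfold scal; simpl; unfold mult; simpl. auto_derive; [exact I | req; ring].
      - intros t Ht. specialize (B t). rewrite Rabs_pos_eq in B by lra. exact B. }
    rewrite (RInt_scal (V := R_CompleteNormedModule)) in K.
    2:{ apply (@ex_RInt_continuous R_CompleteNormedModule). intros t _.
        apply is_derive_continuous with (w * exp (w * (t - a))). auto_derive; [exact I | req; ring]. }
    rewrite RInt_exp_shift in K by lra.
    unfold scal in K; simpl in K; unfold mult in K; simpl in K.
    apply Rle_trans with (1 := K). rewrite Rabs_pos_eq by lra.
    apply Rle_trans with (2 * (c * (exp (w * (x - a)) / w))).
    + apply Rmult_le_compat_l; [lra |]. apply Rmult_le_compat_l; [lra |].
      apply Rmult_le_compat_r; [| lra]. left; now apply Rinv_0_lt_compat.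
    + right; field; lra.
  - rewrite CInt_swap, Cmod_opp by exact F.
    assert (K : Cmod (CInt f x a) <= 2 * RInt (fun t => scal c (exp (- w * (t - a)))) x a).
    { apply CInt_bound_fun; [lra | exact F | |].
      - intro t. apply is_derive_continuous with (c * (- w * exp (- w * (t - a)))).
        unfold scal; simpl; unfold mult; simpl. auto_derive; [exact I | req; ring].
      - intros t Ht. specialize (B t). rewrite Rabs_left1 in B by lra.
        replace (- w * (t - a)) with (w * - (t - a)) by ring. exact B. }
    rewrite (RInt_scal (V := R_CompleteNormedModule)) in K.
    2:{ apply (@ex_RInt_continuous R_CompleteNormedModule). intros t _.
        apply is_derive_continuous with (- w * exp (- w * (t - a))). auto_derive; [exact I | req; ring]. }
    rewrite <- (opp_RInt_swap (V := R_CompleteNormedModule)) in K.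
    2:{ apply (@ex_RInt_continuous R_CompleteNormedModule). intros t _.
        apply is_derive_continuous with (- w * exp (- w * (t - a))). auto_derive; [exact I | req; ring]. }
    rewrite RInt_exp_shift in K by lra.
    unfold scal, opp in K; simpl in K; unfold mult in K; simpl in K.
    apply Rle_trans with (1 := K). rewrite Rabs_left1 by lra.
    replace (w * - (x - a)) with (- w * (x - a)) by ring.
    apply Rle_trans with (2 * (c * (exp (- w * (x - a)) / w))).
    + apply Rmult_le_compat_l; [lra |]. apply Rmult_le_compat_l; [lra |].
      replace (- ((exp (- w * (x - a)) - 1) / - w)) with ((exp (- w * (x - a)) - 1) / w)
        by (field; lra).
      apply Rmult_le_compat_r; [| lra]. left; now apply Rinv_0_lt_compat.
    + right; field; lra.
Qed.

(** Carrying the derivative [v] along turns the second-order equation into a first-order system. *)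
Definition is_sol (q : R -> C) (lam : C) (y v : R -> C) : Prop :=
  (forall x, cderiv y x (v x)) /\ (forall x, cderiv v x ((q x - lam) * y x)%C).

Lemma linear_ode_exists (p : R -> C) (M a : R) (A B : C) :
  ccont p -> (forall x, Cmod (p x) <= M) ->
  exists y v : R -> C, (forall x, cderiv y x (v x)) /\
    (forall x, cderiv v x (p x * y x)%C) /\ y a = A /\ v a = B.
Proof.
  intros Hp HM.
  assert (M0 : 0 <= M) by (apply Rle_trans with (2 := HM a); apply Cmod_ge_0).
  (* Two integrations cost [2 / w] each and [p] costs [M], so [Phi] contracts by [4 * M / w^2] in
     the weighted norm; since [w >= 1], this is at most [1 / 2]. *)
  set (w := 8 * M + 1). assert (w1 : 1 <= w) by (unfold w; lra).
  set (e := fun x => exp (w * Rabs (x - a))).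
  set (V := fun (y : R -> C) x => (B + CInt (fun t => p t * y t)%C a x)%C).
  set (Phi := fun (y : R -> C) x => (A + CInt (V y) a x)%C).
  assert (VD : forall y x, ccont y -> cderiv (V y) x (p x * y x)%C).
  { intros y x Hy. unfold V. eapply cderiv_eq.
    - apply cderiv_plus; [apply cderiv_const | apply cderiv_CInt; now apply ccont_mult].
    - ring. }
  assert (Vc : forall y, ccont y -> ccont (V y)).
  { intros y Hy. exact (ccont_cderiv _ _ (fun x => VD y x Hy)). }
  assert (PD : forall y x, ccont y -> cderiv (Phi y) x (V y x)).
  { intros y x Hy. unfold Phi. eapply cderiv_eq.
    - apply cderiv_plus; [apply cderiv_const | apply cderiv_CInt; now apply Vc].
    - ring. }
  assert (Pc : forall y, ccont y -> ccont (Phi y)).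
  { intros y Hy. exact (ccont_cderiv _ _ (fun x => PD y x Hy)). }
  assert (contr : forall y z c, ccont y -> ccont z -> 0 <= c ->
    (forall x, Cmod (y x - z x) <= c * e x) ->
    forall x, Cmod (Phi y x - Phi z x) <= c / 2 * e x).
  { intros y z c Hy Hz Hc Hyz x.
    assert (E1 : forall t, (V y t - V z t)%C = CInt (fun s => p s * (y s - z s))%C a t).
    { intro t. unfold V.
      rewrite (CInt_ext (fun s => p s * (y s - z s))%C (fun s => p s * y s - p s * z s)%C)
        by (intro; ring).
      rewrite CInt_minus by now apply ccont_mult. ring. }
    assert (E2 : (Phi y x - Phi z x)%C = CInt (fun t => V y t - V z t)%C a x).
    { unfold Phi. rewrite CInt_minus by now apply Vc. ring. }
    rewrite E2.
    assert (B1 : forall t, Cmod (V y t - V z t) <= 2 * (M * c) / w * e t).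
    { intro t. rewrite E1. apply CInt_exp_bound; [lra | nra | |].
      - apply ccont_mult; [exact Hp | now apply ccont_minus].
      - intro s. rewrite Cmod_mult. rewrite Rmult_assoc.
        apply Rmult_le_compat; [apply Cmod_ge_0 | apply Cmod_ge_0 | apply HM | apply Hyz]. }
    assert (C1 : 0 <= 2 * (M * c) / w).
    { apply Rmult_le_pos; [nra |]. left; apply Rinv_0_lt_compat; lra. }
    apply Rle_trans with (2 * (2 * (M * c) / w) / w * e x).
    { apply CInt_exp_bound; [lra | exact C1 | | exact B1].
      apply ccont_minus; now apply Vc. }
    apply Rmult_le_compat_r; [left; apply exp_pos |].
    apply Rle_div_l; [lra |].
    replace (2 * (2 * (M * c) / w)) with (4 * M * c / w) by (field; lra).
    apply Rle_div_l; [lra |].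
    assert (0 <= M * c) by nra.
    assert (c * (8 * M) <= c * w) by (apply Rmult_le_compat_l; unfold w; lra).
    assert (0 <= c * w) by nra.
    assert (c * w <= c * w * w) by nra. lra. }
  set (Y := fix Y n := match n with O => Phi (fun _ => RtoC 0) | S n => Phi (Y n) end).
  assert (Yc : forall n, ccont (Y n)).
  { induction n; simpl; [apply Pc; apply ccont_const | now apply Pc]. }
  set (K := Cmod A + 2 * Cmod B).
  assert (K0 : 0 <= K).
  { unfold K. pose proof (Cmod_ge_0 A). pose proof (Cmod_ge_0 B). lra. }
  assert (e1 : forall x, 1 <= e x).
  { intro x. unfold e. pose proof (exp_ineq1_le (w * Rabs (x - a))).
    pose proof (Rabs_pos (x - a)). nra. }
  assert (B0 : forall x, Cmod (Y 0%nat x - RtoC 0) <= K * e x).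
  { intro x. simpl. unfold Phi, K.
    replace (A + CInt (V (fun _ => RtoC 0)) a x - RtoC 0)%C
      with (A + CInt (V (fun _ => RtoC 0)) a x)%C by ring.
    apply Rle_trans with (1 := Cmod_triangle _ _).
    rewrite Rmult_plus_distr_r. apply Rplus_le_compat.
    - pose proof (Cmod_ge_0 A). specialize (e1 x). nra.
    - apply Rle_trans with (2 * Cmod B / w * e x).
      + apply CInt_exp_bound; [lra | apply Cmod_ge_0 | apply Vc; apply ccont_const |].
        intro t. unfold V.
        rewrite (CInt_ext _ (fun s => RtoC 0 * p s)%C) by (intro; ring).
        rewrite CInt_scal by exact Hp.
        replace (B + RtoC 0 * CInt p a t)%C with B by ring.
        specialize (e1 t). unfold e in e1. pose proof (Cmod_ge_0 B). nra.
      + apply Rmult_le_compat_r; [specialize (e1 x); lra |].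
        apply Rle_div_l; [lra |]. pose proof (Cmod_ge_0 B). nra. }
  assert (Bn : forall n x, Cmod (Y (S n) x - Y n x) <= K * (1 / 2) ^ n * e x).
  { induction n as [|n IH]; intro x.
    - simpl pow. rewrite Rmult_1_r.
      apply Rle_trans with (K / 2 * e x).
      + apply (contr (Y 0%nat) (fun _ => RtoC 0)); [apply (Yc 0%nat) | apply ccont_const | exact K0 | exact B0].
      + apply Rmult_le_compat_r; [specialize (e1 x); lra | lra].
    - apply Rle_trans with (K * (1 / 2) ^ n / 2 * e x).
      + apply (contr (Y (S n)) (Y n)); [apply (Yc (S n)) | apply Yc | | exact IH].
        apply Rmult_le_pos; [exact K0 | apply pow_le; lra].
      + right. simpl. field. }
  destruct (choice (fun x l => forall n, Cmod (l - Y n x) <= 4 * (K * e x) * (1 / 2) ^ n))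
    as [y Hy].
  { intro x. apply geometric_limit_C. intro n. specialize (Bn n x). lra. }
  assert (Hsmall : forall eps, 0 < eps -> exists n, 0 <= 4 * K * (1 / 2) ^ n <= eps).
  { intros eps He. destruct (half_pow_small (4 * K) eps He) as [n Hn]. exists n.
    split; [apply Rmult_le_pos; [lra | apply pow_le; lra] | exact Hn]. }
  assert (ec : forall x, continuous e x).
  { intro x. unfold e. apply continuous_comp.
    - apply (continuous_scal_r (V := R_NormedModule) w (fun x => Rabs (x - a))).
      apply continuous_comp; [| apply continuous_Rabs].
      apply is_derive_continuous with 1. auto_derive; [exact I | req; ring].
    - apply is_derive_continuous with (exp (w * Rabs (x - a))). apply is_derive_exp. }
  assert (yc : ccont y).
  { intro x; split.
    - apply (continuous_uniform_limit (fun n t => Re (Y n t)) _ e (fun n => 4 * K * (1 / 2) ^ n));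
        [ | | apply ec | exact Hsmall | intro t; specialize (e1 t); lra].
      + intros n t. specialize (Hy t n).
        apply Rle_trans with (Cmod (y t - Y n t)); [| lra].
        apply (re_le_Cmod (y t - Y n t)%C).
      + intros n t. exact (proj1 (Yc n t)).
    - apply (continuous_uniform_limit (fun n t => Im (Y n t)) _ e (fun n => 4 * K * (1 / 2) ^ n));
        [ | | apply ec | exact Hsmall | intro t; specialize (e1 t); lra].
      + intros n t. specialize (Hy t n).
        apply Rle_trans with (Cmod (y t - Y n t)); [| lra].
        apply (im_le_Cmod (y t - Y n t)%C).
      + intros n t. exact (proj2 (Yc n t)). }
  (* Both [Phi y - Phi (Y n)] and [y - Y (S n)] are of order [(1 / 2) ^ n], and [Phi (Y n)] is
     [Y (S n)]. *)
  assert (fixed : forall x, Phi y x = y x).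
  { intro x. apply Ceq_minus, Cmod_le_0_eq.
    apply le_0_of_half_pow with (8 * K * e x). intro n.
    replace (Phi y x - y x)%C with ((Phi y x - Phi (Y n) x) - (y x - Y (S n) x))%C
      by (simpl; ring).
    apply Rle_trans with (1 := Cmod_triangle_minus _ _).
    assert (Cmod (Phi y x - Phi (Y n) x) <= 4 * K * (1 / 2) ^ n / 2 * e x).
    { apply contr; [exact yc | apply Yc | | ].
      - apply Rmult_le_pos; [lra | apply pow_le; lra].
      - intro t. specialize (Hy t n). lra. }
    pose proof (Hy x (S n)) as H1. change ((1 / 2) ^ S n) with (1 / 2 * (1 / 2) ^ n) in H1.
    assert (0 <= K * (1 / 2) ^ n * e x).
    { apply Rmult_le_pos; [apply Rmult_le_pos; [exact K0 | apply pow_le; lra] |].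
      specialize (e1 x); lra. }
    lra. }
  exists y, (V y). split; [| split; [| split]].
  - intro x. apply cderiv_ext with (Phi y); [exact fixed | now apply PD].
  - intro x. now apply VD.
  - rewrite <- fixed. unfold Phi. rewrite CInt_point. ring.
  - unfold V. rewrite CInt_point. ring.
Qed.

(** * Solutions on an interval *)

Lemma is_sol_ccont (q : R -> C) (lam : C) (y v : R -> C) : is_sol q lam y v -> ccont y /\ ccont v.
Proof. intros [a b]; split; [exact (ccont_cderiv _ _ a) | exact (ccont_cderiv _ _ b)]. Qed.

Lemma is_sol_lin (q : R -> C) (lam A B : C) (y v z w : R -> C) :
  is_sol q lam y v -> is_sol q lam z w ->
  is_sol q lam (fun x => A * y x + B * z x)%C (fun x => A * v x + B * w x)%C.
Proof.
  intros [a1 a2] [b1 b2]; split; intro x.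
  - apply cderiv_plus; now apply cderiv_scal.
  - eapply cderiv_eq; [apply cderiv_plus; apply cderiv_scal; [apply a2 | apply b2] |].
    ring.
Qed.

(** One computation for two potentials and two parameters: equal coefficients give the constancy of
    the Wronskian, different parameters give Lagrange's identity. *)
Lemma cderiv_wronskian (q r : R -> C) (lam mu : C) (y v z w : R -> C) (x : R) :
  is_sol q lam y v -> is_sol r mu z w ->
  cderiv (fun t => y t * w t - v t * z t)%C x ((r x - mu - (q x - lam)) * (y x * z x))%C.
Proof.
  intros [a1 a2] [b1 b2]. eapply cderiv_eq.
  - apply cderiv_minus; apply cderiv_mult; [apply a1 | apply b2 | apply a2 | apply b1].
  - ring.
Qed.

Lemma ccont_wronskian (q r : R -> C) (lam mu : C) (y v z w : R -> C) :
  is_sol q lam y v -> is_sol r mu z w -> ccont (fun t => y t * w t - v t * z t)%C.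
Proof.
  intros H H'. exact (ccont_cderiv _ _ (fun x => cderiv_wronskian _ _ _ _ _ _ _ _ x H H')).
Qed.

Lemma wronskian_const (q r : R -> C) (lam : C) (y v z w : R -> C) (a b : R) :
  is_sol q lam y v -> is_sol r lam z w ->
  (forall x, a <= x <= b -> q x = r x) ->
  forall x, a <= x <= b -> (y x * w x - v x * z x = y a * w a - v a * z a)%C.
Proof.
  intros H H' E x Hx.
  apply (const_of_cderiv_0 (fun t => y t * w t - v t * z t)%C a b);
    [| exact (ccont_wronskian _ _ _ _ _ _ _ _ H H') | exact Hx].
  intros t Ht. eapply cderiv_eq; [exact (cderiv_wronskian _ _ _ _ _ _ _ _ t H H') |].
  rewrite (E t) by lra. ring.
Qed.

Lemma wronskian_const_all (q : R -> C) (lam : C) (y v z w : R -> C) (a x : R) :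
  is_sol q lam y v -> is_sol q lam z w ->
  (y x * w x - v x * z x = y a * w a - v a * z a)%C.
Proof.
  intros H H'.
  destruct (Rle_dec a x) as [Hx|Hx].
  - apply (wronskian_const q q lam y v z w a x H H'); [reflexivity | lra].
  - symmetry. apply (wronskian_const q q lam y v z w x a H H'); [reflexivity | lra].
Qed.

Definition fundamental (q : R -> C) (a : R) (c c1 s s1 : C -> R -> C) : Prop :=
  forall lam, is_sol q lam (c lam) (c1 lam) /\ is_sol q lam (s lam) (s1 lam) /\
    c lam a = RtoC 1 /\ c1 lam a = RtoC 0 /\ s lam a = RtoC 0 /\ s1 lam a = RtoC 1.

Lemma fundamental_exists (q : R -> C) (M a : R) :
  ccont q -> (forall x, Cmod (q x) <= M) -> exists c c1 s s1, fundamental q a c c1 s s1.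
Proof.
  intros Hq HM.
  assert (K : forall A B lam, exists yv : (R -> C) * (R -> C),
    is_sol q lam (fst yv) (snd yv) /\ fst yv a = A /\ snd yv a = B).
  { intros A B lam.
    destruct (linear_ode_exists (fun x => q x - lam)%C (M + Cmod lam) a A B) as (y & v & h1 & h2 & h3 & h4).
    - apply ccont_minus; [exact Hq | apply ccont_const].
    - intro x. apply Rle_trans with (1 := Cmod_triangle_minus _ _). specialize (HM x). lra.
    - exists (y, v). split; [split; assumption | now split]. }
  destruct (choice _ (K (RtoC 1) (RtoC 0))) as [f Hf].
  destruct (choice _ (K (RtoC 0) (RtoC 1))) as [g Hg].
  exists (fun l => fst (f l)), (fun l => snd (f l)), (fun l => fst (g l)), (fun l => snd (g l)).
  intro lam. specialize (Hf lam). specialize (Hg lam). tauto.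
Qed.

Section Fundamental.

Variables (q : R -> C) (a : R) (c c1 s s1 : C -> R -> C).
Hypothesis F : fundamental q a c c1 s s1.

Lemma fundamental_wronskian (lam : C) (x : R) : (c lam x * s1 lam x - c1 lam x * s lam x = RtoC 1)%C.
Proof.
  destruct (F lam) as (h1 & h2 & e1 & e2 & e3 & e4).
  rewrite (wronskian_const_all q lam _ _ _ _ a x h1 h2), e1, e2, e3, e4. ring.
Qed.

(** The constant Wronskians of [y] with [s] and with [c] express [y a] and [v a] through the values
    at [x]; this linear system has determinant 1 and is solved for [y x] and [v x]. *)
Lemma fundamental_repr (lam : C) (y v : R -> C) (x : R) : is_sol q lam y v ->
  (y x = y a * c lam x + v a * s lam x)%C /\ (v x = y a * c1 lam x + v a * s1 lam x)%C.
Proof.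
  intro H. destruct (F lam) as (h1 & h2 & e1 & e2 & e3 & e4).
  pose proof (wronskian_const_all q lam _ _ _ _ a x H h2) as W1.
  pose proof (wronskian_const_all q lam _ _ _ _ a x H h1) as W2.
  rewrite e3, e4 in W1. rewrite e1, e2 in W2.
  assert (W1' : (y a = y x * s1 lam x - v x * s lam x)%C) by (rewrite W1; ring).
  assert (W2' : (v a = v x * c lam x - y x * c1 lam x)%C).
  { replace (v x * c lam x - y x * c1 lam x)%C with (- (y x * c1 lam x - v x * c lam x))%C by ring.
    rewrite W2; ring. }
  pose proof (fundamental_wronskian lam x) as W.
  split.
  - rewrite W1', W2'.
    replace (y x) with (y x * (c lam x * s1 lam x - c1 lam x * s lam x))%C at 1 by (rewrite W; ring).
    ring.
  - rewrite W1', W2'.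
    replace (v x) with (v x * (c lam x * s1 lam x - c1 lam x * s lam x))%C at 1 by (rewrite W; ring).
    ring.
Qed.

(* Lagrange's identity for the parameters lam and mu, solved for y and v. *)
Lemma fundamental_shift (lam mu : C) (y v : R -> C) (x : R) : is_sol q mu y v ->
  (y x = y a * c lam x + v a * s lam x
     + (mu - lam) * (c lam x * CInt (fun t => y t * s lam t)%C a x
                     - s lam x * CInt (fun t => y t * c lam t)%C a x))%C /\
  (v x = y a * c1 lam x + v a * s1 lam x
     + (mu - lam) * (c1 lam x * CInt (fun t => y t * s lam t)%C a x
                     - s1 lam x * CInt (fun t => y t * c lam t)%C a x))%C.
Proof.
  intro H. destruct (F lam) as (h1 & h2 & e1 & e2 & e3 & e4).
  assert (key : forall z w, is_sol q lam z w ->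
    (y x * w x - v x * z x - (y a * w a - v a * z a) = (mu - lam) * CInt (fun t => y t * z t)%C a x)%C).
  { intros z w Hz.
    assert (cz : ccont (fun t => y t * z t)%C).
    { apply ccont_mult; [exact (proj1 (is_sol_ccont _ _ _ _ H)) | exact (proj1 (is_sol_ccont _ _ _ _ Hz))]. }
    rewrite <- CInt_scal by exact cz.
    symmetry. apply (CInt_of_cderiv (fun t => y t * w t - v t * z t)%C).
    - intro t. eapply cderiv_eq; [exact (cderiv_wronskian _ _ _ _ _ _ _ _ t H Hz) |]. ring.
    - apply ccont_mult; [apply ccont_const | exact cz]. }
  pose proof (key _ _ h2) as W1. pose proof (key _ _ h1) as W2.
  rewrite e3, e4 in W1. rewrite e1, e2 in W2.
  set (I1 := CInt (fun t => y t * s lam t)%C a x) in *.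
  set (I2 := CInt (fun t => y t * c lam t)%C a x) in *.
  pose proof (fundamental_wronskian lam x) as W.
  assert (W1' : (y a = y x * s1 lam x - v x * s lam x - (mu - lam) * I1)%C) by (rewrite <- W1; ring).
  assert (W2' : (v a = v x * c lam x - y x * c1 lam x + (mu - lam) * I2)%C) by (rewrite <- W2; ring).
  split.
  - rewrite W1', W2'.
    replace (y x) with (y x * (c lam x * s1 lam x - c1 lam x * s lam x))%C at 1 by (rewrite W; ring).
    ring.
  - rewrite W1', W2'.
    replace (v x) with (v x * (c lam x * s1 lam x - c1 lam x * s lam x))%C at 1 by (rewrite W; ring).
    ring.
Qed.

End Fundamental.

(** * Energy estimates *)

Definition cdot (z w : C) : R := Re z * Re w + Im z * Im w.

Lemma cdot_le (z w : C) : Rabs (cdot z w) <= Cmod z * Cmod w.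
Proof.
  apply Rsqr_incr_0_var.
  - rewrite <- Rsqr_abs. unfold Rsqr, cdot.
    replace (Cmod z * Cmod w * (Cmod z * Cmod w)) with ((Cmod z * Cmod z) * (Cmod w * Cmod w)) by ring.
    rewrite !Cmod_sqr. pose proof (Rle_0_sqr (Re z * Im w - Im z * Re w)). unfold Rsqr in *. nra.
  - apply Rmult_le_pos; apply Cmod_ge_0.
Qed.

Lemma is_derive_cdot (f g : R -> C) (x : R) (l m : C) : cderiv f x l -> cderiv g x m ->
  is_derive (fun t => cdot (f t) (g t)) x (cdot l (g x) + cdot (f x) m).
Proof.
  intros [a1 a2] [b1 b2]. eapply is_derive_eq.
  - exact (is_derive_plus _ _ _ _ _ (is_derive_Rmult _ _ _ _ _ a1 b1)
             (is_derive_Rmult _ _ _ _ _ a2 b2)).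
  - unfold plus, cdot; simpl. ring.
Qed.

Lemma cdot_diag (z : C) : cdot z z = Cmod z * Cmod z.
Proof. rewrite Cmod_sqr. reflexivity. Qed.

Lemma cdot_sym (z w : C) : cdot z w = cdot w z.
Proof. unfold cdot; ring. Qed.

(** The derivative of [|v|^2 + k^2 |y|^2] is twice the inner product of [v] with
    [(q - lam + k^2) y], and [2 k |v| |y|] is at most the energy; hence the rate [D / k]. For
    [lam = k^2] one may take [D = Q], and the energy stays bounded as [k] grows; for [lam = - k^2]
    the rate is [2 k + Q / k], which is the true exponential growth of the squares. *)
Lemma sol_energy (q : R -> C) (lam : C) (y v : R -> C) (k D a b : R) :
  is_sol q lam y v -> 0 < k -> 0 <= D -> a <= b ->
  (forall x, a <= x <= b -> Cmod (q x - lam + RtoC (k * k)) <= D) ->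
  Cmod (v b) * Cmod (v b) + k * k * (Cmod (y b) * Cmod (y b)) <=
  (Cmod (v a) * Cmod (v a) + k * k * (Cmod (y a) * Cmod (y a))) * exp (D / k * (b - a)).
Proof.
  intros [h1 h2] kp Dp ab B.
  rewrite <- !cdot_diag.
  apply (gronwall (fun x => cdot (v x) (v x) + k * k * cdot (y x) (y x))
    (fun x => cdot ((q x - lam) * y x)%C (v x) + cdot (v x) ((q x - lam) * y x)%C
      + k * k * (cdot (v x) (y x) + cdot (y x) (v x)))); [exact ab | |].
  - intros x Hx.
    apply (is_derive_plus (K := R_AbsRing) (V := R_NormedModule) (fun x => cdot (v x) (v x))
      (fun x => k * k * cdot (y x) (y x))).
    + apply is_derive_cdot; apply h2.
    + apply (is_derive_scal (fun x => cdot (y x) (y x))). apply is_derive_cdot; apply h1.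
  - intros x Hx. specialize (B x Hx).
    replace (cdot ((q x - lam) * y x)%C (v x) + cdot (v x) ((q x - lam) * y x)%C
      + k * k * (cdot (v x) (y x) + cdot (y x) (v x)))
      with (2 * cdot (v x) ((q x - lam + RtoC (k * k)) * y x)%C)
      by (unfold cdot; rewrite !re_mult, !im_mult, !re_plus, !im_plus; simpl; ring).
    pose proof (cdot_le (v x) ((q x - lam + RtoC (k * k)) * y x)%C) as H.
    rewrite Cmod_mult in H.
    rewrite !cdot_diag.
    set (V := Cmod (v x)) in *. set (Y := Cmod (y x)) in *.
    assert (0 <= V) by apply Cmod_ge_0. assert (0 <= Y) by apply Cmod_ge_0.
    pose proof (Rle_abs (cdot (v x) ((q x - lam + RtoC (k * k)) * y x)%C)).
    assert (V * (Cmod (q x - lam + RtoC (k * k)) * Y) <= V * (D * Y)).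
    { apply Rmult_le_compat_l; [assumption |]. now apply Rmult_le_compat_r. }
    apply Rle_trans with (D / k * (2 * (V * (k * Y)))).
    + replace (D / k * (2 * (V * (k * Y)))) with (2 * (V * (D * Y))) by (field; lra). lra.
    + apply Rmult_le_compat_l.
      * apply Rmult_le_pos; [exact Dp | left; now apply Rinv_0_lt_compat].
      * pose proof (Rle_0_sqr (V - k * Y)). unfold Rsqr in *. nra.
Qed.

Lemma exp_mono (x y : R) : x <= y -> exp x <= exp y.
Proof.
  intro H. destruct (Rle_lt_or_eq_dec _ _ H) as [h|h].
  - left; now apply exp_increasing.
  - right; now rewrite h.
Qed.

(** With [k] about the square root of [|lam|] this is growth of order one half; with [k] fixed it is
    local boundedness in the parameter. *)
Lemma sol_bound (q : R -> C) (lam : C) (y v : R -> C) (k Q a b : R) :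
  is_sol q lam y v -> 1 <= k -> Cmod lam <= k * k -> a <= b ->
  (forall x, a <= x <= b -> Cmod (q x) <= Q) -> Cmod (y a) <= 1 -> Cmod (v a) <= 1 ->
  Cmod (y b) <= 2 * exp ((Q + 2) * (b - a) * k) /\
  Cmod (v b) <= 2 * k * exp ((Q + 2) * (b - a) * k).
Proof.
  intros H k1 Hl ab HQ Hy Hv.
  assert (Q0 : 0 <= Q) by (apply Rle_trans with (2 := HQ a ltac:(lra)); apply Cmod_ge_0).
  pose proof (sol_energy q lam y v k (Q + 2 * (k * k)) a b H ltac:(lra) ltac:(nra) ab) as E.
  assert (B : forall x, a <= x <= b -> Cmod (q x - lam + RtoC (k * k)) <= Q + 2 * (k * k)).
  { intros x Hx. apply Rle_trans with (1 := Cmod_triangle _ _).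
    rewrite Cmod_R, Rabs_pos_eq by nra.
    pose proof (Cmod_triangle_minus (q x) lam). specialize (HQ x Hx). lra. }
  specialize (E B). clear B.
  set (e := exp ((Q + 2 * (k * k)) / k * (b - a))) in *.
  set (g := exp ((Q + 2) * (b - a) * k)).
  assert (g1 : 1 <= g).
  { unfold g. pose proof (exp_ineq1_le ((Q + 2) * (b - a) * k)).
    assert (0 <= (Q + 2) * (b - a) * k) by (apply Rmult_le_pos; nra). lra. }
  assert (eg : e <= g).
  { unfold e, g. apply exp_mono.
    replace ((Q + 2) * (b - a) * k) with ((Q + 2) * k * (b - a)) by ring.
    apply Rmult_le_compat_r; [lra |]. apply Rle_div_l; [lra |].
    assert (1 <= k * k) by nra. nra. }
  assert (e0 : 0 < e) by apply exp_pos.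
  pose proof (Cmod_ge_0 (y a)). pose proof (Cmod_ge_0 (v a)).
  pose proof (Cmod_ge_0 (y b)). pose proof (Cmod_ge_0 (v b)).
  set (V := Cmod (v b)) in *. set (Y := Cmod (y b)) in *.
  assert (E2 : V * V + k * k * (Y * Y) <= 2 * (k * k) * (g * g)).
  { apply Rle_trans with (1 := E).
    apply Rmult_le_compat; [nra | lra | | nra].
    assert (Cmod (v a) * Cmod (v a) <= 1) by nra.
    assert (Cmod (y a) * Cmod (y a) <= 1) by nra. nra. }
  split.
  - apply Rsqr_incr_0_var; [| lra]. unfold Rsqr.
    assert (k * k * (Y * Y) <= k * k * (2 * (g * g))) by nra.
    assert (Y * Y <= 2 * (g * g)) by (apply Rmult_le_reg_l with (k * k); nra). nra.
  - apply Rsqr_incr_0_var; [| nra]. unfold Rsqr.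
    assert (0 <= k * k * (Y * Y)) by (apply Rmult_le_pos; nra).
    assert (0 <= (k * k) * (g * g)) by (apply Rmult_le_pos; nra). nra.
Qed.

(** * Differentiability in the spectral parameter *)

Definition loc_bounded (a b : R) (Y : C -> R -> C) : Prop :=
  (forall lam, ccont (Y lam)) /\
  forall L, exists K, 0 <= K /\ forall lam t, Cmod lam <= L -> a <= t <= b -> Cmod (Y lam t) <= K.

(* First-order Taylor expansion in the parameter with a locally uniform
   quadratic remainder: such bounds survive integration in t. *)
Definition param_deriv (a b : R) (Y Y1 : C -> R -> C) : Prop :=
  forall L, exists K, 0 <= K /\ forall lam mu t, Cmod lam <= L -> Cmod mu <= L -> a <= t <= b ->
    Cmod (Y mu t - Y lam t - (mu - lam) * Y1 lam t) <= K * (Cmod (mu - lam) * Cmod (mu - lam)).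

(** [n] successive derivatives in the parameter, each continuous in [t] and bounded locally
    uniformly. The derivative is existential, so that each closure lemma can supply its own
    formula. *)
Fixpoint preg (n : nat) (a b : R) (Y : C -> R -> C) : Prop :=
  loc_bounded a b Y /\
  match n with
  | O => True
  | S m => exists Y1, preg m a b Y1 /\ param_deriv a b Y Y1
  end.

Lemma preg_bounded (n : nat) (a b : R) (Y : C -> R -> C) : preg n a b Y -> loc_bounded a b Y.
Proof. destruct n; intro H; apply H. Qed.

Lemma preg_O (a b : R) (Y : C -> R -> C) : loc_bounded a b Y -> preg 0 a b Y.
Proof. intro H; exact (conj H I). Qed.

Lemma preg_S (n : nat) (a b : R) (Y Y1 : C -> R -> C) : loc_bounded a b Y -> preg n a b Y1 ->
  param_deriv a b Y Y1 -> preg (S n) a b Y.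
Proof. intros H1 H2 H3; exact (conj H1 (ex_intro _ Y1 (conj H2 H3))). Qed.

Lemma preg_pred (n : nat) (a b : R) : forall Y, preg (S n) a b Y -> preg n a b Y.
Proof.
  induction n as [|n IH]; intros Y [H1 [Y1 [H2 H3]]].
  - split; [exact H1 | exact I].
  - split; [exact H1 |]. exists Y1. split; [now apply IH | exact H3].
Qed.

Lemma loc_bounded_const (a b : R) (y : R -> C) (K : R) : ccont y ->
  (forall t, a <= t <= b -> Cmod (y t) <= K) -> loc_bounded a b (fun _ => y).
Proof.
  intros Hy B; split; [intro; exact Hy |].
  intro L. exists (Rmax 0 K). split; [apply Rmax_l |].
  intros lam t _ Ht. apply Rle_trans with (1 := B t Ht). apply Rmax_r.
Qed.

Lemma preg_const (n : nat) (a b : R) : forall (y : R -> C) (K : R), ccont y ->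
  (forall t, a <= t <= b -> Cmod (y t) <= K) -> preg n a b (fun _ => y).
Proof.
  induction n as [|n IH]; intros y K Hy B; split; try (now apply loc_bounded_const with K); [exact I |].
  exists (fun _ _ => RtoC 0). split.
  - apply (IH _ 0); [apply ccont_const |]. intros. rewrite Cmod_0. lra.
  - intro L. exists 0. split; [lra |]. intros lam mu t _ _ _.
    replace (y t - y t - (mu - lam) * RtoC 0)%C with (RtoC 0) by ring. rewrite Cmod_0. lra.
Qed.

Lemma loc_bounded_plus (a b : R) (F G : C -> R -> C) : loc_bounded a b F -> loc_bounded a b G ->
  loc_bounded a b (fun l t => F l t + G l t)%C.
Proof.
  intros [f1 f2] [g1 g2]; split.
  - intro lam. now apply ccont_plus.
  - intro L. destruct (f2 L) as [K1 [p1 h1]], (g2 L) as [K2 [p2 h2]].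
    exists (K1 + K2). split; [lra |]. intros lam t Hl Ht.
    apply Rle_trans with (1 := Cmod_triangle _ _).
    specialize (h1 lam t Hl Ht). specialize (h2 lam t Hl Ht). lra.
Qed.

Lemma loc_bounded_mult (a b : R) (F G : C -> R -> C) : loc_bounded a b F -> loc_bounded a b G ->
  loc_bounded a b (fun l t => F l t * G l t)%C.
Proof.
  intros [f1 f2] [g1 g2]; split.
  - intro lam. now apply ccont_mult.
  - intro L. destruct (f2 L) as [K1 [p1 h1]], (g2 L) as [K2 [p2 h2]].
    exists (K1 * K2). split; [nra |]. intros lam t Hl Ht.
    rewrite Cmod_mult. apply Rmult_le_compat; try apply Cmod_ge_0; [now apply h1 | now apply h2].
Qed.

Lemma loc_bounded_int (a b : R) (F : C -> R -> C) : a <= b -> loc_bounded a b F ->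
  loc_bounded a b (fun l => CInt (F l) a).
Proof.
  intros ab [f1 f2]; split.
  - intro lam. apply (ccont_cderiv _ (F lam)). intro x. now apply cderiv_CInt.
  - intro L. destruct (f2 L) as [K1 [p1 h1]].
    exists (2 * K1 * (b - a)). split; [apply Rmult_le_pos; lra |]. intros lam t Hl Ht.
    apply Rle_trans with (2 * K1 * (t - a)).
    + apply CInt_bound; [lra | apply f1 |]. intros x Hx. apply h1; [exact Hl | lra].
    + apply Rmult_le_compat_l; lra.
Qed.

Lemma preg_plus (n : nat) (a b : R) : forall F G, preg n a b F -> preg n a b G ->
  preg n a b (fun l t => F l t + G l t)%C.
Proof.
  induction n as [|n IH]; intros F G [hF HF] [hG HG]; split;
    try (now apply loc_bounded_plus); [exact I |].
  destruct HF as [F1 [a1 a2]], HG as [G1 [b1 b2]].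
  exists (fun l t => F1 l t + G1 l t)%C. split; [now apply IH |].
  intro L. destruct (a2 L) as [K1 [p1 h1]], (b2 L) as [K2 [p2 h2]].
  exists (K1 + K2). split; [lra |]. intros lam mu t Hl Hm Ht.
  specialize (h1 lam mu t Hl Hm Ht). specialize (h2 lam mu t Hl Hm Ht).
  replace (F mu t + G mu t - (F lam t + G lam t) - (mu - lam) * (F1 lam t + G1 lam t))%C
    with ((F mu t - F lam t - (mu - lam) * F1 lam t) + (G mu t - G lam t - (mu - lam) * G1 lam t))%C by ring.
  apply Rle_trans with (1 := Cmod_triangle _ _). lra.
Qed.

Lemma param_deriv_lipschitz (a b : R) (F F1 : C -> R -> C) : loc_bounded a b F1 ->
  param_deriv a b F F1 -> forall L, exists K, 0 <= K /\ forall lam mu t,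
    Cmod lam <= L -> Cmod mu <= L -> a <= t <= b -> Cmod (F mu t - F lam t) <= K * Cmod (mu - lam).
Proof.
  intros [_ B] D L. destruct (B L) as [K1 [p1 h1]], (D L) as [K2 [p2 h2]].
  (* The quadratic remainder becomes linear because [|mu - lam| <= 2 * L]; [Rmax L 0] keeps the
     constant nonnegative when [L] is negative. *)
  exists (K1 + K2 * (2 * Rmax L 0)). split.
  { apply Rplus_le_le_0_compat; [exact p1 |]. apply Rmult_le_pos; [exact p2 |].
    pose proof (Rmax_r L 0). lra. }
  intros lam mu t Hl Hm Ht. specialize (h1 lam t Hl Ht). specialize (h2 lam mu t Hl Hm Ht).
  replace (F mu t - F lam t)%C with ((F mu t - F lam t - (mu - lam) * F1 lam t) + (mu - lam) * F1 lam t)%C by ring.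
  apply Rle_trans with (1 := Cmod_triangle _ _). rewrite Cmod_mult.
  pose proof (Cmod_ge_0 (mu - lam)). pose proof (Cmod_triangle_minus mu lam). pose proof (Rmax_l L 0).
  assert (Cmod (mu - lam) * Cmod (F1 lam t) <= Cmod (mu - lam) * K1) by now apply Rmult_le_compat_l.
  assert (Cmod (mu - lam) * Cmod (mu - lam) <= (2 * Rmax L 0) * Cmod (mu - lam))
    by (apply Rmult_le_compat_r; lra).
  assert (K2 * (Cmod (mu - lam) * Cmod (mu - lam)) <= K2 * ((2 * Rmax L 0) * Cmod (mu - lam)))
    by now apply Rmult_le_compat_l.
  lra.
Qed.

Lemma param_deriv_mult (a b : R) (F G F1 G1 : C -> R -> C) :
  loc_bounded a b F -> loc_bounded a b G -> loc_bounded a b F1 -> loc_bounded a b G1 ->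
  param_deriv a b F F1 -> param_deriv a b G G1 ->
  param_deriv a b (fun l t => F l t * G l t)%C (fun l t => F1 l t * G l t + F l t * G1 l t)%C.
Proof.
  intros BF BG BF1 BG1 DF DG L.
  destruct (param_deriv_lipschitz a b F F1 BF1 DF L) as [k1 [q1 l1]].
  destruct (param_deriv_lipschitz a b G G1 BG1 DG L) as [k2 [q2 l2]].
  destruct (proj2 BF L) as [M1 [m1 b1]], (proj2 BG L) as [M2 [m2 b2]].
  destruct (DF L) as [K1 [p1 h1]], (DG L) as [K2 [p2 h2]].
  exists (K1 * M2 + M1 * K2 + k1 * k2). split.
  { repeat apply Rplus_le_le_0_compat; now apply Rmult_le_pos. }
  intros lam mu t Hl Hm Ht.
  specialize (l1 lam mu t Hl Hm Ht). specialize (l2 lam mu t Hl Hm Ht).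
  specialize (h1 lam mu t Hl Hm Ht). specialize (h2 lam mu t Hl Hm Ht).
  specialize (b1 lam t Hl Ht). specialize (b2 lam t Hl Ht).
  replace (F mu t * G mu t - F lam t * G lam t - (mu - lam) * (F1 lam t * G lam t + F lam t * G1 lam t))%C
    with ((F mu t - F lam t - (mu - lam) * F1 lam t) * G lam t
      + F lam t * (G mu t - G lam t - (mu - lam) * G1 lam t)
      + (F mu t - F lam t) * (G mu t - G lam t))%C by ring.
  apply Rle_trans with (1 := Cmod_triangle _ _).
  rewrite !Rmult_plus_distr_r. apply Rplus_le_compat.
  - apply Rle_trans with (1 := Cmod_triangle _ _). apply Rplus_le_compat; rewrite Cmod_mult.
    + apply Rle_trans with ((K1 * (Cmod (mu - lam) * Cmod (mu - lam))) * M2).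
      * apply Rmult_le_compat; try apply Cmod_ge_0; assumption.
      * right; ring.
    + apply Rle_trans with (M1 * (K2 * (Cmod (mu - lam) * Cmod (mu - lam)))).
      * apply Rmult_le_compat; try apply Cmod_ge_0; assumption.
      * right; ring.
  - rewrite Cmod_mult. apply Rle_trans with ((k1 * Cmod (mu - lam)) * (k2 * Cmod (mu - lam))).
    + apply Rmult_le_compat; try apply Cmod_ge_0; assumption.
    + right; ring.
Qed.

Lemma preg_mult (n : nat) (a b : R) : forall F G, preg n a b F -> preg n a b G ->
  preg n a b (fun l t => F l t * G l t)%C.
Proof.
  induction n as [|n IH]; intros F G pF pG; pose proof pF as [hF HF]; pose proof pG as [hG HG]; split;
    try (now apply loc_bounded_mult); [exact I |].
  destruct HF as [F1 [a1 a2]], HG as [G1 [b1 b2]].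
  exists (fun l t => F1 l t * G l t + F l t * G1 l t)%C. split.
  - apply preg_plus; apply IH; try assumption; now apply preg_pred.
  - apply param_deriv_mult; try assumption; eapply preg_bounded; eassumption.
Qed.

Lemma preg_scal (n : nat) (a b : R) (k : C) (F : C -> R -> C) : preg n a b F ->
  preg n a b (fun l t => k * F l t)%C.
Proof.
  intro H. apply (preg_mult n a b (fun _ _ => k) F); [| exact H].
  apply preg_const with (Cmod k); [apply ccont_const | intros; lra].
Qed.

Lemma preg_ext (n : nat) (a b : R) (F G : C -> R -> C) : (forall l t, F l t = G l t) ->
  preg n a b F -> preg n a b G.
Proof.
  intros E. replace G with F; [easy |].
  apply functional_extensionality; intro l.
  apply functional_extensionality; intro t. apply E.
Qed.

Lemma preg_minus (n : nat) (a b : R) (F G : C -> R -> C) : preg n a b F -> preg n a b G ->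
  preg n a b (fun l t => F l t - G l t)%C.
Proof.
  intros HF HG. apply preg_ext with (fun l t => F l t + (- RtoC 1) * G l t)%C.
  - intros. ring.
  - apply preg_plus; [exact HF | now apply preg_scal].
Qed.

Lemma preg_int (n : nat) (a b : R) : a <= b -> forall F, preg n a b F ->
  preg n a b (fun l => CInt (F l) a).
Proof.
  intro ab. induction n as [|n IH]; intros F [hF HF]; split; try (now apply loc_bounded_int); [exact I |].
  destruct HF as [F1 [a1 a2]].
  exists (fun l => CInt (F1 l) a). split; [now apply IH |].
  pose proof (proj1 (preg_bounded _ _ _ _ a1)) as c1. pose proof (proj1 hF) as c0.
  intro L. destruct (a2 L) as [K1 [p1 h1]].
  exists (2 * K1 * (b - a)). split; [apply Rmult_le_pos; lra |]. intros lam mu t Hl Hm Ht.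
  rewrite <- CInt_scal by apply c1. rewrite <- CInt_minus by apply c0.
  rewrite <- CInt_minus; [| apply ccont_minus; apply c0 | apply ccont_mult; [apply ccont_const | apply c1]].
  set (d := Cmod (mu - lam) * Cmod (mu - lam)) in *.
  assert (d0 : 0 <= d) by (apply Rmult_le_pos; apply Cmod_ge_0).
  apply Rle_trans with (2 * (K1 * d) * (t - a)).
  - apply CInt_bound; [lra | |].
    + apply ccont_minus; [apply ccont_minus; apply c0 | apply ccont_mult; [apply ccont_const | apply c1]].
    + intros x Hx. apply h1; [exact Hl | exact Hm | lra].
  - assert (0 <= K1 * d) by now apply Rmult_le_pos.
    assert (K1 * d * (t - a) <= K1 * d * (b - a)) by (apply Rmult_le_compat_l; lra). lra.
Qed.

Section FundamentalRegular.

Variables (q : R -> C) (a b Q : R) (c c1 s s1 : C -> R -> C).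
Hypothesis ab : a <= b.
Hypothesis F : fundamental q a c c1 s s1.
Hypothesis HQ : forall x, a <= x <= b -> Cmod (q x) <= Q.

Lemma sol_loc_bounded (Y V : C -> R -> C) : (forall l, is_sol q l (Y l) (V l)) ->
  (forall l, Cmod (Y l a) <= 1) -> (forall l, Cmod (V l a) <= 1) ->
  loc_bounded a b Y /\ loc_bounded a b V.
Proof.
  intros HS HY HV.
  assert (Q0 : 0 <= Q) by (apply Rle_trans with (2 := HQ a ltac:(lra)); apply Cmod_ge_0).
  assert (B : forall L lam t, Cmod lam <= L -> a <= t <= b ->
    Cmod (Y lam t) <= 2 * exp ((Q + 2) * (b - a) * (1 + Rabs L)) /\
    Cmod (V lam t) <= 2 * (1 + Rabs L) * exp ((Q + 2) * (b - a) * (1 + Rabs L))).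
  { intros L lam t Hl Ht. pose proof (Rabs_pos L). pose proof (Rle_abs L).
    destruct (sol_bound q lam (Y lam) (V lam) (1 + Rabs L) Q a t) as [b1 b2]; auto; try lra.
    - nra.
    - intros x Hx. apply HQ; lra.
    - assert (e : exp ((Q + 2) * (t - a) * (1 + Rabs L)) <= exp ((Q + 2) * (b - a) * (1 + Rabs L))).
      { apply exp_mono. apply Rmult_le_compat_r; [lra |]. apply Rmult_le_compat_l; lra. }
      split; [lra |]. apply Rle_trans with (1 := b2). apply Rmult_le_compat_l; lra. }
  split; split; try (intro lam; apply (is_sol_ccont _ _ _ _ (HS lam))); intro L.
  - exists (2 * exp ((Q + 2) * (b - a) * (1 + Rabs L))). split.
    + pose proof (exp_pos ((Q + 2) * (b - a) * (1 + Rabs L))). lra.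
    + intros lam t Hl Ht. now apply B.
  - exists (2 * (1 + Rabs L) * exp ((Q + 2) * (b - a) * (1 + Rabs L))). split.
    + pose proof (exp_pos ((Q + 2) * (b - a) * (1 + Rabs L))). pose proof (Rabs_pos L).
      apply Rmult_le_pos; lra.
    + intros lam t Hl Ht. now apply B.
Qed.

Lemma fundamental_loc_bounded :
  loc_bounded a b c /\ loc_bounded a b c1 /\ loc_bounded a b s /\ loc_bounded a b s1.
Proof.
  destruct (sol_loc_bounded c c1) as [h1 h2];
    try (intro l; destruct (F l) as (e1 & e2 & e3 & e4 & e5 & e6)); [exact e1 | | |].
  { rewrite e3, Cmod_1; lra. } { rewrite e4, Cmod_0; lra. }
  destruct (sol_loc_bounded s s1) as [h3 h4];
    try (intro l; destruct (F l) as (e1 & e2 & e3 & e4 & e5 & e6)); [exact e2 | | |].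
  { rewrite e5, Cmod_0; lra. } { rewrite e6, Cmod_1; lra. }
  tauto.
Qed.

(** The derivative of a solution in the parameter: the bracket of Lagrange's identity
    [fundamental_shift] taken at [mu = lam]. *)
Definition param_primitive (Y C1 S1 : C -> R -> C) (l : C) (x : R) : C :=
  (C1 l x * CInt (fun t => Y l t * s l t)%C a x - S1 l x * CInt (fun t => Y l t * c l t)%C a x)%C.

(* Y solves the equation with initial data independent of the parameter;
   (A, B) is (c, s) for Y itself and (c1, s1) for its derivative. *)
Lemma sol_param_deriv (Y Z A B : C -> R -> C) :
  loc_bounded a b Y -> loc_bounded a b A -> loc_bounded a b B ->
  (forall lam mu x, (Z mu x - Z lam x = (mu - lam) * (A lam x * CInt (fun t => Y mu t * s lam t)%C a x
                     - B lam x * CInt (fun t => Y mu t * c lam t)%C a x))%C) ->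
  (forall L, exists K, 0 <= K /\ forall lam mu t, Cmod lam <= L -> Cmod mu <= L -> a <= t <= b ->
     Cmod (Y mu t - Y lam t) <= K * Cmod (mu - lam)) ->
  param_deriv a b Z (param_primitive Y A B).
Proof.
  intros BY BA BB E Lip L.
  destruct fundamental_loc_bounded as (bc & _ & bs & _).
  destruct (Lip L) as [k [k0 hk]].
  destruct (proj2 BA L) as [MA [a0 ha]], (proj2 BB L) as [MB [b0 hb]].
  destruct (proj2 bc L) as [Mc [c0 hc]], (proj2 bs L) as [Ms [s0 hs]].
  exists (MA * (2 * (k * Ms) * (b - a)) + MB * (2 * (k * Mc) * (b - a))).
  split.
  { assert (0 <= k * Ms) by now apply Rmult_le_pos. assert (0 <= k * Mc) by now apply Rmult_le_pos.
    apply Rplus_le_le_0_compat; apply Rmult_le_pos; try assumption; apply Rmult_le_pos; lra. }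
  intros lam mu t Hl Hm Ht. rewrite E. unfold param_primitive.
  assert (cont : forall X, loc_bounded a b X -> forall l l', ccont (fun t => Y l t * X l' t)%C).
  { intros X HX l l'. apply ccont_mult; [apply (proj1 BY) | apply (proj1 HX)]. }
  assert (bd : forall X MX, loc_bounded a b X -> 0 <= MX ->
    (forall l t, Cmod l <= L -> a <= t <= b -> Cmod (X l t) <= MX) ->
    Cmod (CInt (fun t => Y mu t * X lam t)%C a t - CInt (fun t => Y lam t * X lam t)%C a t)
      <= 2 * (k * MX) * (b - a) * Cmod (mu - lam)).
  { intros X MX HX X0 hX. rewrite <- CInt_minus by now apply cont.
    apply Rle_trans with (2 * (k * Cmod (mu - lam) * MX) * (t - a)).
    - apply CInt_bound; [lra | apply ccont_minus; now apply cont |].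
      intros x Hx. replace (Y mu x * X lam x - Y lam x * X lam x)%C with ((Y mu x - Y lam x) * X lam x)%C by ring.
      rewrite Cmod_mult. apply Rmult_le_compat; try apply Cmod_ge_0.
      + apply hk; [exact Hl | exact Hm | lra].
      + apply hX; [exact Hl | lra].
    - assert (0 <= k * Cmod (mu - lam) * MX).
      { apply Rmult_le_pos; [apply Rmult_le_pos; [exact k0 | apply Cmod_ge_0] | exact X0]. }
      assert (k * Cmod (mu - lam) * MX * (t - a) <= k * Cmod (mu - lam) * MX * (b - a))
        by (apply Rmult_le_compat_l; lra). lra. }
  pose proof (bd s Ms bs s0 hs) as B1. pose proof (bd c Mc bc c0 hc) as B2.
  set (d := Cmod (mu - lam)) in *. assert (d0 : 0 <= d) by apply Cmod_ge_0.
  match goal with |- Cmod ?z <= _ => replace z with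
    ((mu - lam) * (A lam t * (CInt (fun t => Y mu t * s lam t)%C a t - CInt (fun t => Y lam t * s lam t)%C a t)
     - B lam t * (CInt (fun t => Y mu t * c lam t)%C a t - CInt (fun t => Y lam t * c lam t)%C a t)))%C by ring end.
  rewrite Cmod_mult. fold d.
  replace ((MA * (2 * (k * Ms) * (b - a)) + MB * (2 * (k * Mc) * (b - a))) * (d * d))
    with (d * (MA * (2 * (k * Ms) * (b - a) * d) + MB * (2 * (k * Mc) * (b - a) * d))) by ring.
  apply Rmult_le_compat_l; [exact d0 |].
  apply Rle_trans with (1 := Cmod_triangle_minus _ _). rewrite !Cmod_mult.
  apply Rplus_le_compat; apply Rmult_le_compat; try apply Cmod_ge_0; auto.
Qed.

(** First pass of a two-step gain: boundedness alone makes the increment linear in [mu - lam], and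
    [sol_param_deriv] inserts this bound under the integral to reach the quadratic remainder. *)
Lemma sol_param_lipschitz (Y Z A B : C -> R -> C) :
  loc_bounded a b Y -> loc_bounded a b A -> loc_bounded a b B ->
  (forall lam mu x, (Z mu x - Z lam x = (mu - lam) * (A lam x * CInt (fun t => Y mu t * s lam t)%C a x
                     - B lam x * CInt (fun t => Y mu t * c lam t)%C a x))%C) ->
  forall L, exists K, 0 <= K /\ forall lam mu t, Cmod lam <= L -> Cmod mu <= L -> a <= t <= b ->
     Cmod (Z mu t - Z lam t) <= K * Cmod (mu - lam).
Proof.
  intros BY BA BB E L.
  destruct fundamental_loc_bounded as (bc & _ & bs & _).
  destruct (proj2 BY L) as [MY [y0 hy]].
  destruct (proj2 BA L) as [MA [a0 ha]], (proj2 BB L) as [MB [b0 hb]].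
  destruct (proj2 bc L) as [Mc [c0 hc]], (proj2 bs L) as [Ms [s0 hs]].
  exists (MA * (2 * (MY * Ms) * (b - a)) + MB * (2 * (MY * Mc) * (b - a))).
  split.
  { assert (0 <= MY * Ms) by now apply Rmult_le_pos. assert (0 <= MY * Mc) by now apply Rmult_le_pos.
    apply Rplus_le_le_0_compat; apply Rmult_le_pos; try assumption; apply Rmult_le_pos; lra. }
  intros lam mu t Hl Hm Ht. rewrite E.
  assert (bd : forall X MX, loc_bounded a b X -> 0 <= MX ->
    (forall l t, Cmod l <= L -> a <= t <= b -> Cmod (X l t) <= MX) ->
    Cmod (CInt (fun t => Y mu t * X lam t)%C a t) <= 2 * (MY * MX) * (b - a)).
  { intros X MX HX X0 hX.
    apply Rle_trans with (2 * (MY * MX) * (t - a)).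
    - apply CInt_bound; [lra | apply ccont_mult; [apply (proj1 BY) | apply (proj1 HX)] |].
      intros x Hx. rewrite Cmod_mult. apply Rmult_le_compat; try apply Cmod_ge_0.
      + apply hy; [exact Hm | lra].
      + apply hX; [exact Hl | lra].
    - assert (0 <= MY * MX) by now apply Rmult_le_pos.
      apply Rmult_le_compat_l; lra. }
  pose proof (bd s Ms bs s0 hs) as B1. pose proof (bd c Mc bc c0 hc) as B2.
  rewrite Cmod_mult, Rmult_comm. apply Rmult_le_compat_r; [apply Cmod_ge_0 |].
  apply Rle_trans with (1 := Cmod_triangle_minus _ _). rewrite !Cmod_mult.
  apply Rplus_le_compat; apply Rmult_le_compat; try apply Cmod_ge_0; auto.
Qed.

Lemma preg_param_primitive (n : nat) (Y A B : C -> R -> C) : preg n a b Y -> preg n a b A ->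
  preg n a b B -> preg n a b c -> preg n a b s -> preg n a b (param_primitive Y A B).
Proof.
  intros. unfold param_primitive. apply preg_minus.
  - apply preg_mult; [assumption |].
    apply (preg_int n a b ab (fun l t => Y l t * s l t)%C). now apply preg_mult.
  - apply preg_mult; [assumption |].
    apply (preg_int n a b ab (fun l t => Y l t * c l t)%C). now apply preg_mult.
Qed.

(** Bootstrapping: the derivatives in the parameter are built from the four solutions by products
    and integrals, so [n] derivatives of the solutions yield [n + 1]. *)
Lemma fundamental_preg (n : nat) : preg n a b c /\ preg n a b c1 /\ preg n a b s /\ preg n a b s1.
Proof.
  destruct fundamental_loc_bounded as (bc & bc1 & bs & bs1).
  assert (Ec : forall lam mu x,
    (c mu x - c lam x = (mu - lam) * (c lam x * CInt (fun t => c mu t * s lam t)%C a x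
        - s lam x * CInt (fun t => c mu t * c lam t)%C a x))%C /\
    (c1 mu x - c1 lam x = (mu - lam) * (c1 lam x * CInt (fun t => c mu t * s lam t)%C a x
        - s1 lam x * CInt (fun t => c mu t * c lam t)%C a x))%C).
  { intros lam mu x. destruct (F mu) as (h1 & h2 & e1 & e2 & e3 & e4).
    destruct (fundamental_shift q a c c1 s s1 F lam mu _ _ x h1) as [E1 E2].
    rewrite e1, e2 in E1, E2. rewrite E1 at 1. rewrite E2 at 1. split; ring. }
  assert (Es : forall lam mu x,
    (s mu x - s lam x = (mu - lam) * (c lam x * CInt (fun t => s mu t * s lam t)%C a x
        - s lam x * CInt (fun t => s mu t * c lam t)%C a x))%C /\
    (s1 mu x - s1 lam x = (mu - lam) * (c1 lam x * CInt (fun t => s mu t * s lam t)%C a x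
        - s1 lam x * CInt (fun t => s mu t * c lam t)%C a x))%C).
  { intros lam mu x. destruct (F mu) as (h1 & h2 & e1 & e2 & e3 & e4).
    destruct (fundamental_shift q a c c1 s s1 F lam mu _ _ x h2) as [E1 E2].
    rewrite e3, e4 in E1, E2. rewrite E1 at 1. rewrite E2 at 1. split; ring. }
  assert (Lc := sol_param_lipschitz c c c s bc bc bs (fun l m x => proj1 (Ec l m x))).
  assert (Ls := sol_param_lipschitz s s c s bs bc bs (fun l m x => proj1 (Es l m x))).
  induction n as [|n (I1 & I2 & I3 & I4)].
  - split; [| split; [| split]]; now apply preg_O.
  - split; [| split; [| split]].
    + apply preg_S with (param_primitive c c s); [exact bc | now apply preg_param_primitive |].
      exact (sol_param_deriv c c c s bc bc bs (fun l m x => proj1 (Ec l m x)) Lc).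
    + apply preg_S with (param_primitive c c1 s1); [exact bc1 | now apply preg_param_primitive |].
      exact (sol_param_deriv c c1 c1 s1 bc bc1 bs1 (fun l m x => proj2 (Ec l m x)) Lc).
    + apply preg_S with (param_primitive s c s); [exact bs | now apply preg_param_primitive |].
      exact (sol_param_deriv s s c s bs bc bs (fun l m x => proj1 (Es l m x)) Ls).
    + apply preg_S with (param_primitive s c1 s1); [exact bs1 | now apply preg_param_primitive |].
      exact (sol_param_deriv s s1 c1 s1 bs bc1 bs1 (fun l m x => proj2 (Es l m x)) Ls).
Qed.

End FundamentalRegular.

(** * Complex differentiability *)

Definition Cder (f : C -> C) (z l : C) : Prop :=
  forall eps, 0 < eps -> exists delta, 0 < delta /\ forall w, Cmod (w - z) < delta ->
    Cmod (f w - f z - l * (w - z)) <= eps * Cmod (w - z).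

Definition Ccontin (f : C -> C) (z : C) : Prop :=
  forall eps, 0 < eps -> exists delta, 0 < delta /\ forall w, Cmod (w - z) < delta ->
    Cmod (f w - f z) < eps.

Definition Cnear (z : C) (P : C -> Prop) : Prop :=
  exists delta, 0 < delta /\ forall w, Cmod (w - z) < delta -> P w.

Lemma Cnear_and (z : C) (P Q : C -> Prop) : Cnear z P -> Cnear z Q -> Cnear z (fun w => P w /\ Q w).
Proof.
  intros [d [dp H]] [e [ep K]]. exists (Rmin d e). split; [now apply Rmin_glb_lt |].
  intros w Hw. split; [apply H | apply K]; apply Rlt_le_trans with (1 := Hw); [apply Rmin_l | apply Rmin_r].
Qed.

Lemma Cnear_self (z : C) (P : C -> Prop) : Cnear z P -> P z.
Proof.
  intros [d [dp H]]. apply H. replace (z - z)%C with (RtoC 0) by ring. now rewrite Cmod_0.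
Qed.

Lemma Cnear_imp (z : C) (P Q : C -> Prop) : (forall w, P w -> Q w) -> Cnear z P -> Cnear z Q.
Proof. intros PQ [d [dp H]]. exists d. split; [exact dp |]. intros w Hw. now apply PQ, H. Qed.

Lemma Cnear_near (z : C) (P : C -> Prop) : Cnear z P -> Cnear z (fun w => Cnear w P).
Proof.
  intros [d [dp H]]. exists (d / 2). split; [lra |]. intros w Hw. exists (d / 2). split; [lra |].
  intros u Hu. apply H. replace (u - z)%C with ((u - w) + (w - z))%C by ring.
  apply Rle_lt_trans with (1 := Cmod_triangle _ _). lra.
Qed.

Lemma Cder_bound (f : C -> C) (z l : C) : Cder f z l ->
  Cnear z (fun w => Cmod (f w - f z) <= (Cmod l + 1) * Cmod (w - z)).
Proof.
  intro H. destruct (H 1 ltac:(lra)) as [d [dp Hd]]. exists d. split; [exact dp |].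
  intros w Hw. specialize (Hd w Hw).
  replace (f w - f z)%C with ((f w - f z - l * (w - z)) + l * (w - z))%C by ring.
  apply Rle_trans with (1 := Cmod_triangle _ _). rewrite Cmod_mult. lra.
Qed.

Lemma Cder_contin (f : C -> C) (z l : C) : Cder f z l -> Ccontin f z.
Proof.
  intros H eps He. destruct (Cder_bound f z l H) as [d [dp Hd]].
  pose proof (Cmod_ge_0 l).
  assert (0 < eps / (Cmod l + 1)) by (apply Rdiv_lt_0_compat; lra).
  exists (Rmin d (eps / (Cmod l + 1))). split; [now apply Rmin_glb_lt |].
  intros w Hw. apply Rle_lt_trans with (1 := Hd w (Rlt_le_trans _ _ _ Hw (Rmin_l _ _))).
  assert (Hw2 : Cmod (w - z) < eps / (Cmod l + 1)) by (apply Rlt_le_trans with (1 := Hw); apply Rmin_r).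
  apply Rlt_div_r in Hw2; [lra | lra].
Qed.

Lemma Cder_unique (f : C -> C) (z l m : C) : Cder f z l -> Cder f z m -> l = m.
Proof.
  intros H K. apply Ceq_minus, Cmod_le_0_eq, Rle_0_of_all_eps. intros eps He.
  destruct (H (eps / 2) ltac:(lra)) as [d [dp Hd]], (K (eps / 2) ltac:(lra)) as [e [ep Ke]].
  set (r := Rmin d e / 2). assert (r0 : 0 < Rmin d e) by now apply Rmin_glb_lt.
  pose proof (Rmin_l d e). pose proof (Rmin_r d e).
  assert (E : (z + RtoC r - z)%C = RtoC r) by ring.
  assert (Er : Cmod (RtoC r) = r) by (rewrite Cmod_R; apply Rabs_pos_eq; unfold r; lra).
  specialize (Hd (z + RtoC r)%C). specialize (Ke (z + RtoC r)%C).
  rewrite E, Er in Hd, Ke. unfold r in Hd at 1. unfold r in Ke at 1.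
  specialize (Hd ltac:(lra)). specialize (Ke ltac:(lra)).
  assert (B : Cmod ((l - m) * RtoC r) <= eps * r).
  { replace ((l - m) * RtoC r)%C with ((f (z + RtoC r)%C - f z - m * RtoC r) - (f (z + RtoC r)%C - f z - l * RtoC r))%C by ring.
    apply Rle_trans with (1 := Cmod_triangle_minus _ _). lra. }
  rewrite Cmod_mult, Er in B. apply Rmult_le_reg_r with r; [unfold r; lra | exact B].
Qed.

Lemma Cder_ext_near (f g : C -> C) (z l : C) : Cnear z (fun w => f w = g w) -> Cder f z l -> Cder g z l.
Proof.
  intros E H eps He. pose proof (Cnear_self _ _ E) as Ez. cbv beta in Ez.
  destruct E as [e [ep E]]. destruct (H eps He) as [d [dp Hd]].
  exists (Rmin d e). split; [now apply Rmin_glb_lt |]. intros w Hw.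
  rewrite <- Ez, <- E by (apply Rlt_le_trans with (1 := Hw); apply Rmin_r).
  apply Hd. apply Rlt_le_trans with (1 := Hw); apply Rmin_l.
Qed.

Lemma Cder_const (k z : C) : Cder (fun _ => k) z (RtoC 0).
Proof.
  intros eps He. exists 1. split; [lra |]. intros w _.
  replace (k - k - RtoC 0 * (w - z))%C with (RtoC 0) by ring. rewrite Cmod_0.
  apply Rmult_le_pos; [lra | apply Cmod_ge_0].
Qed.

Lemma Cder_id (z : C) : Cder (fun w => w) z (RtoC 1).
Proof.
  intros eps He. exists 1. split; [lra |]. intros w _.
  replace (w - z - RtoC 1 * (w - z))%C with (RtoC 0) by ring. rewrite Cmod_0.
  apply Rmult_le_pos; [lra | apply Cmod_ge_0].
Qed.

Lemma Cder_plus (f g : C -> C) (z l m : C) : Cder f z l -> Cder g z m ->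
  Cder (fun w => f w + g w)%C z (l + m)%C.
Proof.
  intros H K eps He.
  destruct (Cnear_and _ _ _ (H (eps / 2) ltac:(lra)) (K (eps / 2) ltac:(lra))) as [d [dp Hd]].
  exists d. split; [exact dp |]. intros w Hw. destruct (Hd w Hw) as [h1 h2].
  replace (f w + g w - (f z + g z) - (l + m) * (w - z))%C
    with ((f w - f z - l * (w - z)) + (g w - g z - m * (w - z)))%C by ring.
  apply Rle_trans with (1 := Cmod_triangle _ _). lra.
Qed.

Lemma Cder_mult (f g : C -> C) (z l m : C) : Cder f z l -> Cder g z m ->
  Cder (fun w => f w * g w)%C z (l * g z + f z * m)%C.
Proof.
  intros H K eps He.
  pose proof (Cmod_ge_0 (f z)). pose proof (Cmod_ge_0 (g z)). pose proof (Cmod_ge_0 l). pose proof (Cmod_ge_0 m).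
  set (A := Cmod (f z) + Cmod (g z) + 1).
  assert (A1 : 0 < eps / (3 * A)) by (apply Rdiv_lt_0_compat; unfold A; lra).
  destruct (Cnear_and _ _ _ (H _ A1) (K _ A1)) as [d [dp Hd]].
  destruct (Cnear_and _ _ _ (Cder_bound f z l H) (Cder_bound g z m K)) as [e [ep He']].
  set (B := (Cmod l + 1) * (Cmod m + 1)).
  assert (B1 : 0 < B) by (apply Rmult_lt_0_compat; lra).
  assert (B2 : 0 < eps / (3 * B)) by (apply Rdiv_lt_0_compat; lra).
  exists (Rmin (Rmin d e) (eps / (3 * B))). split; [repeat apply Rmin_glb_lt; assumption |].
  intros w Hw.
  assert (w1 : Cmod (w - z) < d).
  { apply Rlt_le_trans with (1 := Hw). apply Rle_trans with (1 := Rmin_l _ _). apply Rmin_l. }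
  assert (w2 : Cmod (w - z) < e).
  { apply Rlt_le_trans with (1 := Hw). apply Rle_trans with (1 := Rmin_l _ _). apply Rmin_r. }
  assert (w3 : Cmod (w - z) < eps / (3 * B)).
  { apply Rlt_le_trans with (1 := Hw). apply Rmin_r. }
  destruct (Hd w w1) as [h1 h2]. destruct (He' w w2) as [h3 h4].
  replace (f w * g w - f z * g z - (l * g z + f z * m) * (w - z))%C
    with ((f w - f z - l * (w - z)) * g z + f z * (g w - g z - m * (w - z)) + (f w - f z) * (g w - g z))%C by ring.
  set (x := Cmod (w - z)) in *. assert (x0 : 0 <= x) by apply Cmod_ge_0.
  apply Rle_trans with (1 := Cmod_triangle _ _).
  assert (T1 : Cmod ((f w - f z - l * (w - z)) * g z + f z * (g w - g z - m * (w - z))) <= 2 * (eps / 3 * x)).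
  { apply Rle_trans with (1 := Cmod_triangle _ _). rewrite !Cmod_mult.
    assert (E : eps / (3 * A) * x * A = eps / 3 * x) by (field; unfold A; lra).
    assert (0 <= eps / (3 * A) * x) by nra.
    assert (Cmod (f w - f z - l * (w - z)) * Cmod (g z) <= eps / (3 * A) * x * A).
    { apply Rmult_le_compat; try apply Cmod_ge_0; [exact h1 | unfold A; lra]. }
    assert (Cmod (f z) * Cmod (g w - g z - m * (w - z)) <= A * (eps / (3 * A) * x)).
    { apply Rmult_le_compat; try apply Cmod_ge_0; [unfold A; lra | exact h2]. }
    lra. }
  assert (T2 : Cmod ((f w - f z) * (g w - g z)) <= eps / 3 * x).
  { rewrite Cmod_mult. apply Rle_trans with (((Cmod l + 1) * x) * ((Cmod m + 1) * x)).
    - apply Rmult_le_compat; try apply Cmod_ge_0; assumption.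
    - replace ((Cmod l + 1) * x * ((Cmod m + 1) * x)) with (B * x * x) by (unfold B; ring).
      apply Rmult_le_compat_r; [exact x0 |].
      apply Rlt_div_r in w3; [lra | lra]. }
  lra.
Qed.

Lemma Ccontin_neq0 (f : C -> C) (z : C) : Ccontin f z -> f z <> RtoC 0 ->
  Cnear z (fun w => Cmod (f z) / 2 <= Cmod (f w)).
Proof.
  intros H N. apply Cmod_gt_0 in N. destruct (H (Cmod (f z) / 2) ltac:(lra)) as [d [dp Hd]].
  exists d. split; [exact dp |]. intros w Hw. specialize (Hd w Hw).
  rewrite Cmod_minus_sym in Hd. pose proof (Cmod_triangle_rev (f z) (f w)). lra.
Qed.

Lemma Cder_inv (f : C -> C) (z l : C) : Cder f z l -> f z <> RtoC 0 ->
  Cder (fun w => / f w)%C z (- (l * / f z * / f z))%C.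
Proof.
  intros H N eps He.
  pose proof (Cder_contin _ _ _ H) as HC.
  pose proof (proj1 (Cmod_gt_0 _) N) as Np. set (a := Cmod (f z)) in *.
  pose proof (Cmod_ge_0 l).
  assert (E1 : 0 < eps * (a * a) / 4) by (apply Rdiv_lt_0_compat; [apply Rmult_lt_0_compat; nra | lra]).
  assert (E2 : 0 < eps * (a * a * a) / (8 * (Cmod l + 1))).
  { apply Rdiv_lt_0_compat; [apply Rmult_lt_0_compat; [lra |]; repeat apply Rmult_lt_0_compat; lra | lra]. }
  destruct (Cnear_and _ _ _ (H _ E1) (Ccontin_neq0 f z HC N)) as [d [dp Hd]].
  destruct (HC _ E2) as [e [ep He']].
  exists (Rmin d e). split; [now apply Rmin_glb_lt |]. intros w Hw.
  destruct (Hd w (Rlt_le_trans _ _ _ Hw (Rmin_l _ _))) as [h1 h2].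
  specialize (He' w (Rlt_le_trans _ _ _ Hw (Rmin_r _ _))).
  fold a in h2.
  assert (Nw : f w <> RtoC 0) by (apply Cmod_gt_0; lra).
  set (x := Cmod (w - z)) in *. assert (x0 : 0 <= x) by apply Cmod_ge_0.
  set (b := Cmod (f w)) in *.
  replace (/ f w - / f z - - (l * / f z * / f z) * (w - z))%C
    with ((l * (w - z) * (f w - f z) - f z * (f w - f z - l * (w - z))) / (f w * f z * f z))%C
    by (field; split; assumption).
  rewrite Cmod_div by (repeat apply Cmult_neq_0; assumption).
  rewrite !Cmod_mult. fold a b.
  assert (D0 : 0 < b * a * a) by (apply Rmult_lt_0_compat; [apply Rmult_lt_0_compat |]; lra).
  apply Rle_div_l; [exact D0 |].
  apply Rle_trans with (1 := Cmod_triangle_minus _ _). rewrite !Cmod_mult. fold a x.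
  assert (T1 : Cmod l * x * Cmod (f w - f z) <= eps * (a * a * a) / 8 * x).
  { apply Rle_trans with ((Cmod l + 1) * x * (eps * (a * a * a) / (8 * (Cmod l + 1)))).
    - apply Rmult_le_compat; [apply Rmult_le_pos; lra | apply Cmod_ge_0 | | lra].
      apply Rmult_le_compat_r; lra.
    - right; field; lra. }
  assert (T2 : a * Cmod (f w - f z - l * (w - z)) <= a * (eps * (a * a) / 4 * x)).
  { apply Rmult_le_compat_l; [lra | exact h1]. }
  assert (T3 : eps * x * (a / 2 * a * a) <= eps * x * (b * a * a)).
  { apply Rmult_le_compat_l; [apply Rmult_le_pos; lra |].
    apply Rmult_le_compat_r; [lra |]. apply Rmult_le_compat_r; lra. }
  assert (0 <= eps * x * (a * a * a)).
  { apply Rmult_le_pos; [apply Rmult_le_pos; lra |]. repeat apply Rmult_le_pos; lra. }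
  lra.
Qed.

Lemma is_derive_eps (f : R -> R) (x l : R) : is_derive f x l <->
  (forall eps, 0 < eps -> exists d, 0 < d /\ forall t, Rabs (t - x) < d ->
    Rabs (f t - f x - l * (t - x)) <= eps * Rabs (t - x)).
Proof.
  split.
  - intros H eps He. apply is_derive_Reals in H. destruct (H eps He) as [d Hd].
    exists d. split; [apply cond_pos |]. intros t Ht.
    destruct (Req_dec t x) as [e|n].
    + rewrite e. replace (f x - f x - l * (x - x)) with 0 by ring. rewrite Rminus_diag, Rabs_R0. lra.
    + specialize (Hd (t - x) ltac:(lra) Ht).
      replace (x + (t - x)) with t in Hd by ring.
      replace (f t - f x - l * (t - x)) with (((f t - f x) / (t - x) - l) * (t - x)) by (field; lra).
      rewrite Rabs_mult. apply Rmult_le_compat_r; [apply Rabs_pos | lra].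
  - intro H. apply is_derive_Reals. intros eps He. destruct (H (eps / 2) ltac:(lra)) as [d [dp Hd]].
    exists (mkposreal d dp). intros h Hn Hh. simpl in Hh.
    specialize (Hd (x + h)). replace (x + h - x) with h in Hd by ring. specialize (Hd Hh).
    replace ((f (x + h) - f x) / h - l) with ((f (x + h) - f x - l * h) / h) by (field; exact Hn).
    unfold Rdiv. rewrite Rabs_mult, Rabs_inv.
    assert (0 < Rabs h) by now apply Rabs_pos_lt.
    apply Rlt_div_l; [assumption |]. nra.
Qed.

Lemma cderiv_eps (f : R -> C) (x : R) (l : C) : cderiv f x l <->
  (forall eps, 0 < eps -> exists d, 0 < d /\ forall t, Rabs (t - x) < d ->
    Cmod (f t - f x - l * RtoC (t - x)) <= eps * Rabs (t - x)).
Proof.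
  assert (EQ : forall t, Re (f t - f x - l * RtoC (t - x))%C = Re (f t) - Re (f x) - Re l * (t - x) /\
    Im (f t - f x - l * RtoC (t - x))%C = Im (f t) - Im (f x) - Im l * (t - x)).
  { intro t. unfold Re, Im; simpl; split; ring. }
  split.
  - intros [H K] eps He. rewrite is_derive_eps in H, K.
    destruct (H (eps / 2) ltac:(lra)) as [d [dp Hd]], (K (eps / 2) ltac:(lra)) as [e [ep Ke]].
    exists (Rmin d e). split; [now apply Rmin_glb_lt |]. intros t Ht.
    specialize (Hd t (Rlt_le_trans _ _ _ Ht (Rmin_l _ _))).
    specialize (Ke t (Rlt_le_trans _ _ _ Ht (Rmin_r _ _))).
    apply Rle_trans with (1 := Cmod_le_Rabs _). destruct (EQ t) as [e1 e2]. rewrite e1, e2. lra.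
  - intro H. split; apply is_derive_eps; intros eps He; destruct (H eps He) as [d [dp Hd]];
      exists d; (split; [exact dp |]); intros t Ht; apply Rle_trans with (2 := Hd t Ht);
      destruct (EQ t) as [e1 e2].
    + rewrite <- e1. apply re_le_Cmod.
    + rewrite <- e2. apply im_le_Cmod.
Qed.

(** The domain [X] and the increment [inc] are abstract, so that one estimate serves both for paths,
    in [cderiv_comp], and for complex arguments, in [Cder_comp]. *)
Lemma chain_rule_estimate (X : Type) (F : C -> C) (G inc : X -> C) (y0 l m : C) : Cder F y0 l ->
  (forall eps, 0 < eps -> exists d, 0 < d /\ forall x, Cmod (inc x) < d ->
     Cmod (G x - y0 - m * inc x) <= eps * Cmod (inc x)) ->
  forall eps, 0 < eps -> exists d, 0 < d /\ forall x, Cmod (inc x) < d ->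
    Cmod (F (G x) - F y0 - l * m * inc x) <= eps * Cmod (inc x).
Proof.
  intros HF HG eps He.
  pose proof (Cmod_ge_0 l). pose proof (Cmod_ge_0 m).
  destruct (HF (eps / (2 * (Cmod m + 1)))) as [d [dp Hd]]; [apply Rdiv_lt_0_compat; lra |].
  destruct (HG (Rmin 1 (eps / (2 * (Cmod l + 1))))) as [e [ep Ke]].
  { apply Rmin_glb_lt; [lra |]. apply Rdiv_lt_0_compat; lra. }
  assert (Q : 0 < d / (Cmod m + 1)) by (apply Rdiv_lt_0_compat; lra).
  exists (Rmin e (d / (Cmod m + 1))). split; [now apply Rmin_glb_lt |]. intros u Hu.
  specialize (Ke u (Rlt_le_trans _ _ _ Hu (Rmin_l _ _))).
  assert (Hu2 : Cmod (inc u) < d / (Cmod m + 1)) by (apply Rlt_le_trans with (1 := Hu); apply Rmin_r).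
  apply Rlt_div_r in Hu2; [| lra].
  set (x := Cmod (inc u)) in *. assert (x0 : 0 <= x) by apply Cmod_ge_0.
  assert (K1 : Cmod (G u - y0 - m * inc u) <= 1 * x).
  { apply Rle_trans with (1 := Ke). apply Rmult_le_compat_r; [exact x0 | apply Rmin_l]. }
  assert (K2 : Cmod (G u - y0 - m * inc u) <= eps / (2 * (Cmod l + 1)) * x).
  { apply Rle_trans with (1 := Ke). apply Rmult_le_compat_r; [exact x0 | apply Rmin_r]. }
  assert (G1 : Cmod (G u - y0) <= (Cmod m + 1) * x).
  { replace (G u - y0)%C with ((G u - y0 - m * inc u) + m * inc u)%C by ring.
    apply Rle_trans with (1 := Cmod_triangle _ _). rewrite Cmod_mult. fold x. lra. }
  specialize (Hd (G u)). specialize (Hd ltac:(lra)).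
  replace (F (G u) - F y0 - l * m * inc u)%C
    with ((F (G u) - F y0 - l * (G u - y0)) + l * (G u - y0 - m * inc u))%C by ring.
  apply Rle_trans with (1 := Cmod_triangle _ _). rewrite Cmod_mult.
  assert (A1 : eps / (2 * (Cmod m + 1)) * Cmod (G u - y0) <= eps / 2 * x).
  { apply Rle_trans with (eps / (2 * (Cmod m + 1)) * ((Cmod m + 1) * x)).
    - apply Rmult_le_compat_l; [| exact G1]. left. apply Rdiv_lt_0_compat; lra.
    - right; field; lra. }
  assert (A2 : Cmod l * Cmod (G u - y0 - m * inc u) <= eps / 2 * x).
  { apply Rle_trans with ((Cmod l + 1) * (eps / (2 * (Cmod l + 1)) * x)).
    - apply Rmult_le_compat; [lra | apply Cmod_ge_0 | lra | exact K2].
    - right; field; lra. }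
  lra.
Qed.

Lemma cderiv_comp (F : C -> C) (g : R -> C) (t : R) (l m : C) :
  Cder F (g t) l -> cderiv g t m -> cderiv (fun u => F (g u)) t (l * m)%C.
Proof.
  intros HF Hg. rewrite cderiv_eps in *.
  pose proof (chain_rule_estimate R F g (fun u => RtoC (u - t)) (g t) l m HF) as K.
  assert (E : forall u, Cmod (RtoC (u - t)) = Rabs (u - t)) by (intro; apply Cmod_R).
  intros eps He. destruct K with eps as [d [dp Hd]]; [| exact He |].
  - intros e ep. destruct (Hg e ep) as [d [dp Hd]]. exists d. split; [exact dp |].
    intros u. rewrite E. apply Hd.
  - exists d. split; [exact dp |]. intros u. rewrite <- E. apply Hd.
Qed.

Lemma Cder_comp (F G : C -> C) (z l m : C) :
  Cder F (G z) l -> Cder G z m -> Cder (fun u => F (G u)) z (l * m)%C.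
Proof. exact (chain_rule_estimate C F G (fun u => u - z)%C (G z) l m). Qed.

Lemma Cder_is_derive (f : C -> C) (z l : C) :
  @is_derive C_AbsRing C_NormedModule f z l <-> Cder f z l.
Proof.
  split.
  - intros [_ H] eps He. specialize (H z (fun P HP => HP) (mkposreal eps He)).
    destruct H as [d Hd]. exists d. split; [apply cond_pos |]. intros w Hw.
    specialize (Hd w Hw). simpl in Hd.
    replace (f w - f z - l * (w - z))%C with (f w - f z - (w - z) * l)%C by ring. exact Hd.
  - intro H. split; [apply (@is_linear_scal_l C_AbsRing C_NormedModule) |].
    intros x Hx eps.
    assert (e : z = x) by exact (@is_filter_lim_locally_unique C_AbsRing (AbsRing_NormedModule C_AbsRing) z x Hx). subst x.
    destruct (H eps (cond_pos eps)) as [d [dp Hd]]. exists (mkposreal d dp). intros w Hw.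
    specialize (Hd w Hw). simpl.
    replace (f w - f z - l * (w - z))%C with (f w - f z - (w - z) * l)%C in Hd by ring. exact Hd.
Qed.

(** Holomorphy graded by the number of derivatives near [z], the last one being continuous at [z].
    The grading replaces Cauchy's theory, by which all positive orders would be equivalent: every
    result below states how many derivatives it consumes. *)
Fixpoint hol (n : nat) (f : C -> C) (z : C) : Prop :=
  match n with
  | O => Ccontin f z
  | S m => exists f1, Cnear z (fun w => Cder f w (f1 w)) /\ hol m f1 z
  end.

Lemma Ccontin_ext_near (f g : C -> C) (z : C) : Cnear z (fun w => f w = g w) ->
  Ccontin f z -> Ccontin g z.
Proof.
  intros E H eps He. pose proof (Cnear_self _ _ E) as Ez. cbv beta in Ez.
  destruct (Cnear_and _ _ _ E (H eps He)) as [d [dp Hd]].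
  exists d. split; [exact dp |]. intros w Hw. destruct (Hd w Hw) as [e h]. now rewrite <- Ez, <- e.
Qed.

Lemma hol_ext_near (n : nat) (z : C) : forall f g, Cnear z (fun w => f w = g w) ->
  hol n f z -> hol n g z.
Proof.
  destruct n as [|n]; intros f g E H.
  - now apply Ccontin_ext_near with f.
  - destruct H as [f1 [h1 h2]]. exists f1. split; [| exact h2].
    apply Cnear_near in E. pose proof (Cnear_and _ _ _ E h1) as K.
    revert K. apply Cnear_imp. intros w [a b]. now apply Cder_ext_near with f.
Qed.

Lemma hol_contin (n : nat) (f : C -> C) (z : C) : hol n f z -> Ccontin f z.
Proof.
  destruct n as [|n]; [easy |]. intros [f1 [h1 _]]. apply Cnear_self in h1. eapply Cder_contin; exact h1.
Qed.

Lemma hol_pred (n : nat) (z : C) : forall f, hol (S n) f z -> hol n f z.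
Proof.
  induction n as [|n IH]; intros f H; [eapply hol_contin; exact H |].
  destruct H as [f1 [h1 h2]]. exists f1. split; [exact h1 | now apply IH].
Qed.

Lemma hol_const (n : nat) (z : C) : forall k, hol n (fun _ => k) z.
Proof.
  induction n as [|n IH]; intro k.
  - eapply Cder_contin. apply Cder_const.
  - exists (fun _ => RtoC 0). split; [| apply IH]. exists 1. split; [lra |]. intros; apply Cder_const.
Qed.

Lemma hol_id (n : nat) (z : C) : hol n (fun w => w) z.
Proof.
  destruct n as [|n].
  - eapply Cder_contin. apply Cder_id.
  - exists (fun _ => RtoC 1). split; [| apply hol_const]. exists 1. split; [lra |]. intros; apply Cder_id.
Qed.

Lemma Ccontin_plus (f g : C -> C) (z : C) : Ccontin f z -> Ccontin g z -> Ccontin (fun w => f w + g w)%C z.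
Proof.
  intros H K eps He.
  destruct (Cnear_and _ _ _ (H (eps / 2) ltac:(lra)) (K (eps / 2) ltac:(lra))) as [d [dp Hd]].
  exists d. split; [exact dp |]. intros w Hw. destruct (Hd w Hw) as [a b].
  replace (f w + g w - (f z + g z))%C with ((f w - f z) + (g w - g z))%C by ring.
  apply Rle_lt_trans with (1 := Cmod_triangle _ _). lra.
Qed.

Lemma Ccontin_mult (f g : C -> C) (z : C) : Ccontin f z -> Ccontin g z -> Ccontin (fun w => f w * g w)%C z.
Proof.
  intros H K eps He.
  pose proof (Cmod_ge_0 (f z)). pose proof (Cmod_ge_0 (g z)).
  set (A := Cmod (f z) + Cmod (g z) + 1).
  assert (E1 : 0 < eps / (4 * A)) by (apply Rdiv_lt_0_compat; unfold A; lra).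
  assert (E2 : 0 < Rmin 1 (eps / (4 * A))) by (apply Rmin_glb_lt; lra).
  destruct (Cnear_and _ _ _ (H _ E1) (K _ E2)) as [d [dp Hd]].
  exists d. split; [exact dp |]. intros w Hw. destruct (Hd w Hw) as [a b].
  assert (b1 : Cmod (g w - g z) < 1) by (apply Rlt_le_trans with (1 := b); apply Rmin_l).
  assert (b2 : Cmod (g w - g z) < eps / (4 * A)) by (apply Rlt_le_trans with (1 := b); apply Rmin_r).
  replace (f w * g w - f z * g z)%C
    with ((f w - f z) * g z + f z * (g w - g z) + (f w - f z) * (g w - g z))%C by ring.
  apply Rle_lt_trans with (1 := Cmod_triangle _ _).
  apply Rle_lt_trans with (1 := Rplus_le_compat_r _ _ _ (Cmod_triangle _ _)). rewrite !Cmod_mult.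
  assert (EA : eps / (4 * A) * A = eps / 4) by (field; unfold A; lra).
  assert (Cmod (f w - f z) * Cmod (g z) <= eps / (4 * A) * A).
  { apply Rmult_le_compat; try apply Cmod_ge_0; [lra | unfold A; lra]. }
  assert (Cmod (f z) * Cmod (g w - g z) <= A * (eps / (4 * A))).
  { apply Rmult_le_compat; try apply Cmod_ge_0; [unfold A; lra | lra]. }
  assert (Cmod (f w - f z) * Cmod (g w - g z) <= eps / (4 * A) * A).
  { apply Rmult_le_compat; try apply Cmod_ge_0; [lra | unfold A; lra]. }
  lra.
Qed.

Lemma Ccontin_inv (f : C -> C) (z : C) : Ccontin f z -> f z <> RtoC 0 -> Ccontin (fun w => / f w)%C z.
Proof.
  intros H N eps He. pose proof (proj1 (Cmod_gt_0 _) N) as Np. set (a := Cmod (f z)) in *.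
  assert (E1 : 0 < eps * (a * a) / 4) by (apply Rdiv_lt_0_compat; [apply Rmult_lt_0_compat; nra | lra]).
  destruct (Cnear_and _ _ _ (H _ E1) (Ccontin_neq0 f z H N)) as [d [dp Hd]].
  exists d. split; [exact dp |]. intros w Hw. destruct (Hd w Hw) as [h1 h2]. fold a in h2.
  assert (Nw : f w <> RtoC 0) by (apply Cmod_gt_0; lra).
  replace (/ f w - / f z)%C with ((f z - f w) / (f w * f z))%C by (field; split; assumption).
  rewrite Cmod_div by (apply Cmult_neq_0; assumption). rewrite Cmod_mult. fold a.
  assert (0 < Cmod (f w) * a) by (apply Rmult_lt_0_compat; lra).
  apply Rlt_div_l; [assumption |]. rewrite Cmod_minus_sym.
  assert (eps * (a / 2 * a) <= eps * (Cmod (f w) * a)).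
  { apply Rmult_le_compat_l; [lra |]. apply Rmult_le_compat_r; lra. }
  assert (0 < eps * (a * a)) by (apply Rmult_lt_0_compat; nra). lra.
Qed.

Lemma hol_plus (n : nat) (z : C) : forall f g, hol n f z -> hol n g z -> hol n (fun w => f w + g w)%C z.
Proof.
  induction n as [|n IH]; intros f g H K; [now apply Ccontin_plus |].
  destruct H as [f1 [a1 a2]], K as [g1 [b1 b2]].
  exists (fun w => f1 w + g1 w)%C. split; [| now apply IH].
  generalize (Cnear_and _ _ _ a1 b1). apply Cnear_imp. intros w [h k]. now apply Cder_plus.
Qed.

Lemma hol_mult (n : nat) (z : C) : forall f g, hol n f z -> hol n g z -> hol n (fun w => f w * g w)%C z.
Proof.
  induction n as [|n IH]; intros f g H K; [now apply Ccontin_mult |].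
  pose proof (hol_pred _ _ _ H) as H'. pose proof (hol_pred _ _ _ K) as K'.
  destruct H as [f1 [a1 a2]], K as [g1 [b1 b2]].
  exists (fun w => f1 w * g w + f w * g1 w)%C. split; [| apply hol_plus; now apply IH].
  generalize (Cnear_and _ _ _ a1 b1). apply Cnear_imp. intros w [h k]. now apply Cder_mult.
Qed.

Lemma Cnear_neq0 (f : C -> C) (z : C) : Ccontin f z -> f z <> RtoC 0 -> Cnear z (fun w => f w <> RtoC 0).
Proof.
  intros H N. generalize (Ccontin_neq0 f z H N). apply Cnear_imp. intros w Hw.
  apply Cmod_gt_0. apply Cmod_gt_0 in N. lra.
Qed.

Lemma hol_opp (n : nat) (z : C) (f : C -> C) : hol n f z -> hol n (fun w => - f w)%C z.
Proof.
  intro H. apply hol_ext_near with (fun w => (- RtoC 1) * f w)%C.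
  - exists 1. split; [lra |]. intros; ring.
  - apply (hol_mult n z (fun _ => - RtoC 1)%C f); [apply hol_const | exact H].
Qed.

Lemma hol_inv (n : nat) (z : C) : forall f, hol n f z -> f z <> RtoC 0 -> hol n (fun w => / f w)%C z.
Proof.
  induction n as [|n IH]; intros f H N; [now apply Ccontin_inv |].
  pose proof (hol_pred _ _ _ H) as H'. pose proof (hol_contin _ _ _ H) as Hc.
  destruct H as [f1 [a1 a2]].
  exists (fun w => - (f1 w * / f w * / f w))%C. split.
  - generalize (Cnear_and _ _ _ a1 (Cnear_neq0 f z Hc N)). apply Cnear_imp.
    intros w [h k]. now apply Cder_inv.
  - apply hol_opp. apply (hol_mult n z (fun w => f1 w * / f w)%C); [apply hol_mult |]; auto.
Qed.

(** The derivatives given near different points agree by uniqueness, so pointwise choice glues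
    them. *)
Lemma hol_S_global (n : nat) (f : C -> C) : (forall z, hol (S n) f z) ->
  exists f1, (forall z, Cder f z (f1 z)) /\ forall z, hol n f1 z.
Proof.
  intro H.
  destruct (choice (fun z l => Cder f z l)) as [f1 Hf1].
  { intro z. destruct (H z) as [g [h _]]. exists (g z). exact (Cnear_self _ _ h). }
  exists f1. split; [exact Hf1 |]. intro z. destruct (H z) as [g [h k]].
  apply hol_ext_near with g; [| exact k]. revert h. apply Cnear_imp. intros w Hw.
  exact (Cder_unique _ _ _ _ Hw (Hf1 w)).
Qed.

(** * Entire functions with all derivatives locally bounded *)

(** The real variable on [[0, 1]] is a dummy: entire functions become constant families, and the
    closure properties of [preg], integration included, apply to them. *)
Definition ereg (F : C -> C) : Prop := forall n, preg n 0 1 (fun l _ => F l).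

Lemma preg_eval (n : nat) (a b x : R) : a <= x <= b -> forall Y, preg n a b Y ->
  preg n 0 1 (fun l _ => Y l x).
Proof.
  intro Hx.
  assert (LB : forall Y, loc_bounded a b Y -> loc_bounded 0 1 (fun l _ => Y l x)).
  { intros Y [_ H]; split; [intro; apply ccont_const |].
    intro L. destruct (H L) as [K [p h]]. exists K. split; [exact p |]. intros lam t Hl _. now apply h. }
  induction n as [|n IH]; intros Y [H1 H2]; [split; [now apply LB | exact I] |].
  destruct H2 as [Y1 [h1 h2]].
  apply preg_S with (fun l _ => Y1 l x); [now apply LB | now apply IH |].
  intro L. destruct (h2 L) as [K [p h]]. exists K. split; [exact p |].
  intros lam mu t Hl Hm _. now apply h.
Qed.

Lemma ereg_eval (a b x : R) (Y : C -> R -> C) : a <= x <= b -> (forall n, preg n a b Y) ->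
  ereg (fun l => Y l x).
Proof. intros Hx H n. now apply (preg_eval n a b). Qed.

Lemma ereg_mult (F G : C -> C) : ereg F -> ereg G -> ereg (fun l => F l * G l)%C.
Proof. intros HF HG n. exact (preg_mult n 0 1 _ _ (HF n) (HG n)). Qed.

Lemma ereg_minus (F G : C -> C) : ereg F -> ereg G -> ereg (fun l => F l - G l)%C.
Proof. intros HF HG n. exact (preg_minus n 0 1 _ _ (HF n) (HG n)). Qed.

Lemma ereg_const (k : C) : ereg (fun _ => k).
Proof.
  intro n. apply (preg_const n 0 1 (fun _ => k) (Cmod k)); [apply ccont_const | intros; lra].
Qed.

Lemma preg_id (n : nat) (a b : R) : preg n a b (fun l _ => l).
Proof.
  assert (LB : loc_bounded a b (fun l _ => l)).
  { split; [intro; apply ccont_const |]. intro L. exists (Rmax 0 L). split; [apply Rmax_l |].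
    intros lam t Hl _. apply Rle_trans with (1 := Hl). apply Rmax_r. }
  destruct n as [|n]; [now apply preg_O |].
  apply preg_S with (fun _ _ => RtoC 1); [exact LB | |].
  - apply preg_const with 1; [apply ccont_const | intros; rewrite Cmod_1; lra].
  - intro L. exists 0. split; [lra |]. intros lam mu t _ _ _.
    replace (mu - lam - (mu - lam) * RtoC 1)%C with (RtoC 0) by ring. rewrite Cmod_0. lra.
Qed.

Lemma ereg_id : ereg (fun l => l).
Proof. intro n. apply preg_id. Qed.

Lemma param_deriv_Cder (F F1 : C -> C) : param_deriv 0 1 (fun l _ => F l) (fun l _ => F1 l) ->
  forall z, Cder F z (F1 z).
Proof.
  intros H z eps He. destruct (H (Cmod z + 1)) as [K [p h]].
  assert (Q : 0 < eps / (K + 1)) by (apply Rdiv_lt_0_compat; lra).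
  exists (Rmin 1 (eps / (K + 1))). split; [apply Rmin_glb_lt; lra |].
  intros w Hw.
  assert (w1 : Cmod (w - z) < 1) by (apply Rlt_le_trans with (1 := Hw); apply Rmin_l).
  assert (w2 : Cmod (w - z) < eps / (K + 1)) by (apply Rlt_le_trans with (1 := Hw); apply Rmin_r).
  apply Rlt_div_r in w2; [| lra].
  assert (Cmod w <= Cmod z + 1).
  { replace w with (z + (w - z))%C by ring. apply Rle_trans with (1 := Cmod_triangle _ _). lra. }
  specialize (h z w 0 ltac:(lra) ltac:(lra) ltac:(lra)).
  replace (F w - F z - F1 z * (w - z))%C with (F w - F z - (w - z) * F1 z)%C by ring.
  apply Rle_trans with (1 := h). rewrite <- Rmult_assoc. apply Rmult_le_compat_r; [apply Cmod_ge_0 |].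
  pose proof (Cmod_ge_0 (w - z)). nra.
Qed.

Lemma preg_hol (n : nat) : forall F, preg (S n) 0 1 (fun l _ => F l) -> forall z, hol n F z.
Proof.
  induction n as [|n IH]; intros F H z.
  - destruct H as [_ [Y1 [_ h]]].
    eapply Cder_contin. apply (param_deriv_Cder F (fun l => Y1 l 0)).
    intro L. destruct (h L) as [K [p k]]. exists K. split; [exact p |].
    intros lam mu t Hl Hm _. apply (k lam mu 0 Hl Hm). lra.
  - destruct H as [_ [Y1 [h1 h]]].
    exists (fun l => Y1 l 0). split.
    + exists 1. split; [lra |]. intros w _. apply (param_deriv_Cder F (fun l => Y1 l 0)).
      intro L. destruct (h L) as [K [p k]]. exists K. split; [exact p |].
      intros lam mu t Hl Hm _. apply (k lam mu 0 Hl Hm). lra.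
    + apply IH. apply (preg_eval (S n) 0 1 0 ltac:(lra) Y1 h1).
Qed.

Lemma ereg_hol (n : nat) (F : C -> C) (z : C) : ereg F -> hol n F z.
Proof. intro H. apply preg_hol, H. Qed.

Lemma ereg_bounded (F : C -> C) : ereg F -> forall L, exists K, 0 <= K /\ forall z, Cmod z <= L -> Cmod (F z) <= K.
Proof.
  intros H L. destruct (H 0%nat) as [[_ h] _]. destruct (h L) as [K [p k]]. exists K. split; [exact p |].
  intros z Hz. apply (k z 0 Hz). lra.
Qed.

(** Each order [n] supplies its own derivative; by uniqueness all of them equal the one found at
    order 0, which therefore has every order of regularity. *)
Lemma ereg_deriv (F : C -> C) : ereg F ->
  exists F1, ereg F1 /\ (forall z, Cder F z (F1 z)) /\ param_deriv 0 1 (fun l _ => F l) (fun l _ => F1 l).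
Proof.
  intro H.
  assert (D : forall n, exists F1, preg n 0 1 (fun l _ => F1 l) /\ (forall z, Cder F z (F1 z)) /\
     param_deriv 0 1 (fun l _ => F l) (fun l _ => F1 l)).
  { intro n. destruct (H (S n)) as [_ [Y1 [h1 h]]].
    assert (P : param_deriv 0 1 (fun l _ => F l) (fun l _ => Y1 l 0)).
    { intro L. destruct (h L) as [K [p k]]. exists K. split; [exact p |].
      intros lam mu t Hl Hm _. apply (k lam mu 0 Hl Hm). lra. }
    exists (fun l => Y1 l 0). split; [| split].
    - exact (preg_eval n 0 1 0 ltac:(lra) Y1 h1).
    - exact (param_deriv_Cder F (fun l => Y1 l 0) P).
    - exact P. }
  destruct (D 0%nat) as [F1 [_ [h1 h2]]]. exists F1. split; [| now split].
  intro n. destruct (D n) as [G [g1 [g2 _]]]. apply preg_ext with (2 := g1).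
  intros l _. exact (Cder_unique _ _ _ _ (g2 l) (h1 l)).
Qed.

Lemma cderiv_segment (z0 w : C) (t : R) : cderiv (fun t => z0 + RtoC t * (w - z0))%C t (w - z0)%C.
Proof.
  eapply cderiv_eq.
  - apply cderiv_plus; [apply cderiv_const |]. apply cderiv_mult; [apply cderiv_id | apply cderiv_const].
  - cbv beta; ring.
Qed.

Lemma ccont_RtoC : ccont (fun t => RtoC t).
Proof. exact (ccont_cderiv _ _ (fun x => cderiv_id x)). Qed.

Lemma preg_segment (n : nat) (z0 : C) : forall F, ereg F ->
  preg n 0 1 (fun w t => F (z0 + RtoC t * (w - z0))%C).
Proof.
  assert (seg : forall L w t, Cmod w <= L -> 0 <= t <= 1 ->
    Cmod (z0 + RtoC t * (w - z0)) <= 2 * Cmod z0 + L).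
  { intros L w t Hw Ht. apply Rle_trans with (1 := Cmod_triangle _ _).
    rewrite Cmod_mult, Cmod_R, Rabs_pos_eq by lra.
    pose proof (Cmod_triangle_minus w z0). pose proof (Cmod_ge_0 (w - z0)). nra. }
  assert (LB : forall F, ereg F -> loc_bounded 0 1 (fun w t => F (z0 + RtoC t * (w - z0))%C)).
  { intros F HF. split.
    - intro w. destruct (ereg_deriv F HF) as [F1 [_ [D _]]].
      exact (ccont_cderiv _ _ (fun t => cderiv_comp F _ t _ _ (D _) (cderiv_segment z0 w t))).
    - intro L. destruct (ereg_bounded F HF (2 * Cmod z0 + L)) as [K [p k]]. exists K. split; [exact p |].
      intros w t Hw Ht. apply k. now apply seg. }
  induction n as [|n IH]; intros F HF; [apply preg_O; now apply LB |].
  destruct (ereg_deriv F HF) as [F1 [H1 [D P]]].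
  apply preg_S with (fun w t => RtoC t * F1 (z0 + RtoC t * (w - z0)))%C; [now apply LB | |].
  - apply (preg_mult n 0 1 (fun _ t => RtoC t)); [| now apply IH].
    apply preg_const with 1; [apply ccont_RtoC |].
    intros t Ht. rewrite Cmod_R, Rabs_pos_eq; lra.
  - intro L. destruct (P (2 * Cmod z0 + L)) as [K [p k]]. exists K. split; [exact p |].
    intros lam mu t Hl Hm Ht.
    specialize (k _ _ t (seg L lam t Hl Ht) (seg L mu t Hm Ht) Ht). cbv beta in k.
    replace (z0 + RtoC t * (mu - z0) - (z0 + RtoC t * (lam - z0)))%C with (RtoC t * (mu - lam))%C in k by ring.
    replace ((mu - lam) * (RtoC t * F1 (z0 + RtoC t * (lam - z0))))%C
      with (RtoC t * (mu - lam) * F1 (z0 + RtoC t * (lam - z0)))%C by ring.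
    apply Rle_trans with (1 := k). apply Rmult_le_compat_l; [exact p |].
    rewrite Cmod_mult, Cmod_R, Rabs_pos_eq by lra. pose proof (Cmod_ge_0 (mu - lam)).
    apply Rmult_le_compat; nra.
Qed.

(** Hadamard's formula: the quotient is the integral of [F1] along the segment from [z0] to [w], and
    integration preserves [preg]. No removable singularity has to be treated. *)
Lemma ereg_divide (F : C -> C) (z0 : C) : ereg F -> F z0 = RtoC 0 ->
  exists G, ereg G /\ forall w, F w = ((w - z0) * G w)%C.
Proof.
  intros HF F0. destruct (ereg_deriv F HF) as [F1 [H1 [D P]]].
  exists (fun w => CInt (fun t => F1 (z0 + RtoC t * (w - z0))%C) 0 1). split.
  - intro n. apply (preg_eval n 0 1 1 ltac:(lra) (fun w => CInt (fun t => F1 (z0 + RtoC t * (w - z0))%C) 0)).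
    apply preg_int; [lra |]. now apply preg_segment.
  - intro w.
    assert (cF : ccont (fun t => F1 (z0 + RtoC t * (w - z0))%C)).
    { exact (proj1 (preg_bounded _ _ _ _ (preg_segment 0 z0 F1 H1)) w). }
    rewrite <- CInt_scal by exact cF.
    rewrite (CInt_of_cderiv (fun t => F (z0 + RtoC t * (w - z0))%C)).
    + replace (z0 + RtoC 1 * (w - z0))%C with w by ring.
      replace (z0 + RtoC 0 * (w - z0))%C with z0 by ring. rewrite F0. ring.
    + intro t. eapply cderiv_eq; [exact (cderiv_comp F _ t _ _ (D _) (cderiv_segment z0 w t)) |]. cbv beta; ring.
    + apply ccont_mult; [apply ccont_const | exact cF].
Qed.

Lemma ereg_entire (F : C -> C) : ereg F -> entire F.
Proof.
  intros H z. destruct (ereg_deriv F H) as [F1 [_ [D _]]]. exists (F1 z). apply Cder_is_derive, D.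
Qed.

Lemma entire_contin (F : C -> C) (z : C) : entire F -> Ccontin F z.
Proof.
  intros H. destruct (H z) as [l Hl]. apply Cder_is_derive in Hl. eapply Cder_contin; exact Hl.
Qed.

(** * Circle means *)

Lemma nondecreasing_of_derive_interior (f df : R -> R) (a b : R) : a <= b ->
  (forall x, a <= x <= b -> is_derive f x (df x)) ->
  (forall x, a < x < b -> 0 <= df x) -> f a <= f b.
Proof.
  intros ab D N. destruct (Rle_lt_or_eq_dec _ _ ab) as [lt|e]; [| rewrite e; lra].
  destruct (MVT_cor2 f df a b lt) as [c [E Hc]].
  - intros x Hx. apply is_derive_Reals. now apply D.
  - specialize (N c Hc). assert (0 <= df c * (b - a)) by (apply Rmult_le_pos; lra). lra.
Qed.

Definition cont2 (f : R -> R -> R) : Prop := forall x y, continuity_2d_pt f x y.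

Definition ccont2 (f : R -> R -> C) : Prop :=
  cont2 (fun x y => Re (f x y)) /\ cont2 (fun x y => Im (f x y)).

Lemma ccont2_mult (f g : R -> R -> C) : ccont2 f -> ccont2 g -> ccont2 (fun x y => f x y * g x y)%C.
Proof.
  intros [a1 a2] [b1 b2]; split; intros x y.
  - exact (continuity_2d_pt_minus _ _ _ _ (continuity_2d_pt_mult _ _ _ _ (a1 x y) (b1 x y))
             (continuity_2d_pt_mult _ _ _ _ (a2 x y) (b2 x y))).
  - exact (continuity_2d_pt_plus _ _ _ _ (continuity_2d_pt_mult _ _ _ _ (a1 x y) (b2 x y))
             (continuity_2d_pt_mult _ _ _ _ (a2 x y) (b1 x y))).
Qed.

Lemma ccont2_plus (f g : R -> R -> C) : ccont2 f -> ccont2 g -> ccont2 (fun x y => f x y + g x y)%C.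
Proof.
  intros [a1 a2] [b1 b2]; split; intros x y.
  - exact (continuity_2d_pt_plus _ _ _ _ (a1 x y) (b1 x y)).
  - exact (continuity_2d_pt_plus _ _ _ _ (a2 x y) (b2 x y)).
Qed.

Lemma ccont2_const (k : C) : ccont2 (fun _ _ => k).
Proof. split; intros x y; apply continuity_2d_pt_const. Qed.

Lemma ccont2_comp (F : C -> C) (f : R -> R -> C) : (forall z, Ccontin F z) -> ccont2 f ->
  ccont2 (fun x y => F (f x y)).
Proof.
  intros HF [a1 a2].
  assert (K : forall x y (eps : posreal), locally_2d (fun u v => Cmod (F (f u v) - F (f x y)) < eps) x y).
  { intros x y eps. destruct (HF (f x y) eps (cond_pos eps)) as [d [dp Hd]].
    assert (d2 : 0 < d / 2) by lra.
    generalize (locally_2d_and _ _ _ _ (a1 x y (mkposreal _ d2)) (a2 x y (mkposreal _ d2))).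
    intros [e He]. exists e. intros u v Hu Hv. destruct (He u v Hu Hv) as [h1 h2]. simpl in h1, h2.
    apply Hd. apply Rle_lt_trans with (1 := Cmod_le_Rabs _).
    replace (Re (f u v - f x y)) with (Re (f u v) - Re (f x y)) by (unfold Re; simpl; ring).
    replace (Im (f u v - f x y)) with (Im (f u v) - Im (f x y)) by (unfold Im; simpl; ring). lra. }
  split; intros x y eps; destruct (K x y eps) as [e He]; exists e; intros u v Hu Hv;
    apply Rle_lt_trans with (2 := He u v Hu Hv).
  - apply (re_le_Cmod (F (f u v) - F (f x y))%C).
  - apply (im_le_Cmod (F (f u v) - F (f x y))%C).
Qed.

Lemma cont2_cdot (f g : R -> R -> C) : ccont2 f -> ccont2 g -> cont2 (fun x y => cdot (f x y) (g x y)).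
Proof.
  intros [a1 a2] [b1 b2] x y.
  exact (continuity_2d_pt_plus _ _ _ _ (continuity_2d_pt_mult _ _ _ _ (a1 x y) (b1 x y))
             (continuity_2d_pt_mult _ _ _ _ (a2 x y) (b2 x y))).
Qed.

Lemma cont2_continuous (f : R -> R -> R) (x y : R) : cont2 f -> continuous (f x) y.
Proof.
  intro H. apply continuity_pt_filterlim. intros eps He.
  destruct (H x y (mkposreal eps He)) as [d Hd]. exists d. split; [apply cond_pos |].
  intros t [_ Ht]. simpl in *. unfold Rdist in *. apply Hd; [| exact Ht].
  rewrite Rminus_diag, Rabs_R0. apply cond_pos.
Qed.

Lemma ccont2_ccont (f : R -> R -> C) (x : R) : ccont2 f -> ccont (f x).
Proof.
  intros [a1 a2] y; split.
  - exact (cont2_continuous (fun x y => Re (f x y)) x y a1).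
  - exact (cont2_continuous (fun x y => Im (f x y)) x y a2).
Qed.

Lemma is_derive_RInt_smooth (f g : R -> R -> R) (a b : R) :
  (forall x t, is_derive (fun x => f x t) x (g x t)) -> cont2 g -> (forall x t, continuous (f x) t) ->
  forall x, is_derive (fun x => RInt (f x) a b) x (RInt (g x) a b).
Proof.
  intros D Cg Cf x.
  eapply is_derive_eq.
  - apply (is_derive_RInt_param f a b x).
    + apply filter_forall. intros y t _. eexists. apply D.
    + intros t _. apply continuity_2d_pt_ext with g; [| apply Cg].
      intros u v. symmetry. apply is_derive_unique, D.
    + apply filter_forall. intro y. apply (@ex_RInt_continuous R_CompleteNormedModule). intros; apply Cf.
  - apply RInt_ext. intros t _. apply is_derive_unique, D.
Qed.

Lemma cderiv_CInt_smooth (f g : R -> R -> C) (a b : R) :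
  (forall x t, cderiv (fun x => f x t) x (g x t)) -> ccont2 g -> (forall x, ccont (f x)) ->
  forall x, cderiv (fun x => CInt (f x) a b) x (CInt (g x) a b).
Proof.
  intros D [g1 g2] Cf x; split.
  - exact (is_derive_RInt_smooth (fun x t => Re (f x t)) (fun x t => Re (g x t)) a b
      (fun x t => proj1 (D x t)) g1 (fun x t => proj1 (Cf x t)) x).
  - exact (is_derive_RInt_smooth (fun x t => Im (f x t)) (fun x t => Im (g x t)) a b
      (fun x t => proj2 (D x t)) g2 (fun x t => proj2 (Cf x t)) x).
Qed.

Definition cis (t : R) : C := (cos t, sin t).

Definition circ (p : C) (r t : R) : C := (p + RtoC r * cis t)%C.

Lemma cderiv_cis (t : R) : cderiv cis t (Ci * cis t)%C.
Proof.
  split; unfold cis; simpl.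
  - eapply is_derive_eq; [apply is_derive_cos | ring].
  - eapply is_derive_eq; [apply is_derive_sin | ring].
Qed.

Lemma cis_norm (t : R) : cos t * cos t + sin t * sin t = 1.
Proof. pose proof (sin2_cos2 t). unfold Rsqr in *. lra. Qed.

Lemma Cmod_cis (t : R) : Cmod (cis t) = 1.
Proof.
  pose proof (Cmod_sqr (cis t)) as H. unfold cis in H at 3 4 5 6. simpl in H.
  rewrite cis_norm in H. pose proof (Cmod_ge_0 (cis t)). nra.
Qed.

Lemma circ_dist (p : C) (r t : R) : 0 <= r -> Cmod (circ p r t - p) = r.
Proof.
  intro Hr. unfold circ. replace (p + RtoC r * cis t - p)%C with (RtoC r * cis t)%C by ring.
  rewrite Cmod_mult, Cmod_cis, Cmod_R, Rabs_pos_eq by exact Hr. ring.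
Qed.

Lemma cis_2PI : cis (2 * PI) = cis 0.
Proof. unfold cis. now rewrite cos_2PI, sin_2PI, cos_0, sin_0. Qed.

Lemma circ_2PI (p : C) (r : R) : circ p r (2 * PI) = circ p r 0.
Proof. unfold circ. now rewrite cis_2PI. Qed.

Lemma cderiv_circ_t (p : C) (r t : R) : cderiv (circ p r) t (Ci * (RtoC r * cis t))%C.
Proof.
  unfold circ. eapply cderiv_eq.
  - apply cderiv_plus; [apply cderiv_const |]. apply cderiv_scal. apply cderiv_cis.
  - ring.
Qed.

Lemma cderiv_circ_r (p : C) (r t : R) : cderiv (fun r => circ p r t) r (cis t).
Proof.
  unfold circ. eapply cderiv_eq.
  - apply cderiv_plus; [apply cderiv_const |]. apply cderiv_mult; [apply cderiv_id | apply cderiv_const].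
  - cbv beta; ring.
Qed.

Lemma ccont2_snd (f : R -> C) : ccont f -> ccont2 (fun _ t => f t).
Proof.
  intro H; split; intros x y.
  - apply (continuity_1d_2d_pt_comp (fun t => Re (f t)) (fun _ t => t)).
    + apply continuity_pt_filterlim. exact (proj1 (H y)).
    + apply continuity_2d_pt_id2.
  - apply (continuity_1d_2d_pt_comp (fun t => Im (f t)) (fun _ t => t)).
    + apply continuity_pt_filterlim. exact (proj2 (H y)).
    + apply continuity_2d_pt_id2.
Qed.

Lemma ccont2_fst : ccont2 (fun r _ => RtoC r).
Proof.
  split; intros x y; simpl; [apply continuity_2d_pt_id1 | apply continuity_2d_pt_const].
Qed.

Lemma ccont_cis : ccont cis.
Proof. exact (ccont_cderiv _ _ cderiv_cis). Qed.

Lemma ccont2_circ (p : C) : ccont2 (circ p).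
Proof.
  unfold circ. apply ccont2_plus; [apply ccont2_const |].
  apply (ccont2_mult (fun r _ => RtoC r) (fun _ t => cis t)); [apply ccont2_fst |].
  apply ccont2_snd, ccont_cis.
Qed.

(** The derivative of the circle integral in the radius, multiplied by [i r], is the integral of the
    angular derivative of [F (circ p r t)], which vanishes by periodicity. The integral therefore
    keeps its value at radius 0. *)
Lemma mean_value (F : C -> C) (p : C) (r : R) : (forall z, hol 1 F z) -> 0 <= r ->
  CInt (fun t => F (circ p r t)) 0 (2 * PI) = (RtoC (2 * PI) * F p)%C.
Proof.
  intros HF Hr. destruct (hol_S_global 0 F HF) as [F1 [D C1]]. simpl in C1.
  assert (CF : forall z, Ccontin F z) by (intro z; eapply Cder_contin; apply D).
  assert (c2F : ccont2 (fun r t => F (circ p r t))) by (apply ccont2_comp; [exact CF | apply ccont2_circ]).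
  assert (c2g : ccont2 (fun r t => F1 (circ p r t) * cis t)%C).
  { apply ccont2_mult; [apply ccont2_comp; [exact C1 | apply ccont2_circ] | apply ccont2_snd, ccont_cis]. }
  assert (I1 : forall x, cderiv (fun x => CInt (fun t => F (circ p x t)) 0 (2 * PI)) x
     (CInt (fun t => F1 (circ p x t) * cis t)%C 0 (2 * PI))).
  { apply (cderiv_CInt_smooth (fun x t => F (circ p x t)) (fun x t => F1 (circ p x t) * cis t)%C).
    - intros x t. exact (cderiv_comp F (fun x => circ p x t) x _ _ (D _) (cderiv_circ_r p x t)).
    - exact c2g.
    - intro x. exact (ccont2_ccont _ x c2F). }
  assert (Z : forall x, 0 < x -> CInt (fun t => F1 (circ p x t) * cis t)%C 0 (2 * PI) = RtoC 0).
  { intros x Hx.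
    assert (E : (Ci * RtoC x * CInt (fun t => F1 (circ p x t) * cis t) 0 (2 * PI) = RtoC 0)%C).
    { rewrite <- CInt_scal by exact (ccont2_ccont _ x c2g).
      rewrite (CInt_of_cderiv (fun t => F (circ p x t))).
      - rewrite circ_2PI. ring.
      - intro t. eapply cderiv_eq; [exact (cderiv_comp F (circ p x) t _ _ (D _) (cderiv_circ_t p x t)) |].
        ring.
      - apply ccont_mult; [apply ccont_const | exact (ccont2_ccont _ x c2g)]. }
    destruct (Ceq_dec (CInt (fun t => F1 (circ p x t) * cis t)%C 0 (2 * PI)) (RtoC 0)) as [e|n]; [exact e |].
    exfalso. revert E. apply Cmult_neq_0; [| exact n].
    apply Cmult_neq_0.
    - intro e. apply (f_equal snd) in e. simpl in e. lra.
    - intro e. apply (f_equal fst) in e. simpl in e. lra. }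
  rewrite (const_of_cderiv_0 (fun x => CInt (fun t => F (circ p x t)) 0 (2 * PI)) 0 r) with (x := r).
  - rewrite (CInt_ext _ (fun t => RtoC 1 * F p)%C).
    2:{ intro t. unfold circ. replace (p + RtoC 0 * cis t)%C with p by ring. ring. }
    rewrite (CInt_of_cderiv (fun t => RtoC t * F p)%C).
    + ring.
    + intro t. eapply cderiv_eq.
      * apply cderiv_mult; [apply cderiv_id | apply cderiv_const].
      * cbv beta; ring.
    + apply ccont_const.
  - intros x Hx. rewrite <- (Z x ltac:(lra)). apply I1.
  - exact (ccont_cderiv _ _ I1).
  - lra.
Qed.

Lemma RInt_plus_cont (f g : R -> R) (a b : R) : (forall x, continuous f x) -> (forall x, continuous g x) ->
  RInt (fun x => f x + g x) a b = RInt f a b + RInt g a b.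
Proof.
  intros F G. apply (RInt_plus (V := R_CompleteNormedModule) f g);
    apply (@ex_RInt_continuous R_CompleteNormedModule); intros; [apply F | apply G].
Qed.

Lemma RInt_scal_cont (f : R -> R) (k a b : R) : (forall x, continuous f x) ->
  RInt (fun x => k * f x) a b = k * RInt f a b.
Proof.
  intros F. apply (RInt_scal (V := R_CompleteNormedModule) f a b k).
  apply (@ex_RInt_continuous R_CompleteNormedModule); intros; apply F.
Qed.

Lemma RInt_const_R (k a b : R) : RInt (fun _ => k) a b = (b - a) * k.
Proof. exact (RInt_const (V := R_CompleteNormedModule) a b k). Qed.

Lemma RInt_le_cont (f g : R -> R) (a b : R) : a <= b -> (forall x, continuous f x) ->
  (forall x, continuous g x) -> (forall x, a <= x <= b -> f x <= g x) -> RInt f a b <= RInt g a b.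
Proof.
  intros ab F G H. apply RInt_le; [exact ab | | | intros; apply H; lra];
    apply (@ex_RInt_continuous R_CompleteNormedModule); intros; [apply F | apply G].
Qed.

Lemma continuous_Rmult (f g : R -> R) (x : R) : continuous f x -> continuous g x ->
  continuous (fun t => f t * g t) x.
Proof. intros F G. exact (continuous_mult _ _ _ F G). Qed.

Lemma continuous_Rplus (f g : R -> R) (x : R) : continuous f x -> continuous g x ->
  continuous (fun t => f t + g t) x.
Proof. intros F G. exact (continuous_plus _ _ _ F G). Qed.

Lemma continuous_cos (x : R) : continuous cos x.
Proof. eapply is_derive_continuous. apply is_derive_cos. Qed.

Lemma continuous_sin (x : R) : continuous sin x.
Proof. eapply is_derive_continuous. apply is_derive_sin. Qed.

Lemma PI_pos_2 : 0 < 2 * PI.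
Proof. pose proof PI_RGT_0. lra. Qed.

(* u plays the role of the real part of a primitive of k. *)
Lemma primitive_fourier (u : R -> R) (k : C -> C) (p : C) (r : R) : 0 < r ->
  (forall z, hol 1 k z) -> u (2 * PI) = u 0 ->
  (forall t, is_derive u t (Re (Ci * (RtoC r * cis t) * k (circ p r t))%C)) ->
  RInt (fun t => u t * cos t) 0 (2 * PI) = PI * r * Re (k p) /\
  RInt (fun t => u t * sin t) 0 (2 * PI) = - (PI * r * Im (k p)).
Proof.
  intros Hr Hk per D.
  set (du := fun t => Re (Ci * (RtoC r * cis t) * k (circ p r t))%C) in D.
  assert (kc : forall z, Ccontin k z) by (intro z; eapply hol_contin; apply Hk).
  assert (ck : ccont (fun t => k (circ p r t))).
  { apply (ccont2_ccont (fun r t => k (circ p r t))). apply ccont2_comp; [exact kc | apply ccont2_circ]. }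
  assert (ce : ccont (fun t => cis t * cis t * k (circ p r t))%C).
  { apply ccont_mult; [apply ccont_mult; apply ccont_cis | exact ck]. }
  assert (cdu : forall t, continuous du t).
  { intro t. assert (cc : ccont (fun t => Ci * (RtoC r * cis t) * k (circ p r t))%C).
    { apply ccont_mult; [| exact ck]. apply ccont_mult; [apply ccont_const |].
      apply ccont_mult; [apply ccont_const | apply ccont_cis]. }
    exact (proj1 (cc t)). }
  assert (cu : forall t, continuous u t) by (intro t; eapply is_derive_continuous; apply D).
  pose proof (mean_value k p r Hk ltac:(lra)) as M0.
  (* The function [(z - p)^2 * k z] vanishes at [p], so its mean does too; on the circle this is the
     integral of [cis^2 * k] up to the factor [r^2]. *)
  assert (M2 : CInt (fun t => cis t * cis t * k (circ p r t))%C 0 (2 * PI) = RtoC 0).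
  { pose proof (mean_value (fun z => (z - p) * (z - p) * k z)%C p r) as M. cbv beta in M.
    assert (H1 : forall z, hol 1 (fun z => z - p)%C z).
    { intro z. apply (hol_plus 1 z (fun z => z) (fun _ => - p)%C); [apply hol_id | apply hol_const]. }
    specialize (M (fun z => hol_mult 1 z _ _ (hol_mult 1 z _ _ (H1 z) (H1 z)) (Hk z)) ltac:(lra)).
    rewrite (CInt_ext _ (fun t => (RtoC r * RtoC r) * (cis t * cis t * k (circ p r t)))%C) in M
      by (intro t; unfold circ; ring).
    rewrite CInt_scal in M by exact ce.
    replace (RtoC (2 * PI) * ((p - p) * (p - p) * k p))%C with (RtoC 0) in M by ring.
    destruct (Ceq_dec (CInt (fun t => cis t * cis t * k (circ p r t))%C 0 (2 * PI)) (RtoC 0)) as [e|n]; [exact e |].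
    exfalso. revert M. apply Cmult_neq_0; [| exact n].
    assert (RtoC r <> RtoC 0) by (intro e; apply (f_equal fst) in e; simpl in e; lra).
    now apply Cmult_neq_0. }
  pose proof (f_equal Re M0) as M0r. pose proof (f_equal Im M0) as M0i.
  pose proof (f_equal Re M2) as M2r. pose proof (f_equal Im M2) as M2i.
  rewrite re_scal_l in M0r.
  replace (Im (RtoC (2 * PI) * k p)) with (2 * PI * Im (k p)) in M0i by (rewrite im_mult; simpl; ring).
  unfold CInt in M0r, M0i, M2r, M2i; simpl in M0r, M0i, M2r, M2i.
  change (RInt (fun t => Re (k (circ p r t))) 0 (2 * PI) = 2 * PI * Re (k p)) in M0r.
  change (RInt (fun t => Im (k (circ p r t))) 0 (2 * PI) = 2 * PI * Im (k p)) in M0i.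
  change (RInt (fun t => Re (cis t * cis t * k (circ p r t))%C) 0 (2 * PI) = 0) in M2r.
  change (RInt (fun t => Im (cis t * cis t * k (circ p r t))%C) 0 (2 * PI) = 0) in M2i.
  set (kr := fun t => Re (k (circ p r t))) in *. set (ki := fun t => Im (k (circ p r t))) in *.
  set (er := fun t => Re (cis t * cis t * k (circ p r t))%C) in *.
  set (ei := fun t => Im (cis t * cis t * k (circ p r t))%C) in *.
  assert (ckr : forall t, continuous kr t) by (intro t; exact (proj1 (ck t))).
  assert (cki : forall t, continuous ki t) by (intro t; exact (proj2 (ck t))).
  assert (cer : forall t, continuous er t) by (intro t; exact (proj1 (ce t))).
  assert (cei : forall t, continuous ei t) by (intro t; exact (proj2 (ce t))).
  assert (dur : forall t, du t = - r * (kr t * sin t + ki t * cos t)).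
  { intro t. unfold du, kr, ki, cis. rewrite !re_mult, !im_mult. simpl. ring. }
  split.
  (* Integration by parts replaces [u cos] by [du sin], and the double-angle formulas split this
     into the real parts of [k] and of [cis^2 * k], whose integrals are known from [M0] and [M2]. *)
  - assert (P : RInt (fun t => du t * sin t + u t * cos t) 0 (2 * PI) = 0).
    { rewrite (RInt_of_derive (fun t => u t * sin t)).
      - rewrite sin_2PI, sin_0. req. ring.
      - intro t. exact (is_derive_Rmult _ _ _ _ _ (D t) (is_derive_sin t)).
      - intro t. apply continuous_Rplus; apply continuous_Rmult;
          [apply cdu | apply continuous_sin | apply cu | apply continuous_cos]. }
    rewrite RInt_plus_cont in P.
    2:{ intro t. apply continuous_Rmult; [apply cdu | apply continuous_sin]. }
    2:{ intro t. apply continuous_Rmult; [apply cu | apply continuous_cos]. }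
    rewrite (RInt_ext _ (fun t => (- r / 2) * kr t + (r / 2) * er t)) in P.
    2:{ intros t _. rewrite dur. unfold er. rewrite !re_mult, !im_mult. fold (kr t) (ki t).
        change (Re (cis t)) with (cos t). change (Im (cis t)) with (sin t).
        pose proof (cis_norm t) as N.
        replace (- r / 2 * kr t) with (- r / 2 * kr t * (cos t * cos t + sin t * sin t)) by (rewrite N; ring).
        req. field. }
    rewrite RInt_plus_cont in P by (intro t; apply continuous_Rmult; [apply continuous_const | auto]).
    rewrite !RInt_scal_cont in P by auto. rewrite M0r, M2r in P. lra.
  - assert (P : RInt (fun t => du t * cos t + u t * - sin t) 0 (2 * PI) = 0).
    { rewrite (RInt_of_derive (fun t => u t * cos t)).
      - rewrite cos_2PI, cos_0, per. req. ring.
      - intro t. exact (is_derive_Rmult _ _ _ _ _ (D t) (is_derive_cos t)).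
      - intro t. apply continuous_Rplus; apply continuous_Rmult;
          [apply cdu | apply continuous_cos | apply cu |].
        apply (continuous_opp sin). apply continuous_sin. }
    rewrite RInt_plus_cont in P.
    2:{ intro t. apply continuous_Rmult; [apply cdu | apply continuous_cos]. }
    2:{ intro t. apply continuous_Rmult; [apply cu |]. apply (continuous_opp sin). apply continuous_sin. }
    rewrite (RInt_ext (fun t => u t * - sin t) (fun t => (- 1) * (u t * sin t))) in P by (intros; req; ring).
    rewrite (RInt_scal_cont (fun t => u t * sin t)) in P.
    2:{ intro t. apply continuous_Rmult; [apply cu | apply continuous_sin]. }
    rewrite (RInt_ext _ (fun t => (- r / 2) * ki t + (- r / 2) * ei t)) in P.
    2:{ intros t _. rewrite dur. unfold ei. rewrite !im_mult, !re_mult. rewrite ?im_mult. fold (kr t) (ki t).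
        change (Re (cis t)) with (cos t). change (Im (cis t)) with (sin t).
        pose proof (cis_norm t) as N.
        replace (- r / 2 * ki t) with (- r / 2 * ki t * (cos t * cos t + sin t * sin t)) by (rewrite N; ring).
        req. field. }
    rewrite RInt_plus_cont in P by (intro t; apply continuous_Rmult; [apply continuous_const | auto]).
    rewrite !RInt_scal_cont in P by auto. rewrite M0i, M2i in P. lra.
Qed.

Lemma is_derive_ln_comp (f : R -> R) (x l : R) : 0 < f x -> is_derive f x l ->
  is_derive (fun t => ln (f t)) x (l / f x).
Proof.
  intros Hp H. eapply is_derive_eq.
  - exact (is_derive_comp ln f x (/ f x) l (is_derive_ln (f x) Hp) H).
  - unfold scal; simpl; unfold mult; simpl. field. lra.
Qed.

Lemma cdot_ge_0 (z : C) : 0 <= cdot z z.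
Proof. unfold cdot. nra. Qed.

Lemma cdot_gt_0 (z : C) : z <> RtoC 0 -> 0 < cdot z z.
Proof. intro N. rewrite cdot_diag. apply Cmod_gt_0 in N. nra. Qed.

Lemma cdot_mult (z w : C) : cdot (z * w) (z * w) = cdot z z * cdot w w.
Proof. unfold cdot. rewrite re_mult, im_mult. ring. Qed.

Lemma cdot_div (a z : C) : z <> RtoC 0 -> cdot a z / cdot z z = Re (a / z)%C.
Proof.
  intro N. pose proof (cdot_gt_0 z N) as P.
  assert (E : cdot a z = Re (a / z)%C * cdot z z).
  { replace a with ((a / z) * z)%C at 1 by (field; exact N).
    unfold cdot. rewrite re_mult, im_mult. ring. }
  rewrite E. field. lra.
Qed.

Lemma cont2_continuous_ln (f : R -> R -> C) (e x t : R) : ccont2 f -> 0 < cdot (f x t) (f x t) + e ->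
  continuous (fun t => ln (cdot (f x t) (f x t) + e)) t.
Proof.
  intros H P. apply (continuous_comp (fun t => cdot (f x t) (f x t) + e) ln).
  - apply (continuous_Rplus (fun t => cdot (f x t) (f x t)) (fun _ => e)); [| apply continuous_const].
    exact (cont2_continuous _ x t (cont2_cdot _ _ H H)).
  - eapply is_derive_continuous. now apply is_derive_ln.
Qed.

Lemma cont2_quotient (f g : R -> R -> R) : cont2 f -> cont2 g -> (forall x y, g x y <> 0) ->
  cont2 (fun x y => f x y / g x y).
Proof.
  intros F G N x y. apply continuity_2d_pt_mult; [apply F |].
  apply continuity_2d_pt_inv; [apply G | apply N].
Qed.

Lemma cont2_plus (f g : R -> R -> R) : cont2 f -> cont2 g -> cont2 (fun x y => f x y + g x y).
Proof. intros F G x y. apply continuity_2d_pt_plus; [apply F | apply G]. Qed.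

Lemma cont2_mult (f g : R -> R -> R) : cont2 f -> cont2 g -> cont2 (fun x y => f x y * g x y).
Proof. intros F G x y. apply continuity_2d_pt_mult; [apply F | apply G]. Qed.

Lemma cont2_minus (f g : R -> R -> R) : cont2 f -> cont2 g -> cont2 (fun x y => f x y - g x y).
Proof. intros F G x y. apply continuity_2d_pt_minus; [apply F | apply G]. Qed.

Lemma cont2_const (k : R) : cont2 (fun _ _ => k).
Proof. intros x y. apply continuity_2d_pt_const. Qed.

Lemma cont2_scal (f : R -> R -> R) (k : R) : cont2 f -> cont2 (fun x y => k * f x y).
Proof. intros F. apply (cont2_mult (fun _ _ => k) f); [apply cont2_const | exact F]. Qed.

Lemma is_derive_quotient (f g : R -> R) (x l m : R) : g x <> 0 -> is_derive f x l -> is_derive g x m ->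
  is_derive (fun t => f t / g t) x ((l * g x - f x * m) / (g x * g x)).
Proof.
  intros N F G. eapply is_derive_eq.
  - exact (is_derive_div f g x l m F G N).
  - simpl. field. exact N.
Qed.

(* ln (|f|^2 + e) is subharmonic: with s = ln r its Laplacian in (s, t) is
   4 e |z f'|^2 / (|f|^2 + e)^2, so the derivative of its circle mean is r^{-1} times a
   nondecreasing function vanishing at 0. *)
Lemma log_mean_ge (f : C -> C) (p : C) (r e : R) : (forall z, hol 2 f z) -> 0 < e -> 0 <= r ->
  2 * PI * ln (cdot (f p) (f p) + e) <=
  RInt (fun t => ln (cdot (f (circ p r t)) (f (circ p r t)) + e)) 0 (2 * PI).
Proof.
  intros Hf He Hr.
  destruct (hol_S_global 1 f Hf) as [f1 [D1 H1]]. destruct (hol_S_global 0 f1 H1) as [f2 [D2 C2]].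
  simpl in C2.
  set (F := fun r t => f (circ p r t)). set (F1 := fun r t => f1 (circ p r t)).
  set (F2 := fun r t => f2 (circ p r t)).
  set (z := fun r t => (RtoC r * cis t)%C).
  assert (cz : ccont2 z).
  { apply (ccont2_mult (fun r _ => RtoC r) (fun _ t => cis t)); [apply ccont2_fst | apply ccont2_snd, ccont_cis]. }
  assert (cF : ccont2 F).
  { apply ccont2_comp; [intro; eapply Cder_contin; apply D1 | apply ccont2_circ]. }
  assert (cF1 : ccont2 F1).
  { apply ccont2_comp; [intro; eapply Cder_contin; apply D2 | apply ccont2_circ]. }
  assert (cF2 : ccont2 F2) by (apply ccont2_comp; [exact C2 | apply ccont2_circ]).
  assert (ce : ccont2 (fun _ t => cis t)) by apply ccont2_snd, ccont_cis.
  set (Dn := fun r t => cdot (F r t) (F r t) + e).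
  assert (Dp : forall r t, 0 < Dn r t) by (intros; unfold Dn; pose proof (cdot_ge_0 (F r0 t)); lra).
  assert (cDn : cont2 Dn) by (apply cont2_plus; [now apply cont2_cdot | apply cont2_const]).
  assert (Dn0 : forall r t, Dn r t <> 0) by (intros r0 t; specialize (Dp r0 t); lra).
  assert (Fr : forall r t, cderiv (fun r => F r t) r (F1 r t * cis t)%C).
  { intros x t. exact (cderiv_comp f (fun x => circ p x t) x _ _ (D1 _) (cderiv_circ_r p x t)). }
  assert (Ft : forall r t, cderiv (F r) t (F1 r t * (Ci * z r t))%C).
  { intros x t. exact (cderiv_comp f (circ p x) t _ _ (D1 _) (cderiv_circ_t p x t)). }
  assert (F1r : forall r t, cderiv (fun r => F1 r t) r (F2 r t * cis t)%C).
  { intros x t. exact (cderiv_comp f1 (fun x => circ p x t) x _ _ (D2 _) (cderiv_circ_r p x t)). }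
  assert (F1t : forall r t, cderiv (F1 r) t (F2 r t * (Ci * z r t))%C).
  { intros x t. exact (cderiv_comp f1 (circ p x) t _ _ (D2 _) (cderiv_circ_t p x t)). }
  assert (zr : forall r t, cderiv (fun r => z r t) r (cis t)).
  { intros x t. unfold z. eapply cderiv_eq.
    - apply cderiv_mult; [apply cderiv_id | apply cderiv_const].
    - cbv beta; ring. }
  assert (zt : forall r t, cderiv (z r) t (Ci * z r t)%C).
  { intros x t. unfold z. eapply cderiv_eq; [apply cderiv_scal, cderiv_cis | ring]. }
  assert (Dr : forall r t, is_derive (fun r => Dn r t) r (2 * cdot (F1 r t * cis t)%C (F r t))).
  { intros x t. eapply is_derive_eq.
    - apply (is_derive_plus (K := R_AbsRing) (V := R_NormedModule) (fun x => cdot (F x t) (F x t)) (fun _ => e)).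
      + apply is_derive_cdot; apply Fr.
      + apply (is_derive_const (K := R_AbsRing) (V := R_NormedModule)).
    - rewrite (cdot_sym (F x t)). unfold plus, zero; simpl. ring. }
  assert (Dt : forall r t, is_derive (Dn r) t (2 * cdot (F1 r t * (Ci * z r t))%C (F r t))).
  { intros x t. eapply is_derive_eq.
    - apply (is_derive_plus (K := R_AbsRing) (V := R_NormedModule) (fun t => cdot (F x t) (F x t)) (fun _ => e)).
      + apply is_derive_cdot; apply Ft.
      + apply (is_derive_const (K := R_AbsRing) (V := R_NormedModule)).
    - rewrite (cdot_sym (F x t)). unfold plus, zero; simpl. ring. }
  (* [vr] is the radial derivative of [ln (Dn r t)], [b] is [r] times it and [c] is the angular
     derivative; [br] and [ct] differentiate [b] in [r] and [c] in [t]. Thus [r * br + ct] is the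
     Laplacian in the variables [(ln r, t)]. *)
  set (vr := fun r t => 2 * cdot (F1 r t * cis t)%C (F r t) / Dn r t).
  set (b := fun r t => 2 * cdot (F1 r t * z r t)%C (F r t) / Dn r t).
  set (c := fun r t => 2 * cdot (F1 r t * (Ci * z r t))%C (F r t) / Dn r t).
  set (A1r := fun r t => (F2 r t * cis t * z r t + F1 r t * cis t)%C).
  set (br := fun r t => (2 * (cdot (A1r r t) (F r t) + cdot (F1 r t * z r t) (F1 r t * cis t)) * Dn r t
     - 2 * cdot (F1 r t * z r t) (F r t) * (2 * cdot (F1 r t * cis t) (F r t))) / (Dn r t * Dn r t)).
  set (A1t := fun r t => (F2 r t * (Ci * z r t) * (Ci * z r t) + F1 r t * (Ci * (Ci * z r t)))%C).
  set (ct := fun r t => (2 * (cdot (A1t r t) (F r t) + cdot (F1 r t * (Ci * z r t)) (F1 r t * (Ci * z r t))) * Dn r t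
     - 2 * cdot (F1 r t * (Ci * z r t)) (F r t) * (2 * cdot (F1 r t * (Ci * z r t)) (F r t))) / (Dn r t * Dn r t)).
  assert (cCz : ccont2 (fun r t => Ci * z r t)%C) by (apply (ccont2_mult (fun _ _ => Ci)); [apply ccont2_const | exact cz]).
  assert (cvr : cont2 vr).
  { apply cont2_quotient; [apply cont2_scal, cont2_cdot; [now apply ccont2_mult | exact cF] | exact cDn | exact Dn0]. }
  assert (cb : cont2 b).
  { apply cont2_quotient; [apply cont2_scal, cont2_cdot; [now apply ccont2_mult | exact cF] | exact cDn | exact Dn0]. }
  assert (cA1r : ccont2 A1r).
  { apply ccont2_plus; [apply ccont2_mult; [now apply ccont2_mult | exact cz] | now apply ccont2_mult]. }
  assert (cA1t : ccont2 A1t).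
  { apply ccont2_plus; [apply ccont2_mult; [now apply ccont2_mult | exact cCz] | apply ccont2_mult; [exact cF1 |]].
    apply (ccont2_mult (fun _ _ => Ci)); [apply ccont2_const | exact cCz]. }
  assert (DD0 : forall r t, Dn r t * Dn r t <> 0) by (intros; now apply Rmult_integral_contrapositive_currified).
  assert (cbr : cont2 br).
  { apply cont2_quotient; [apply cont2_minus | now apply cont2_mult | exact DD0].
    - apply cont2_mult; [apply cont2_scal, cont2_plus; apply cont2_cdot; try assumption; now apply ccont2_mult | exact cDn].
    - apply cont2_mult; apply cont2_scal, cont2_cdot; try assumption; now apply ccont2_mult. }
  assert (cct : cont2 ct).
  { apply cont2_quotient; [apply cont2_minus | now apply cont2_mult | exact DD0].
    - apply cont2_mult; [apply cont2_scal, cont2_plus; apply cont2_cdot; try assumption; now apply ccont2_mult | exact cDn].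
    - apply cont2_mult; apply cont2_scal, cont2_cdot; try assumption; now apply ccont2_mult. }
  assert (vD : forall x t, is_derive (fun r => ln (Dn r t)) x (vr x t)).
  { intros x t. exact (is_derive_ln_comp (fun r => Dn r t) x _ (Dp x t) (Dr x t)). }
  assert (bD : forall x t, is_derive (fun r => b r t) x (br x t)).
  { intros x t. unfold b, br. eapply is_derive_eq.
    - apply (is_derive_quotient (fun r => 2 * cdot (F1 r t * z r t)%C (F r t)) (fun r => Dn r t)); [apply Dn0 | | apply Dr].
      apply (is_derive_scal (fun r => cdot (F1 r t * z r t)%C (F r t))).
      apply is_derive_cdot; [| apply Fr]. apply cderiv_mult; [apply F1r | apply zr].
    - unfold A1r. reflexivity. }
  assert (cD : forall x t, is_derive (c x) t (ct x t)).
  { intros x t. unfold c, ct. eapply is_derive_eq.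
    - apply (is_derive_quotient (fun t => 2 * cdot (F1 x t * (Ci * z x t))%C (F x t)) (Dn x)); [apply Dn0 | | apply Dt].
      apply (is_derive_scal (fun t => cdot (F1 x t * (Ci * z x t))%C (F x t))).
      apply is_derive_cdot; [| apply Ft]. apply cderiv_mult; [apply F1t |]. apply cderiv_scal. apply zt.
    - unfold A1t. reflexivity. }
  (* [A1t] is minus [x * A1r], so the second derivatives of [f] cancel. The squares of the inner
     products of [F1 z] and [i F1 z] with [F] add up to [|F1 z|^2 |F|^2], and only the part of [Dn]
     equal to [e] survives. *)
  assert (lap : forall x t, 0 <= x * br x t + ct x t).
  { intros x t. unfold br, ct.
    replace (x * ((2 * (cdot (A1r x t) (F x t) + cdot (F1 x t * z x t) (F1 x t * cis t)) * Dn x t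
       - 2 * cdot (F1 x t * z x t) (F x t) * (2 * cdot (F1 x t * cis t) (F x t))) / (Dn x t * Dn x t))
      + (2 * (cdot (A1t x t) (F x t) + cdot (F1 x t * (Ci * z x t)) (F1 x t * (Ci * z x t))) * Dn x t
       - 2 * cdot (F1 x t * (Ci * z x t)) (F x t) * (2 * cdot (F1 x t * (Ci * z x t)) (F x t))) / (Dn x t * Dn x t))
    with (4 * e * cdot (F1 x t * z x t) (F1 x t * z x t) / (Dn x t * Dn x t)).
    - apply Rmult_le_pos; [apply Rmult_le_pos; [lra | apply cdot_ge_0] |].
      left; apply Rinv_0_lt_compat. specialize (Dp x t). nra.
    - unfold Rdiv. rewrite <- Rmult_assoc, <- Rmult_plus_distr_r. f_equal.
      unfold A1r, A1t, Dn, z, cdot, cis. rewrite ?re_plus, ?im_plus.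
      repeat rewrite ?re_mult, ?im_mult. simpl.
      generalize (Re (F x t)) (Im (F x t)) (Re (F1 x t)) (Im (F1 x t)) (Re (F2 x t)) (Im (F2 x t)).
      intros. ring. }
  set (B := fun x => RInt (b x) 0 (2 * PI)).
  assert (BD : forall x, is_derive B x (RInt (br x) 0 (2 * PI))).
  { apply is_derive_RInt_smooth; [exact bD | exact cbr |]. intros x t. now apply cont2_continuous. }
  assert (ct0 : forall x, RInt (ct x) 0 (2 * PI) = 0).
  { intro x. rewrite (RInt_of_derive (c x)); [| apply cD | intro t; now apply cont2_continuous].
    unfold c, Dn, F, F1, z. rewrite circ_2PI, cis_2PI. req. ring. }
  assert (Br0 : forall x, 0 < x -> 0 <= RInt (br x) 0 (2 * PI)).
  { intros x Hx.
    assert (K : 0 <= RInt (fun t => x * br x t + ct x t) 0 (2 * PI)).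
    { apply RInt_ge_0; [pose proof PI_pos_2; lra | | intros; apply lap].
      apply (@ex_RInt_continuous R_CompleteNormedModule). intros t _.
      apply continuous_Rplus; [apply continuous_Rmult; [apply continuous_const |] |]; now apply cont2_continuous. }
    rewrite RInt_plus_cont, RInt_scal_cont, ct0 in K;
      try (intro t; now apply cont2_continuous).
    2:{ intro t. apply continuous_Rmult; [apply continuous_const | now apply cont2_continuous]. }
    apply Rmult_le_reg_l with x; lra. }
  assert (Bpos : forall x, 0 <= x -> 0 <= B x).
  { intros x Hx.
    apply Rle_trans with (B 0).
    - right. unfold B. rewrite (RInt_ext _ (fun _ => 0)).
      + rewrite RInt_const_R. ring.
      + intros t _. unfold b, z. replace (F1 0 t * (RtoC 0 * cis t))%C with (RtoC 0) by ring.
        unfold cdot. simpl. req. field. apply Dn0.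
    - apply (nondecreasing_of_derive_interior B (fun x => RInt (br x) 0 (2 * PI))); [exact Hx | intros; apply BD |].
      intros y Hy. apply Br0. lra. }
  assert (AD : forall x, is_derive (fun x => RInt (fun t => ln (Dn x t)) 0 (2 * PI)) x (RInt (vr x) 0 (2 * PI))).
  { apply (is_derive_RInt_smooth (fun x t => ln (Dn x t))); [exact vD | exact cvr |].
    intros x t. apply (cont2_continuous_ln F e x t cF). apply Dp. }
  apply Rle_trans with (RInt (fun t => ln (Dn 0 t)) 0 (2 * PI)).
  - right. rewrite (RInt_ext _ (fun _ => ln (cdot (f p) (f p) + e))).
    + rewrite RInt_const_R. ring.
    + intros t _. unfold Dn, F, circ. now replace (p + RtoC 0 * cis t)%C with p by ring.
  - apply (nondecreasing_of_derive_interior (fun x => RInt (fun t => ln (Dn x t)) 0 (2 * PI))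
      (fun x => RInt (vr x) 0 (2 * PI))); [exact Hr | intros; apply AD |].
    intros x Hx.
    assert (E : x * RInt (vr x) 0 (2 * PI) = B x).
    { rewrite <- RInt_scal_cont by (intro t; now apply cont2_continuous).
      unfold B. apply RInt_ext. intros t _. unfold b, vr, z, cdot.
      replace (F1 x t * (RtoC x * cis t))%C with (RtoC x * (F1 x t * cis t))%C by ring.
      rewrite re_scal_l. replace (Im (RtoC x * (F1 x t * cis t))) with (x * Im (F1 x t * cis t)%C)
        by (rewrite (im_mult (RtoC x)); simpl; ring).
      req. field. apply Dn0. }
    apply Rmult_le_reg_l with x; [lra |]. rewrite E, Rmult_0_r. apply Bpos; lra.
Qed.

(** The radial derivative of the mean is twice the real part of the integral of [k * cis] with
    [k = h1 / h]; this is zero by the mean value property of [(z - p) * k z] at [p]. *)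
Lemma log_mean_eq (h h1 : C -> C) (p : C) (r : R) :
  (forall z, Cder h z (h1 z)) -> (forall z, hol 1 h1 z) -> (forall z, h z <> RtoC 0) -> 0 <= r ->
  RInt (fun t => ln (cdot (h (circ p r t)) (h (circ p r t)))) 0 (2 * PI) =
  2 * PI * ln (cdot (h p) (h p)).
Proof.
  intros D H1 N Hr.
  assert (hc : forall z, hol 1 h z).
  { intro z. exists h1. split; [exists 1; split; [lra |]; intros; apply D | eapply hol_contin; apply H1]. }
  set (k := fun z => (h1 z * / h z)%C).
  assert (Hk : forall z, hol 1 k z) by (intro z; apply hol_mult; [apply H1 | apply hol_inv; [apply hc | apply N]]).
  set (F := fun r t => h (circ p r t)).
  assert (cF : ccont2 F) by (apply ccont2_comp; [intro; eapply Cder_contin; apply D | apply ccont2_circ]).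
  set (K := fun r t => (k (circ p r t) * cis t)%C).
  assert (cK : ccont2 K).
  { apply ccont2_mult; [apply ccont2_comp; [intro; eapply hol_contin; apply Hk | apply ccont2_circ] |].
    apply ccont2_snd, ccont_cis. }
  assert (AD : forall x, is_derive (fun x => RInt (fun t => ln (cdot (F x t) (F x t))) 0 (2 * PI)) x
      (RInt (fun t => 2 * Re (K x t)) 0 (2 * PI))).
  { apply (is_derive_RInt_smooth (fun x t => ln (cdot (F x t) (F x t))) (fun x t => 2 * Re (K x t))).
    - intros x t. eapply is_derive_eq.
      + apply (is_derive_ln_comp (fun x => cdot (F x t) (F x t))); [apply cdot_gt_0, N |].
        apply is_derive_cdot; exact (cderiv_comp h (fun x => circ p x t) x _ _ (D _) (cderiv_circ_r p x t)).
      + rewrite (cdot_sym (F x t)).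
        replace (K x t) with (h1 (circ p x t) * cis t / F x t)%C
          by (unfold K, k, F; field; apply N).
        rewrite <- cdot_div by apply N. field. pose proof (cdot_gt_0 (F x t) (N _)). lra.
    - apply cont2_scal. exact (proj1 cK).
    - intros x t. pose proof (cont2_continuous_ln F 0 x t cF) as c0.
      eapply continuous_ext; [| apply c0; rewrite Rplus_0_r; apply cdot_gt_0, N].
      intro y. cbv beta. now rewrite Rplus_0_r. }
  transitivity (RInt (fun t => ln (cdot (F 0 t) (F 0 t))) 0 (2 * PI)).
  - apply (const_of_derive_0 (fun x => RInt (fun t => ln (cdot (F x t) (F x t))) 0 (2 * PI)) 0 r); [| | lra].
    + intros x Hx. eapply is_derive_eq; [apply AD |].
      pose proof (mean_value (fun z => (z - p) * k z)%C p x) as M. cbv beta in M.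
      assert (H2 : forall z, hol 1 (fun z => (z - p) * k z)%C z).
      { intro z. apply (hol_mult 1 z (fun z => z - p)%C); [| apply Hk].
        apply (hol_plus 1 z (fun z => z) (fun _ => - p)%C); [apply hol_id | apply hol_const]. }
      specialize (M H2 ltac:(lra)).
      rewrite (CInt_ext _ (fun t => RtoC x * K x t)%C) in M by (intro; unfold K, circ; ring).
      rewrite CInt_scal in M by exact (ccont2_ccont _ x cK).
      apply (f_equal Re) in M. rewrite re_scal_l in M. unfold CInt in M. simpl in M.
      rewrite RInt_scal_cont by (intro t; exact (cont2_continuous (fun x t => Re (K x t)) x t (proj1 cK))).
      change (x * RInt (fun t => Re (K x t)) 0 (2 * PI) = Re (RtoC (2 * PI) * ((p - p) * k p))) in M.
      replace (RtoC (2 * PI) * ((p - p) * k p))%C with (RtoC 0) in M by ring. change (Re (RtoC 0)) with 0 in M.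
      assert (RInt (fun t => Re (K x t)) 0 (2 * PI) = 0) by (apply Rmult_eq_reg_l with x; lra). lra.
    + intros x _. eapply is_derive_continuous. apply AD.
  - rewrite (RInt_ext _ (fun _ => ln (cdot (h p) (h p)))).
    + rewrite RInt_const_R. req. ring.
    + intros t _. unfold F, circ. now replace (p + RtoC 0 * cis t)%C with p by ring.
Qed.

(** * Growth of order one half *)

(** The 1 under the root keeps the root at least 1, so that constants and factors such as
    [sqrt (1 + |z|)] are absorbed by the exponential without a case of small [z]. *)
Definition order_half (F : C -> C) : Prop :=
  exists A B, 0 <= A /\ 0 <= B /\ forall z, Cmod (F z) <= A * exp (B * sqrt (1 + Cmod z)).

Lemma sqrt_1_Cmod (z : C) : 1 <= sqrt (1 + Cmod z).
Proof. rewrite <- sqrt_1 at 1. apply sqrt_le_1_alt. pose proof (Cmod_ge_0 z). lra. Qed.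

Lemma order_half_mult (F G : C -> C) : order_half F -> order_half G -> order_half (fun z => F z * G z)%C.
Proof.
  intros [A [B [a [b H]]]] [A' [B' [a' [b' H']]]].
  exists (A * A'), (B + B'). split; [nra |]. split; [lra |]. intro z.
  rewrite Cmod_mult, Rmult_plus_distr_r, exp_plus.
  replace (A * A' * (exp (B * sqrt (1 + Cmod z)) * exp (B' * sqrt (1 + Cmod z))))
    with ((A * exp (B * sqrt (1 + Cmod z))) * (A' * exp (B' * sqrt (1 + Cmod z)))) by ring.
  apply Rmult_le_compat; try apply Cmod_ge_0; auto.
Qed.

Lemma order_half_plus (F G : C -> C) : order_half F -> order_half G -> order_half (fun z => F z + G z)%C.
Proof.
  intros [A [B [a [b H]]]] [A' [B' [a' [b' H']]]].
  exists (A + A'), (B + B'). split; [lra |]. split; [lra |]. intro z.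
  apply Rle_trans with (1 := Cmod_triangle _ _). specialize (H z). specialize (H' z).
  pose proof (sqrt_1_Cmod z) as s1.
  assert (exp (B * sqrt (1 + Cmod z)) <= exp ((B + B') * sqrt (1 + Cmod z))) by (apply exp_mono; nra).
  assert (exp (B' * sqrt (1 + Cmod z)) <= exp ((B + B') * sqrt (1 + Cmod z))) by (apply exp_mono; nra).
  rewrite Rmult_plus_distr_r. apply Rplus_le_compat.
  - apply Rle_trans with (1 := H). now apply Rmult_le_compat_l.
  - apply Rle_trans with (1 := H'). now apply Rmult_le_compat_l.
Qed.

Lemma order_half_const (k : C) : order_half (fun _ => k).
Proof.
  exists (Cmod k), 0. split; [apply Cmod_ge_0 |]. split; [lra |]. intro z.
  rewrite Rmult_0_l, exp_0. lra.
Qed.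

Lemma order_half_minus (F G : C -> C) : order_half F -> order_half G -> order_half (fun z => F z - G z)%C.
Proof.
  intros HF HG. destruct (order_half_plus F (fun z => (- RtoC 1) * G z)%C HF) as (A & B & a & b & H).
  - apply (order_half_mult (fun _ => (- RtoC 1)%C) G); [apply order_half_const | exact HG].
  - exists A, B. split; [exact a |]. split; [exact b |]. intro z. specialize (H z).
    now replace (F z - G z)%C with (F z + - RtoC 1 * G z)%C by ring.
Qed.

Lemma order_half_id : order_half (fun z => z).
Proof.
  exists 4, 1. split; [lra |]. split; [lra |]. intro z.
  pose proof (sqrt_1_Cmod z) as s1. pose proof (Cmod_ge_0 z).
  assert (E : sqrt (1 + Cmod z) * sqrt (1 + Cmod z) = 1 + Cmod z) by (apply sqrt_sqrt; lra).
  set (x := sqrt (1 + Cmod z)) in *.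
  pose proof (exp_ineq1_le (x / 2)). replace (1 * x) with (x / 2 + x / 2) by field. rewrite exp_plus.
  assert ((1 + x / 2) * (1 + x / 2) <= exp (x / 2) * exp (x / 2)) by (apply Rmult_le_compat; lra).
  nra.
Qed.

Lemma le_0_of_sublinear (x c1 c2 c3 : R) : 0 <= c1 -> 0 <= c2 -> 0 <= c3 ->
  (forall r, 0 < r -> r * x <= c1 + c2 * sqrt (c3 + r)) -> x <= 0.
Proof.
  intros h1 h2 h3 H. destruct (Rle_dec x 0) as [Hx|Hx]; [exact Hx | exfalso].
  apply Rnot_le_lt in Hx.
  (* The radius [s * s - c3] turns the root into [s]; this [s] is large enough for the quadratic
     left side to exceed the linear right side. *)
  set (s := (c1 + c3 * x + c2) / x + 1 + c3).
  assert (D : 0 <= (c1 + c3 * x + c2) / x).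
  { apply Rmult_le_pos; [nra | left; now apply Rinv_0_lt_compat]. }
  assert (s1 : 1 + c3 <= s) by (unfold s; lra).
  assert (sx : s * x = c1 + c3 * x + c2 + (1 + c3) * x) by (unfold s; field; lra).
  specialize (H (s * s - c3)). replace (c3 + (s * s - c3)) with (s * s) in H by ring.
  rewrite sqrt_square in H by lra.
  assert (0 < s * s - c3) by nra. specialize (H ltac:(assumption)).
  assert (s * (s * x) = s * (c1 + c3 * x + c2 + (1 + c3) * x)) by (rewrite sx; ring).
  assert (0 <= c3 * x) by nra.
  assert (c1 + c3 * x <= s * (c1 + c3 * x)) by nra.
  assert (0 < s * ((1 + c3) * x)) by (apply Rmult_lt_0_compat; nra).
  nra.
Qed.

Lemma ln_sqr_bound (M s B : R) : 0 <= M -> 0 <= B -> 0 <= s ->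
  ln ((M * exp (B * s)) * (M * exp (B * s)) + 1) <= 2 * M + 2 * B * s.
Proof.
  intros h1 h2 h3.
  rewrite <- (ln_exp (2 * M + 2 * B * s)).
  assert (e1 : 1 <= exp (B * s)).
  { pose proof (exp_ineq1_le (B * s)). assert (0 <= B * s) by nra. lra. }
  apply ln_le; [nra |].
  replace (2 * M + 2 * B * s) with (M + M + (B * s + B * s)) by ring.
  rewrite (exp_plus (M + M)), (exp_plus M), (exp_plus (B * s)).
  pose proof (exp_ineq1_le M). set (E := exp (B * s)) in *.
  assert (1 + M * M <= exp M * exp M).
  { assert ((1 + M) * (1 + M) <= exp M * exp M) by (apply Rmult_le_compat; lra). nra. }
  assert (1 <= E * E) by nra.
  replace (M * E * (M * E) + 1) with (M * M * (E * E) + 1) by ring.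
  assert ((1 + M * M) * (E * E) <= exp M * exp M * (E * E)) by (apply Rmult_le_compat_r; lra). lra.
Qed.

Lemma Rabs_half_ln_diff (x y L : R) : 0 <= L -> x <= L -> y <= L -> Rabs (x / 2 - y / 2) <= 2 * L - x / 2 - y / 2.
Proof. intros. unfold Rabs; destruct Rcase_abs; lra. Qed.

Lemma RInt_cos_bound (u w : R -> R) (trig : R -> R) :
  (forall t, continuous u t) -> (forall t, continuous w t) -> (forall t, continuous trig t) ->
  (forall t, Rabs (trig t) <= 1) ->
  (forall t, 0 <= t <= 2 * PI -> Rabs (u t) <= w t) ->
  Rabs (RInt (fun t => u t * trig t) 0 (2 * PI)) <= RInt w 0 (2 * PI).
Proof.
  intros cu cw ct B H.
  apply RInt_abs_le_fun; [pose proof PI_pos_2; lra | | exact cw |].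
  - intro t. now apply continuous_Rmult.
  - intros t Ht. rewrite Rabs_mult. specialize (B t). specialize (H t Ht).
    pose proof (Rabs_pos (u t)). pose proof (Rabs_pos (trig t)). nra.
Qed.

Lemma Rabs_cos_le (t : R) : Rabs (cos t) <= 1.
Proof. apply Rabs_le. pose proof (COS_bound t). lra. Qed.

Lemma Rabs_sin_le (t : R) : Rabs (sin t) <= 1.
Proof. apply Rabs_le. pose proof (SIN_bound t). lra. Qed.

(* The logarithm of h = f / g is harmonic; its circle means are controlled from above by the
   growth of f and g, and from below by Jensen's inequality for g, where ln (|g|^2 + e)
   replaces ln |g|^2 to avoid the zeros of g. *)
Lemma quotient_log_derivative_0 (f g h h1 : C -> C) (p : C) :
  order_half f -> order_half g -> (forall z, hol 2 g z) ->
  (forall z, Cder h z (h1 z)) -> (forall z, hol 1 h1 z) -> (forall z, h z <> RtoC 0) ->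
  (forall z, f z = (h z * g z)%C) -> g p <> RtoC 0 -> h1 p = RtoC 0.
Proof.
  intros [Af [Bf [af [bf Hf]]]] [Ag [Bg [ag [bg Hg]]]] g2 D H1 N E gp.
  assert (h2 : forall z, hol 1 h z).
  { intro z. exists h1. split; [exists 1; split; [lra |]; intros; apply D | eapply hol_contin; apply H1]. }
  set (k := fun z => (h1 z * / h z)%C).
  assert (Hk : forall z, hol 1 k z) by (intro z; apply hol_mult; [apply H1 | apply hol_inv; [apply h2 | apply N]]).
  set (c0 := - ln (cdot (h p) (h p)) / 2 - ln (cdot (g p) (g p))).
  set (A := Af + Ag). set (B := Bf + Bg).
  assert (main : forall r, 0 < r ->
    Rabs (PI * r * Re (k p)) <= 2 * PI * (2 * (2 * A + 2 * B * sqrt (1 + Cmod p + r)) + c0) /\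
    Rabs (- (PI * r * Im (k p))) <= 2 * PI * (2 * (2 * A + 2 * B * sqrt (1 + Cmod p + r)) + c0)).
  { intros r Hr.
    set (hc := fun t => h (circ p r t)). set (gc := fun t => g (circ p r t)).
    assert (ch2 : ccont2 (fun r t => h (circ p r t))).
    { apply ccont2_comp; [intro; eapply Cder_contin; apply D | apply ccont2_circ]. }
    assert (cg2 : ccont2 (fun r t => g (circ p r t))).
    { apply ccont2_comp; [intro; eapply hol_contin; apply g2 | apply ccont2_circ]. }
    pose proof PI_pos_2 as P2.
    destruct (continuity_ab_maj (fun t => cdot (hc t) (hc t)) 0 (2 * PI)) as [tm [Htm _]]; [lra | |].
    { intros t _. apply continuity_pt_filterlim.
      exact (cont2_continuous _ r t (cont2_cdot _ _ ch2 ch2)). }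
    set (Hm := cdot (hc tm) (hc tm)) in *. assert (Hm0 : 0 <= Hm) by apply cdot_ge_0.
    (* With [Hm] the maximum of [|h|^2] on the circle, both [e] and [e * |h|^2] are at most 1 there:
       replacing [|g|^2] by [|g|^2 + e] raises [|g|^2] and [|f|^2 = |h g|^2] by at most 1. *)
    set (e := / (Hm + 1)). assert (e0 : 0 < e) by (apply Rinv_0_lt_compat; lra).
    assert (e1 : e * (Hm + 1) = 1) by (unfold e; field; lra).
    set (u := fun t => / 2 * ln (cdot (hc t) (hc t))).
    set (Y := fun t => cdot (gc t) (gc t) + e).
    assert (Y0 : forall t, 0 < Y t) by (intro t; unfold Y; pose proof (cdot_ge_0 (gc t)); lra).
    assert (hp : forall t, 0 < cdot (hc t) (hc t)) by (intro t; apply cdot_gt_0, N).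
    set (s := sqrt (1 + Cmod p + r)). set (L := 2 * A + 2 * B * s).
    assert (s0 : 0 <= s) by apply sqrt_pos.
    assert (L0 : 0 <= L) by (unfold L, A, B; assert (0 <= (Bf + Bg) * s) by nra; lra).
    assert (sc : forall t, sqrt (1 + Cmod (circ p r t)) <= s).
    { intro t. apply sqrt_le_1_alt. pose proof (circ_dist p r t ltac:(lra)) as cd.
      pose proof (Cmod_triangle (circ p r t - p) p) as T.
      replace (circ p r t - p + p)%C with (circ p r t) in T by ring. lra. }
    assert (gb : forall t, cdot (gc t) (gc t) <= (Ag * exp (Bg * s)) * (Ag * exp (Bg * s))).
    { intro t. rewrite cdot_diag.
      assert (Cmod (gc t) <= Ag * exp (Bg * s)).
      { apply Rle_trans with (1 := Hg _). apply Rmult_le_compat_l; [exact ag |].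
        apply exp_mono. apply Rmult_le_compat_l; [exact bg | apply sc]. }
      apply Rmult_le_compat; try apply Cmod_ge_0; assumption. }
    assert (fb : forall t, cdot (f (circ p r t)) (f (circ p r t)) <= (Af * exp (Bf * s)) * (Af * exp (Bf * s))).
    { intro t. rewrite cdot_diag.
      assert (Cmod (f (circ p r t)) <= Af * exp (Bf * s)).
      { apply Rle_trans with (1 := Hf _). apply Rmult_le_compat_l; [exact af |].
        apply exp_mono. apply Rmult_le_compat_l; [exact bf | apply sc]. }
      apply Rmult_le_compat; try apply Cmod_ge_0; assumption. }
    assert (lY : forall t, ln (Y t) <= L).
    { intro t. apply Rle_trans with (ln ((Ag * exp (Bg * s)) * (Ag * exp (Bg * s)) + 1)).
      - apply ln_le; [apply Y0 |]. unfold Y. specialize (gb t). nra.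
      - apply Rle_trans with (1 := ln_sqr_bound Ag s Bg ag bg s0). unfold L, A, B. nra. }
    assert (lX : forall t, 0 <= t <= 2 * PI -> 2 * u t + ln (Y t) <= L).
    { intros t Ht. unfold u.
      replace (2 * (/ 2 * ln (cdot (hc t) (hc t))) + ln (Y t)) with (ln (cdot (hc t) (hc t)) + ln (Y t)) by field.
      rewrite <- ln_mult by (apply hp || apply Y0).
      apply Rle_trans with (ln ((Af * exp (Bf * s)) * (Af * exp (Bf * s)) + 1)).
      - apply ln_le; [apply Rmult_lt_0_compat; [apply hp | apply Y0] |].
        unfold Y. rewrite Rmult_plus_distr_l, <- cdot_mult. unfold hc, gc. rewrite <- E.
        specialize (fb t). specialize (Htm t Ht). fold (hc t).
        assert (cdot (hc t) (hc t) * e <= Hm * e) by (apply Rmult_le_compat_r; lra). nra.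
      - apply Rle_trans with (1 := ln_sqr_bound Af s Bf af bf s0). unfold L, A, B. nra. }
    assert (cu : forall t, continuous u t).
    { intro t. apply continuous_Rmult; [apply continuous_const |].
      pose proof (cont2_continuous_ln _ 0 r t ch2) as K.
      eapply continuous_ext; [| apply K; rewrite Rplus_0_r; apply hp].
      intro y. cbv beta. now rewrite Rplus_0_r. }
    assert (cY : forall t, continuous (fun t => ln (Y t)) t).
    { intro t. apply (cont2_continuous_ln _ e r t cg2). apply Y0. }
    (* [u] is half the difference of [ln (|h|^2 Y)] and [ln Y], both at most [L], so upper bounds
       alone give [|u| <= 2 L - u - ln Y]. The integral of the right side is under control: that of
       [u] is exact by harmonicity, that of [ln Y] is bounded below by Jensen's inequality. *)
    set (w := fun t => (2 * L + (- 1) * u t) + (- 1) * ln (Y t)).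
    assert (cw : forall t, continuous w t).
    { intro t. apply continuous_Rplus; [apply continuous_Rplus |]; try apply continuous_const;
        apply continuous_Rmult; auto; apply continuous_const. }
    assert (uw : forall t, 0 <= t <= 2 * PI -> Rabs (u t) <= w t).
    { intros t Ht. pose proof (Rabs_half_ln_diff _ _ L L0 (lX t Ht) (lY t)) as K.
      replace ((2 * u t + ln (Y t)) / 2 - ln (Y t) / 2) with (u t) in K by field.
      unfold w. lra. }
    assert (Iw : RInt w 0 (2 * PI) <= 2 * PI * (2 * L + c0)).
    { unfold w. rewrite RInt_plus_cont, RInt_plus_cont, RInt_const_R, !RInt_scal_cont.
      - unfold u. rewrite RInt_scal_cont.
        + unfold hc. rewrite (log_mean_eq h h1 p r D H1 N) by lra.
          pose proof (log_mean_ge g p r e g2 e0 ltac:(lra)) as J.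
          change (2 * PI * ln (cdot (g p) (g p) + e) <= RInt (fun t => ln (Y t)) 0 (2 * PI)) in J.
          assert (K : ln (cdot (g p) (g p)) <= ln (cdot (g p) (g p) + e)).
          { apply ln_le; [now apply cdot_gt_0 | lra]. }
          unfold c0. set (l1 := ln (cdot (h p) (h p))) in *. set (l2 := ln (cdot (g p) (g p))) in *.
          assert (2 * PI * l2 <= 2 * PI * ln (cdot (g p) (g p) + e)) by (apply Rmult_le_compat_l; lra).
          lra.
        + intro t. pose proof (cont2_continuous_ln _ 0 r t ch2) as K.
          eapply continuous_ext; [| apply K; rewrite Rplus_0_r; apply hp].
          intro y. cbv beta. now rewrite Rplus_0_r.
      - exact cY.
      - exact cu.
      - intro; apply continuous_const.
      - intro t. apply continuous_Rmult; [apply continuous_const | apply cu].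
      - intro t. apply continuous_Rplus; [apply continuous_const |].
        apply continuous_Rmult; [apply continuous_const | apply cu].
      - intro t. apply continuous_Rmult; [apply continuous_const | apply cY]. }
    destruct (primitive_fourier u k p r Hr Hk) as [F1 F2].
    { unfold u, hc. now rewrite circ_2PI. }
    { intro t. unfold u. eapply is_derive_eq.
      - apply (is_derive_scal (fun t => ln (cdot (hc t) (hc t)))).
        apply (is_derive_ln_comp (fun t => cdot (hc t) (hc t))); [apply hp |].
        apply is_derive_cdot; exact (cderiv_comp h (circ p r) t _ _ (D _) (cderiv_circ_t p r t)).
      - rewrite (cdot_sym (hc t)).
        replace (Ci * (RtoC r * cis t) * k (circ p r t))%C
          with ((h1 (circ p r t) * (Ci * (RtoC r * cis t))) / hc t)%C
          by (unfold k, hc; field; apply N).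
        rewrite <- cdot_div by apply N. unfold hc. specialize (hp t). unfold hc in hp.
        req. field. lra. }
    rewrite <- F1, <- F2. split.
    - apply Rle_trans with (2 := Iw).
      apply RInt_cos_bound; auto; [exact continuous_cos | exact Rabs_cos_le].
    - apply Rle_trans with (2 := Iw).
      apply RInt_cos_bound; auto; [exact continuous_sin | exact Rabs_sin_le]. }
  assert (A0 : 0 <= A) by (unfold A; lra). assert (B0 : 0 <= B) by (unfold B; lra).
  pose proof (Cmod_ge_0 p). pose proof (Rabs_pos c0). pose proof (Rle_abs c0). pose proof PI_RGT_0.
  assert (Z : forall x, (forall r, 0 < r -> Rabs (PI * r * x) <=
      2 * PI * (2 * (2 * A + 2 * B * sqrt (1 + Cmod p + r)) + c0)) -> x = 0).
  { intros x Hx.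
    assert (K : Rabs x <= 0).
    { apply le_0_of_sublinear with (8 * A + 2 * Rabs c0) (8 * B) (1 + Cmod p); try lra.
      intros r Hr. specialize (Hx r Hr).
      rewrite Rabs_mult, (Rabs_pos_eq (PI * r)) in Hx by nra.
      apply Rmult_le_reg_l with PI; [assumption |].
      replace (PI * (r * Rabs x)) with (PI * r * Rabs x) by ring.
      apply Rle_trans with (1 := Hx).
      replace (2 * PI * (2 * (2 * A + 2 * B * sqrt (1 + Cmod p + r)) + c0))
        with (PI * (8 * A + 2 * c0 + 8 * B * sqrt (1 + Cmod p + r))) by ring.
      apply Rmult_le_compat_l; lra. }
    pose proof (Rabs_pos x). destruct (Req_dec x 0) as [e|n]; [exact e |].
    pose proof (Rabs_pos_lt x n). lra. }
  assert (k0 : k p = RtoC 0).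
  { apply Re_Im_eq; simpl.
    - apply Z. intros r Hr. now apply main.
    - apply Z. intros r Hr. rewrite <- Rabs_Ropp. now apply main. }
  replace (h1 p) with (k p * h p)%C by (unfold k; field; apply N). rewrite k0. ring.
Qed.

Lemma const_of_Cder_0 (F : C -> C) : (forall z, Cder F z (RtoC 0)) -> forall z, F z = F (RtoC 0).
Proof.
  intros D z.
  assert (E : forall t, cderiv (fun t => F (RtoC 0 + RtoC t * (z - RtoC 0))%C) t (RtoC 0)).
  { intro t. eapply cderiv_eq; [exact (cderiv_comp F _ t _ _ (D _) (cderiv_segment (RtoC 0) z t)) |]. ring. }
  pose proof (const_of_cderiv_0 (fun t => F (RtoC 0 + RtoC t * (z - RtoC 0))%C) 0 1 (fun t _ => E t)
    (ccont_cderiv _ _ E) 1 ltac:(lra)) as K. cbv beta in K.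
  replace (RtoC 0 + RtoC 1 * (z - RtoC 0))%C with z in K by ring.
  replace (RtoC 0 + RtoC 0 * (z - RtoC 0))%C with (RtoC 0) in K by ring. exact K.
Qed.

(** The derivative [h1] vanishes wherever [g] does not. If it were nonzero at some point it would be
    nonzero on a disc, and [g] would vanish on that disc. *)
Lemma quotient_const (f g h : C -> C) :
  order_half f -> order_half g -> (forall z, hol 2 g z) -> (forall z, hol 2 h z) ->
  (forall z, h z <> RtoC 0) -> (forall z, f z = (h z * g z)%C) ->
  (forall z, ~ Cnear z (fun w => g w = RtoC 0)) ->
  exists c, c <> RtoC 0 /\ forall z, f z = (c * g z)%C.
Proof.
  intros Of Og g2 h2 N E iso. destruct (hol_S_global 1 h h2) as [h1 [D H1]].
  assert (Z : forall z, h1 z = RtoC 0).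
  { intro z. destruct (Ceq_dec (h1 z) (RtoC 0)) as [e|n]; [exact e | exfalso].
    assert (Hc : Ccontin h1 z) by (eapply hol_contin; apply H1).
    apply (iso z). generalize (Cnear_neq0 h1 z Hc n). apply Cnear_imp. intros w Hw.
    destruct (Ceq_dec (g w) (RtoC 0)) as [e|n']; [exact e | exfalso]. apply Hw.
    exact (quotient_log_derivative_0 f g h h1 w Of Og g2 D H1 N E n'). }
  exists (h (RtoC 0)). split; [apply N |]. intro z. rewrite E. f_equal.
  apply const_of_Cder_0. intro w. rewrite <- (Z w). apply D.
Qed.

(** The first Fourier coefficients of [Re F] on a circle of radius [r] about [p] are, up to sign,
    [PI * r] times the components of [F1 p], yet they are bounded by [2 * PI * K] for every [r]. *)
Lemma liouville (F : C -> C) (K : R) : (forall z, hol 2 F z) -> (forall z, Cmod (F z) <= K) ->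
  forall z, F z = F (RtoC 0).
Proof.
  intros HF B. destruct (hol_S_global 1 F HF) as [F1 [D H1]].
  assert (K0 : 0 <= K) by (apply Rle_trans with (2 := B (RtoC 0)); apply Cmod_ge_0).
  apply const_of_Cder_0. intro p. replace (RtoC 0) with (F1 p); [apply D |].
  pose proof PI_RGT_0.
  assert (main : forall r, 0 < r -> Rabs (PI * r * Re (F1 p)) <= 2 * PI * K /\
                                    Rabs (- (PI * r * Im (F1 p))) <= 2 * PI * K).
  { intros r Hr. set (u := fun t => Re (F (circ p r t))).
    assert (Du : forall t, is_derive u t (Re (Ci * (RtoC r * cis t) * F1 (circ p r t))%C)).
    { intro t. pose proof (cderiv_comp F (circ p r) t _ _ (D _) (cderiv_circ_t p r t)) as [d _].
      eapply is_derive_eq; [exact d |]. f_equal. ring. }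
    assert (cu : forall t, continuous u t) by (intro t; eapply is_derive_continuous; apply Du).
    destruct (primitive_fourier u F1 p r Hr H1) as [E1 E2]; [unfold u; now rewrite circ_2PI | exact Du |].
    rewrite <- E1, <- E2.
    replace (2 * PI * K) with (RInt (fun _ => K) 0 (2 * PI)) by (rewrite RInt_const_R; req; ring).
    assert (Bu : forall t, 0 <= t <= 2 * PI -> Rabs (u t) <= K).
    { intros t _. apply Rle_trans with (2 := B (circ p r t)). apply re_le_Cmod. }
    split; apply (RInt_cos_bound u (fun _ => K)); auto using continuous_cos, continuous_sin, Rabs_cos_le, Rabs_sin_le;
      intro; apply continuous_const. }
  assert (Z : forall x, (forall r, 0 < r -> Rabs (PI * r * x) <= 2 * PI * K) -> x = 0).
  { intros x Hx.
    assert (L : Rabs x <= 0).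
    { apply le_0_of_sublinear with (2 * K) 0 0; try lra.
      intros r Hr. specialize (Hx r Hr). rewrite Rabs_mult, (Rabs_pos_eq (PI * r)) in Hx by nra.
      apply Rmult_le_reg_l with PI; [assumption | lra]. }
    pose proof (Rabs_pos x). destruct (Req_dec x 0) as [e|n]; [exact e |].
    pose proof (Rabs_pos_lt x n). lra. }
  apply Re_Im_eq; simpl.
  - apply Z. intros r Hr. now apply main.
  - apply Z. intros r Hr. rewrite <- Rabs_Ropp. now apply main.
Qed.

(** * Entire functions with the same zeros *)

Lemma circle_mean_bound (G : C -> C) (p : C) (r K : R) : (forall z, hol 1 G z) -> 0 <= r ->
  (forall z, Cmod (z - p) = r -> Cmod (G z) <= K) -> Cmod (G p) <= 2 * K.
Proof.
  intros HG Hr B. pose proof (mean_value G p r HG Hr) as M. pose proof PI_pos_2.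
  assert (cG : ccont (fun t => G (circ p r t))).
  { apply (ccont2_ccont (fun r t => G (circ p r t))).
    apply ccont2_comp; [intro; eapply hol_contin; apply HG | apply ccont2_circ]. }
  pose proof (CInt_bound (fun t => G (circ p r t)) K 0 (2 * PI) ltac:(lra) cG) as E.
  specialize (E (fun t _ => B _ (circ_dist p r t Hr))).
  rewrite M, Cmod_mult, Cmod_R, Rabs_pos_eq in E by lra.
  apply Rmult_le_reg_l with (2 * PI); lra.
Qed.

Lemma Cpow_neq_0 (z : C) (n : nat) : z <> RtoC 0 -> (z ^ n)%C <> RtoC 0.
Proof.
  intro N. apply Cmod_gt_0. rewrite Cmod_pow. apply pow_lt. now apply Cmod_gt_0.
Qed.

Lemma Cpow_0_neq (n : nat) : n <> 0%nat -> (RtoC 0 ^ n)%C = RtoC 0.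
Proof. destruct n as [|n]; [easy |]. intros _. simpl. ring. Qed.

(** Differs from [zero_of_mult] in admitting order 0 and in taking the cofactor from the class that
    is stable under division by [w - z]. *)
Definition order_at (f : C -> C) (z : C) (m : nat) (g : C -> C) : Prop :=
  ereg g /\ g z <> RtoC 0 /\ forall w, f w = ((w - z) ^ m * g w)%C.

(** A quantitative identity theorem. If zeros at [z] could be divided out forever, then
    [f = (w - z)^n g_n] for all [n]. On the circle of radius [3 D] about [p], with [D = |p - z|],
    one has [|w - z| >= 2 D], so the mean value property bounds [|g_n(p)|] by [2 M / (2 D)^n], and
    [|f(p)| <= 2 M / 2^n] tends to 0. *)
Lemma order_exists (f : C -> C) (p z : C) : ereg f -> f p <> RtoC 0 -> exists m g, order_at f z m g.
Proof.
  intros Hf Np. apply NNPP. intro No.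
  assert (all : forall n, exists g, ereg g /\ forall w, f w = ((w - z) ^ n * g w)%C).
  { induction n as [|n [g [Hg E]]].
    - exists f. split; [exact Hf |]. intro w. simpl. ring.
    - destruct (Ceq_dec (g z) (RtoC 0)) as [e|n0].
      + destruct (ereg_divide g z Hg e) as [G [HG EG]]. exists G. split; [exact HG |].
        intro w. rewrite E, EG. simpl. ring.
      + exfalso. apply No. exists n, g. split; [exact Hg |]. now split. }
  destruct (Ceq_dec p z) as [e|pz].
  { destruct (all 1%nat) as [g [_ E]]. apply Np. rewrite E, e. simpl. ring. }
  assert (D0 : 0 < Cmod (p - z)).
  { apply Cmod_gt_0. intro e. apply pz. now apply Ceq_minus. }
  set (D := Cmod (p - z)) in *.
  destruct (ereg_bounded f Hf (Cmod p + 3 * D)) as [M [M0 HM]].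
  assert (K : forall n : nat, Cmod (f p) <= 2 * M * (1 / 2) ^ n).
  { intro n. destruct (all n) as [g [Hg E]].
    assert (B : Cmod (g p) <= 2 * (M / (2 * D) ^ n)).
    { apply (circle_mean_bound g p (3 * D)); [intro; now apply ereg_hol | lra |].
      intros w Hw.
      assert (Dw : 2 * D <= Cmod (w - z)).
      { pose proof (Cmod_triangle_rev (w - p) (z - p)) as T.
        replace (w - p - (z - p))%C with (w - z)%C in T by ring.
        rewrite (Cmod_minus_sym z p) in T. fold D in T. lra. }
      assert (P : 0 < (2 * D) ^ n) by (apply pow_lt; lra).
      apply Rle_div_r; [exact P |].
      apply Rle_trans with (Cmod (g w) * Cmod (w - z) ^ n).
      - apply Rmult_le_compat_l; [apply Cmod_ge_0 |]. apply pow_incr. lra.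
      - rewrite <- Cmod_pow, Rmult_comm, <- Cmod_mult, <- E. apply HM.
        replace w with ((w - p) + p)%C by ring. apply Rle_trans with (1 := Cmod_triangle _ _). lra. }
    rewrite E, Cmod_mult, Cmod_pow. fold D.
    assert (P : 0 < D ^ n) by (apply pow_lt; lra).
    apply Rle_trans with (D ^ n * (2 * (M / (2 * D) ^ n))); [apply Rmult_le_compat_l; lra |].
    right. rewrite Rpow_mult_distr. unfold Rdiv. rewrite Rmult_1_l, pow_inv. field.
    split; [apply pow_nonzero; lra | apply Rgt_not_eq; exact P]. }
  pose proof (le_0_of_half_pow _ _ K). apply Cmod_gt_0 in Np. lra.
Qed.

Lemma Ccontin_eq_at (f g : C -> C) (z : C) : Ccontin f z -> Ccontin g z ->
  (forall w, w <> z -> f w = g w) -> f z = g z.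
Proof.
  intros F G E. apply Ceq_minus, Cmod_le_0_eq, Rle_0_of_all_eps. intros eps He.
  destruct (Cnear_and _ _ _ (F (eps / 2) ltac:(lra)) (G (eps / 2) ltac:(lra))) as [d [dp Hd]].
  destruct (Hd (z + RtoC (d / 2))%C) as [h1 h2].
  { replace (z + RtoC (d / 2) - z)%C with (RtoC (d / 2)) by ring. rewrite Cmod_R, Rabs_pos_eq; lra. }
  rewrite E in h1.
  2:{ intro e. assert (e' : RtoC (d / 2) = RtoC 0).
      { replace (RtoC (d / 2)) with (z + RtoC (d / 2) - z)%C by ring. rewrite e. ring. }
      apply (f_equal fst) in e'. simpl in e'. lra. }
  replace (f z - g z)%C with ((g (z + RtoC (d / 2))%C - g z) - (g (z + RtoC (d / 2))%C - f z))%C by ring.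
  apply Rle_trans with (1 := Cmod_triangle_minus _ _). lra.
Qed.

Lemma hol_sub_pow (n m : nat) (z0 z : C) : hol n (fun w => (w - z0) ^ m)%C z.
Proof.
  induction m as [|m IH]; simpl.
  - apply hol_const.
  - apply (hol_mult n z (fun w => w - z0)%C); [| exact IH].
    apply (hol_plus n z (fun w => w) (fun _ => - z0)%C); [apply hol_id | apply hol_const].
Qed.

Lemma order_le (f : C -> C) (z : C) (m m' : nat) (g g' : C -> C) :
  Ccontin g z -> Ccontin g' z -> g z <> RtoC 0 ->
  (forall w, f w = ((w - z) ^ m * g w)%C) -> (forall w, f w = ((w - z) ^ m' * g' w)%C) -> (m' <= m)%nat.
Proof.
  intros cg cg' N E E'. destruct (Nat.le_gt_cases m' m) as [h|h]; [exact h | exfalso].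
  apply N.
  rewrite (Ccontin_eq_at g (fun w => (w - z) ^ (m' - m) * g' w)%C z).
  - replace (z - z)%C with (RtoC 0) by ring. rewrite Cpow_0_neq by lia. ring.
  - exact cg.
  - apply Ccontin_mult; [exact (hol_contin 0 _ _ (hol_sub_pow 0 (m' - m) z z)) | exact cg'].
  - intros w Hw.
    assert (Nw : (w - z)%C <> RtoC 0) by (intro e; apply Hw; now apply Ceq_minus).
    pose proof (Cpow_neq_0 _ m Nw) as Np.
    assert (X : ((w - z) ^ m * (g w - (w - z) ^ (m' - m) * g' w) = RtoC 0)%C).
    { replace ((w - z) ^ m * (g w - (w - z) ^ (m' - m) * g' w))%C
        with (((w - z) ^ m * g w) - ((w - z) ^ m * (w - z) ^ (m' - m)) * g' w)%C by ring.
      rewrite <- Cpow_add_r. replace (m + (m' - m))%nat with m' by lia. rewrite <- E, <- E'. ring. }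
    apply Ceq_minus. destruct (Ceq_dec (g w - (w - z) ^ (m' - m) * g' w)%C (RtoC 0)) as [e|n]; [exact e | exfalso].
    revert X. now apply Cmult_neq_0.
Qed.

(** The cofactor obtained from [same_zeros] is entire in the sense of the statement, the other one
    lies in [ereg]; [order_le] compares them through their continuity. *)
Lemma order_at_same (f g : C -> C) (z : C) (m n : nat) (F G : C -> C) : same_zeros f g ->
  order_at f z m F -> order_at g z n G -> (m <= n)%nat.
Proof.
  intros S (HF & NF & EF) (HG & NG & EG).
  destruct m as [|m]; [lia |].
  destruct (proj1 (S z (Datatypes.S m))) as [_ [G' [eG' [NG' EG']]]].
  { split; [lia |]. exists F. split; [now apply ereg_entire | now split]. }
  apply (order_le g z n (Datatypes.S m) G G'); try assumption.
  - apply entire_contin. now apply ereg_entire.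
  - now apply entire_contin.
Qed.

Lemma same_zeros_sym (f g : C -> C) : same_zeros f g -> same_zeros g f.
Proof. intros S z m. now rewrite (S z m). Qed.

Lemma same_zeros_proportional (f g : C -> C) (p p' : C) : ereg f -> ereg g -> order_half f -> order_half g ->
  f p <> RtoC 0 -> g p' <> RtoC 0 -> same_zeros f g -> exists c, c <> RtoC 0 /\ forall z, f z = (c * g z)%C.
Proof.
  intros Hf Hg Of Og Nf Ng S.
  destruct (choice (fun z (mFG : nat * ((C -> C) * (C -> C))) =>
    order_at f z (fst mFG) (fst (snd mFG)) /\ order_at g z (fst mFG) (snd (snd mFG)))) as [Q HQ].
  { intro z. destruct (order_exists f p z Hf Nf) as [m [F HF]].
    destruct (order_exists g p' z Hg Ng) as [n [G HG]].
    pose proof (order_at_same f g z m n F G S HF HG).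
    pose proof (order_at_same g f z n m G F (same_zeros_sym _ _ S) HG HF).
    assert (e : m = n) by lia. subst n. exists (m, (F, G)). now split. }
  set (F := fun z => fst (snd (Q z))) in *. set (G := fun z => snd (snd (Q z))) in *.
  set (m := fun z => fst (Q z)) in *.
  (* At each point the cofactors chosen for that very point are divided. Off the zeros this is
     [f / g]; near a fixed [z] it coincides with the quotient of the fixed cofactors [F z] and
     [G z], which gives holomorphy across the zeros. *)
  set (h := fun z => (F z z * / G z z)%C).
  assert (h_off : forall z, g z <> RtoC 0 -> h z = (f z * / g z)%C).
  { intros z N. destruct (HQ z) as [(_ & NF & EF) (_ & NG & EG)]. fold (F z) in *. fold (G z) in *. fold (m z) in *.
    pose proof (EG z) as EGz. pose proof (EF z) as EFz.
    replace (z - z)%C with (RtoC 0) in EGz, EFz by ring.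
    destruct (m z) as [|k].
    - unfold h. rewrite EGz, EFz. simpl. f_equal; [ring | f_equal; ring].
    - exfalso. apply N. rewrite EGz, Cpow_0_neq by lia. ring. }
  apply (quotient_const f g h Of Og).
  - intro z. now apply ereg_hol.
  - intro z. destruct (HQ z) as [(HF & NF & EF) (HG & NG & EG)]. fold (F z) in *. fold (G z) in *. fold (m z) in *.
    apply hol_ext_near with (fun w => F z w * / G z w)%C.
    + pose proof (ereg_hol 0 _ z HG) as cG.
      generalize (Cnear_neq0 (G z) z cG NG). apply Cnear_imp. intros w Nw.
      destruct (Ceq_dec w z) as [e|n]; [now rewrite e |].
      assert (Nz : (w - z)%C <> RtoC 0) by (intro e; apply n; now apply Ceq_minus).
      pose proof (Cpow_neq_0 _ (m z) Nz) as Np.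
      rewrite h_off by (rewrite EG; now apply Cmult_neq_0).
      rewrite EF, EG. field. now split.
    + apply hol_mult; [now apply ereg_hol | apply hol_inv; [now apply ereg_hol | exact NG]].
  - intro z. destruct (HQ z) as [(_ & NF & _) (_ & NG & _)]. unfold h. apply Cmult_neq_0; [exact NF |].
    apply Cmod_gt_0. rewrite Cmod_inv by exact NG. apply Rinv_0_lt_compat. now apply Cmod_gt_0.
  - intro z. destruct (HQ z) as [(_ & NF & EF) (_ & NG & EG)]. fold (F z) in *. fold (G z) in *. fold (m z) in *.
    unfold h. rewrite (EF z), (EG z). field. exact NG.
  - intros z [d [dp Hd]]. destruct (HQ z) as [_ (HG & NG & EG)]. fold (G z) in *. fold (m z) in *.
    pose proof (ereg_hol 0 _ z HG) as cG. destruct (Cnear_neq0 (G z) z cG NG) as [e [ep He]].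
    set (r := Rmin d e / 2). pose proof (Rmin_l d e). pose proof (Rmin_r d e).
    assert (0 < Rmin d e) by now apply Rmin_glb_lt.
    assert (Er : Cmod (z + RtoC r - z) = r).
    { replace (z + RtoC r - z)%C with (RtoC r) by ring. rewrite Cmod_R. apply Rabs_pos_eq. unfold r; lra. }
    specialize (Hd (z + RtoC r)%C). specialize (He (z + RtoC r)%C). rewrite Er in Hd, He.
    unfold r in Hd at 1. unfold r in He at 1.
    specialize (Hd ltac:(lra)). specialize (He ltac:(lra)).
    rewrite EG in Hd. revert Hd. apply Cmult_neq_0; [| exact He].
    apply Cpow_neq_0. apply Cmod_gt_0. rewrite Er. unfold r; lra.
Qed.

(** * A Phragmen-Lindelof principle *)

Lemma rectangle_max (f : R -> R -> R) (a b c d : R) : a <= b -> c <= d -> cont2 f ->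
  exists x0 y0, a <= x0 <= b /\ c <= y0 <= d /\
    forall x y, a <= x <= b -> c <= y <= d -> f x y <= f x0 y0.
Proof.
  intros ab cd Hf.
  (* The maximum over [y] is taken first; the resulting function of [x] is continuous by uniform
     continuity of [f]. *)
  destruct (choice (fun x y0 => c <= y0 <= d /\ forall y, c <= y <= d -> f x y <= f x y0)) as [Y HY].
  { intro x. destruct (continuity_ab_maj (f x) c d cd) as [y0 [h1 h2]].
    - intros y _. apply continuity_pt_filterlim. now apply cont2_continuous.
    - exists y0. now split. }
  destruct (continuity_ab_maj (fun x => f x (Y x)) a b ab) as [x0 [h1 h2]].
  - intros x Hx eps He.
    (* The rectangle is widened by 1 because continuity at [x] also looks at points outside
       [[a, b]]. *)
    destruct (uniform_continuity_2d f (a - 1) (b + 1) c d (fun x y _ _ => Hf x y) (mkposreal eps He)) as [de Hd].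
    exists (Rmin de 1). split; [apply Rmin_glb_lt; [apply cond_pos | lra] |].
    intros t [_ Ht]. simpl in *. unfold Rdist in *.
    assert (t1 : Rabs (t - x) < de) by (apply Rlt_le_trans with (1 := Ht); apply Rmin_l).
    assert (t2 : Rabs (t - x) < 1) by (apply Rlt_le_trans with (1 := Ht); apply Rmin_r).
    apply Rabs_def2 in t2.
    destruct (HY t) as [yt mt]. destruct (HY x) as [yx mx].
    assert (z : forall y, Rabs (y - y) < de) by (intro y; rewrite Rminus_diag, Rabs_R0; apply cond_pos).
    assert (K1 : Rabs (f t (Y t) - f x (Y t)) < eps) by (apply (Hd x (Y t) t (Y t)); auto; lra).
    assert (K2 : Rabs (f t (Y x) - f x (Y x)) < eps) by (apply (Hd x (Y x) t (Y x)); auto; lra).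
    apply Rabs_def2 in K1. apply Rabs_def2 in K2.
    specialize (mt (Y x) yx). specialize (mx (Y t) yt). apply Rabs_def1; lra.
  - exists x0, (Y x0). split; [exact h2 |]. split; [apply HY |].
    intros x y Hx Hy. apply Rle_trans with (f x (Y x)); [now apply HY | now apply h1].
Qed.

Lemma RInt_cos_sqr : RInt (fun t => cos t * cos t) 0 (2 * PI) = PI.
Proof.
  rewrite (RInt_of_derive (fun t => / 2 * (t + sin t * cos t)) (fun t => cos t * cos t)).
  - rewrite sin_2PI, sin_0. req. field.
  - intro t. eapply is_derive_eq.
    + apply (is_derive_scal (fun t => t + sin t * cos t)).
      apply (is_derive_plus (K := R_AbsRing) (V := R_NormedModule) (fun t => t) (fun t => sin t * cos t)).
      * apply (is_derive_id (K := R_AbsRing)).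
      * apply is_derive_Rmult; [apply is_derive_sin | apply is_derive_cos].
    + unfold plus, one; simpl. pose proof (cis_norm t). nra.
  - intro t. apply continuous_Rmult; apply continuous_cos.
Qed.

Lemma RInt_cos_period : RInt cos 0 (2 * PI) = 0.
Proof.
  rewrite (RInt_of_derive sin cos).
  - rewrite sin_2PI, sin_0. req. ring.
  - intro t. apply is_derive_sin.
  - exact continuous_cos.
Qed.

(** Pointwise [|G|^2 >= 2 (G(p), G) - |G(p)|^2], and the mean of the right side is known from the
    mean value property. *)
Lemma cdot_mean_ge (G : C -> C) (p : C) (r : R) : (forall z, hol 1 G z) -> 0 <= r ->
  2 * PI * cdot (G p) (G p) <= RInt (fun t => cdot (G (circ p r t)) (G (circ p r t))) 0 (2 * PI).
Proof.
  intros HG Hr. pose proof PI_pos_2.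
  assert (cG2 : ccont2 (fun r t => G (circ p r t))).
  { apply ccont2_comp; [intro; eapply hol_contin; apply HG | apply ccont2_circ]. }
  pose proof (ccont2_ccont _ r cG2) as cG. cbv beta in cG.
  pose proof (mean_value G p r HG Hr) as M.
  pose proof (f_equal Re M) as Mr. pose proof (f_equal Im M) as Mi.
  rewrite re_scal_l in Mr.
  replace (Im (RtoC (2 * PI) * G p)) with (2 * PI * Im (G p)) in Mi by (rewrite im_mult; simpl; ring).
  change (RInt (fun t => Re (G (circ p r t))) 0 (2 * PI) = 2 * PI * Re (G p)) in Mr.
  change (RInt (fun t => Im (G (circ p r t))) 0 (2 * PI) = 2 * PI * Im (G p)) in Mi.
  set (a := Re (G p)) in *. set (b := Im (G p)) in *.
  set (u := fun t => Re (G (circ p r t))) in *. set (v := fun t => Im (G (circ p r t))) in *.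
  assert (cu : forall t, continuous u t) by (intro t; exact (proj1 (cG t))).
  assert (cv : forall t, continuous v t) by (intro t; exact (proj2 (cG t))).
  apply Rle_trans with (RInt (fun t => (2 * a * u t + 2 * b * v t) + - (a * a + b * b)) 0 (2 * PI)).
  - assert (c1 : forall t, continuous (fun t => 2 * a * u t) t)
      by (intro t; apply continuous_Rmult; [apply continuous_const | apply cu]).
    assert (c2 : forall t, continuous (fun t => 2 * b * v t) t)
      by (intro t; apply continuous_Rmult; [apply continuous_const | apply cv]).
    rewrite RInt_plus_cont; [| intro t; now apply continuous_Rplus | intro; apply continuous_const].
    rewrite RInt_plus_cont by assumption. rewrite RInt_const_R, !RInt_scal_cont by assumption.
    rewrite Mr, Mi. unfold cdot. fold a b. right; ring.
  - apply RInt_le_cont; [lra | | |].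
    + intro t. apply continuous_Rplus; [apply continuous_Rplus |]; try apply continuous_const;
        apply continuous_Rmult; auto; apply continuous_const.
    + intro t. exact (cont2_continuous _ r t (cont2_cdot _ _ cG2 cG2)).
    + intros t _. unfold cdot. fold (u t) (v t).
      pose proof (Rle_0_sqr (u t - a)). pose proof (Rle_0_sqr (v t - b)). unfold Rsqr in *. lra.
Qed.

(** Adding [e * x^2] makes [|G|^2] strictly subharmonic, so that the mean over a small circle
    excludes an interior maximum. The perturbation is at most half the supposed excess over [K * K],
    hence the maximum cannot lie on the boundary either. *)
Lemma max_principle_rectangle (G : C -> C) (K L h : R) : (forall z, hol 1 G z) -> 0 <= K -> 0 < L -> 0 < h ->
  (forall x y, 0 <= x <= L -> 0 <= y <= h -> x = 0 \/ x = L \/ y = 0 \/ y = h -> Cmod (G (x, y)) <= K) ->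
  forall x y, 0 <= x <= L -> 0 <= y <= h -> Cmod (G (x, y)) <= K.
Proof.
  intros HG K0 L0 h0 B x y Hx Hy.
  destruct (Rle_dec (Cmod (G (x, y))) K) as [ok|bad]; [exact ok | exfalso].
  apply Rnot_le_lt in bad.
  set (N := fun x y => cdot (G (x, y)) (G (x, y))).
  set (e := (N x y - K * K) / (2 * (L * L))).
  assert (gap : 0 < N x y - K * K) by (unfold N; rewrite cdot_diag; nra).
  assert (LL : 0 < L * L) by nra.
  assert (e0 : 0 < e) by (apply Rdiv_lt_0_compat; lra).
  assert (eL : e * (L * L) = (N x y - K * K) / 2) by (unfold e; field; lra).
  set (phi := fun x y => N x y + e * (x * x)).
  assert (cxy : ccont2 (fun x y => (x, y))).
  { split; intros u v; [apply continuity_2d_pt_id1 | apply continuity_2d_pt_id2]. }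
  assert (cG : ccont2 (fun x y => G (x, y))) by (apply ccont2_comp; [intro; eapply hol_contin; apply HG | exact cxy]).
  assert (cphi : cont2 phi).
  { apply cont2_plus; [now apply cont2_cdot |]. apply cont2_scal.
    apply cont2_mult; intros u v; apply continuity_2d_pt_id1. }
  destruct (rectangle_max phi 0 L 0 h ltac:(lra) ltac:(lra) cphi) as [x0 [y0 [Hx0 [Hy0 Hm]]]].
  assert (big : K * K + e * (L * L) < phi x0 y0).
  { apply Rlt_le_trans with (phi x y); [| now apply Hm]. unfold phi.
    assert (0 <= e * (x * x)) by (apply Rmult_le_pos; nra). lra. }
  assert (inter : 0 < x0 < L /\ 0 < y0 < h).
  { assert (nb : ~ (x0 = 0 \/ x0 = L \/ y0 = 0 \/ y0 = h)).
    { intro bd. specialize (B x0 y0 Hx0 Hy0 bd).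
      assert (N x0 y0 <= K * K) by (unfold N; rewrite cdot_diag; pose proof (Cmod_ge_0 (G (x0, y0))); nra).
      assert (e * (x0 * x0) <= e * (L * L)) by (apply Rmult_le_compat_l; nra).
      unfold phi in big. lra. }
    repeat split; apply Rnot_le_lt; intro; apply nb; lra. }
  set (r := Rmin (Rmin x0 (L - x0)) (Rmin y0 (h - y0))).
  assert (r0 : 0 < r) by (repeat apply Rmin_glb_lt; lra).
  assert (r1 : r <= x0 /\ r <= L - x0 /\ r <= y0 /\ r <= h - y0).
  { unfold r. pose proof (Rmin_l (Rmin x0 (L - x0)) (Rmin y0 (h - y0))).
    pose proof (Rmin_r (Rmin x0 (L - x0)) (Rmin y0 (h - y0))).
    pose proof (Rmin_l x0 (L - x0)). pose proof (Rmin_r x0 (L - x0)).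
    pose proof (Rmin_l y0 (h - y0)). pose proof (Rmin_r y0 (h - y0)). lra. }
  set (p := (x0, y0) : C).
  assert (Ec : forall t, circ p r t = (x0 + r * cos t, y0 + r * sin t)).
  { intro t. unfold circ, p, cis. apply Re_Im_eq; simpl; ring. }
  pose proof (cdot_mean_ge G p r HG ltac:(lra)) as M1. pose proof PI_pos_2.
  assert (Up : RInt (fun t => cdot (G (circ p r t)) (G (circ p r t)) + e * ((x0 + r * cos t) * (x0 + r * cos t))) 0 (2 * PI)
     <= RInt (fun _ => phi x0 y0) 0 (2 * PI)).
  { assert (c2 : ccont2 (fun r t => G (circ p r t))).
    { apply ccont2_comp; [intro; eapply hol_contin; apply HG | apply ccont2_circ]. }
    assert (cl : forall t, continuous (fun t => x0 + r * cos t) t).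
    { intro t. apply continuous_Rplus; [apply continuous_const |].
      apply continuous_Rmult; [apply continuous_const | apply continuous_cos]. }
    apply RInt_le_cont; [lra | | intro; apply continuous_const |].
    - intro t. apply continuous_Rplus; [exact (cont2_continuous _ r t (cont2_cdot _ _ c2 c2)) |].
      apply continuous_Rmult; [apply continuous_const |]. now apply continuous_Rmult.
    - intros t _. rewrite Ec. pose proof (COS_bound t). pose proof (SIN_bound t).
      apply (Hm (x0 + r * cos t) (y0 + r * sin t)); nra. }
  rewrite RInt_const_R in Up.
  rewrite (RInt_ext _ (fun t => (cdot (G (circ p r t)) (G (circ p r t)) + e * (x0 * x0))
     + ((2 * e * x0 * r) * cos t + (e * r * r) * (cos t * cos t)))) in Up by (intros; req; ring).
  assert (c2 : ccont2 (fun r t => G (circ p r t))).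
  { apply ccont2_comp; [intro; eapply hol_contin; apply HG | apply ccont2_circ]. }
  assert (cg : forall t, continuous (fun t => cdot (G (circ p r t)) (G (circ p r t))) t)
    by (intro t; exact (cont2_continuous _ r t (cont2_cdot _ _ c2 c2))).
  assert (cc : forall t, continuous (fun t => cos t * cos t) t)
    by (intro t; apply continuous_Rmult; apply continuous_cos).
  rewrite RInt_plus_cont in Up.
  2:{ intro t. apply continuous_Rplus; [apply cg | apply continuous_const]. }
  2:{ intro t. apply continuous_Rplus; (apply continuous_Rmult; [apply continuous_const |]);
      [apply continuous_cos | apply cc]. }
  rewrite RInt_plus_cont in Up; [| exact cg | intro; apply continuous_const].
  rewrite (RInt_plus_cont (fun t => 2 * e * x0 * r * cos t)) in Up.
  2:{ intro t. apply continuous_Rmult; [apply continuous_const | apply continuous_cos]. }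
  2:{ intro t. apply continuous_Rmult; [apply continuous_const | apply cc]. }
  rewrite RInt_const_R, (RInt_scal_cont cos), (RInt_scal_cont (fun t => cos t * cos t)) in Up
    by first [exact continuous_cos | exact cc].
  rewrite RInt_cos_sqr, RInt_cos_period in Up.
  unfold phi, N in Up. fold p in Up. pose proof PI_RGT_0.
  assert (0 < e * r * r * PI).
  { apply Rmult_lt_0_compat; [apply Rmult_lt_0_compat; [apply Rmult_lt_0_compat |] |]; assumption. }
  lra.
Qed.

(** * The complex exponential and logarithmic coordinates *)

Definition cexp (w : C) : C := (RtoC (exp (Re w)) * cis (Im w))%C.

Lemma Cmod_cexp (w : C) : Cmod (cexp w) = exp (Re w).
Proof.
  unfold cexp. rewrite Cmod_mult, Cmod_cis, Cmod_R, Rabs_pos_eq; [ring | left; apply exp_pos].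
Qed.

Lemma cexp_plus (z w : C) : cexp (z + w) = (cexp z * cexp w)%C.
Proof.
  unfold cexp, cis. rewrite re_plus, im_plus, exp_plus, cos_plus, sin_plus.
  apply Re_Im_eq; simpl; ring.
Qed.

Lemma cexp_ray (w : C) (t : R) : cderiv (fun t => cexp (RtoC t * w)) t (w * cexp (RtoC t * w))%C.
Proof.
  assert (E : forall t, cexp (RtoC t * w) = (exp (Re w * t) * cos (Im w * t), exp (Re w * t) * sin (Im w * t))).
  { intro s. unfold cexp, cis. rewrite re_scal_l.
    replace (Im (RtoC s * w)) with (s * Im w) by (rewrite im_mult; simpl; ring).
    rewrite (Rmult_comm s (Re w)), (Rmult_comm s (Im w)). apply Re_Im_eq; simpl; ring. }
  apply cderiv_ext with (fun t => (exp (Re w * t) * cos (Im w * t), exp (Re w * t) * sin (Im w * t)) : C).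
  { intro s. now rewrite E. }
  rewrite E. split; simpl.
  - auto_derive; [exact I |]. destruct w as [a b]; unfold Re, Im; simpl. req. ring.
  - auto_derive; [exact I |]. destruct w as [a b]; unfold Re, Im; simpl. req. ring.
Qed.

Lemma cexp_taylor (h : C) : Cmod (cexp h - RtoC 1 - h) <= 4 * exp (Cmod h) * (Cmod h * Cmod h).
Proof.
  set (f := fun t => cexp (RtoC t * h)).
  assert (cf : ccont f) by exact (ccont_cderiv _ _ (cexp_ray h)).
  assert (chf : ccont (fun t => h * f t)%C) by (apply ccont_mult; [apply ccont_const | exact cf]).
  assert (f0 : f 0 = RtoC 1).
  { unfold f. replace (RtoC 0 * h)%C with (RtoC 0) by ring. unfold cexp, cis. simpl.
    rewrite exp_0, cos_0, sin_0. apply Re_Im_eq; simpl; ring. }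
  pose proof (Cmod_ge_0 h) as h0.
  assert (B : forall t, 0 <= t <= 1 -> Cmod (f t) <= exp (Cmod h)).
  { intros t Ht. unfold f. rewrite Cmod_cexp. apply exp_mono. rewrite re_scal_l.
    pose proof (re_le_Cmod h). pose proof (Rle_abs (Re h)). pose proof (Rabs_pos (Re h)). nra. }
  assert (f1 : forall t, 0 <= t <= 1 -> Cmod (f t - RtoC 1) <= 2 * (Cmod h * exp (Cmod h))).
  { intros t Ht. rewrite <- f0. rewrite <- (CInt_of_cderiv f (fun t => h * f t)%C 0 t (cexp_ray h) chf).
    apply Rle_trans with (2 * (Cmod h * exp (Cmod h)) * (t - 0)).
    - apply CInt_bound; [lra | exact chf |]. intros x Hx. rewrite Cmod_mult.
      apply Rmult_le_compat_l; [exact h0 | apply B; lra].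
    - assert (0 <= Cmod h * exp (Cmod h)) by (apply Rmult_le_pos; [exact h0 | left; apply exp_pos]). nra. }
  assert (E : (cexp h - RtoC 1 - h = CInt (fun t => h * f t - h) 0 1)%C).
  { rewrite (CInt_of_cderiv (fun t => f t - h * RtoC t)%C).
    - rewrite f0. unfold f. replace (RtoC 1 * h)%C with h by ring. ring.
    - intro t. eapply cderiv_eq; [apply cderiv_minus; [apply cexp_ray | apply cderiv_scal, cderiv_id] |].
      unfold f. ring.
    - apply ccont_minus; [exact chf | apply ccont_const]. }
  rewrite E.
  apply Rle_trans with (2 * (Cmod h * (2 * (Cmod h * exp (Cmod h)))) * (1 - 0)).
  - apply CInt_bound; [lra | apply ccont_minus; [exact chf | apply ccont_const] |].
    intros x Hx. replace (h * f x - h)%C with (h * (f x - RtoC 1))%C by ring. rewrite Cmod_mult.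
    apply Rmult_le_compat_l; [exact h0 | now apply f1].
  - right; ring.
Qed.

Lemma Cder_cexp (z : C) : Cder cexp z (cexp z).
Proof.
  intros eps He.
  set (M := 4 * exp 1 * exp (Re z)).
  assert (M0 : 0 < M) by (unfold M; pose proof (exp_pos 1); pose proof (exp_pos (Re z)); nra).
  exists (Rmin 1 (eps / M)). split; [apply Rmin_glb_lt; [lra |]; now apply Rdiv_lt_0_compat |].
  intros w Hw.
  assert (w1 : Cmod (w - z) < 1) by (apply Rlt_le_trans with (1 := Hw); apply Rmin_l).
  assert (w2 : Cmod (w - z) < eps / M) by (apply Rlt_le_trans with (1 := Hw); apply Rmin_r).
  apply Rlt_div_r in w2; [| exact M0].
  replace (cexp w) with (cexp z * cexp (w - z))%C by (rewrite <- cexp_plus; f_equal; ring).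
  replace (cexp z * cexp (w - z) - cexp z - cexp z * (w - z))%C
    with (cexp z * (cexp (w - z) - RtoC 1 - (w - z)))%C by ring.
  rewrite Cmod_mult, Cmod_cexp.
  set (x := Cmod (w - z)) in *. assert (x0 : 0 <= x) by apply Cmod_ge_0.
  apply Rle_trans with (exp (Re z) * (4 * exp 1 * (x * x))).
  - apply Rmult_le_compat_l; [left; apply exp_pos |].
    apply Rle_trans with (1 := cexp_taylor _). fold x.
    apply Rmult_le_compat_r; [nra |]. apply Rmult_le_compat_l; [lra |]. apply exp_mono. lra.
  - replace (exp (Re z) * (4 * exp 1 * (x * x))) with (x * M * x) by (unfold M; ring).
    apply Rmult_le_compat_r; lra.
Qed.

Lemma hol_cexp (n : nat) (z : C) : hol n cexp z.
Proof.
  induction n as [|n IH].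
  - eapply Cder_contin. apply Cder_cexp.
  - exists cexp. split; [| exact IH]. exists 1. split; [lra |]. intros; apply Cder_cexp.
Qed.

Lemma Ccontin_comp (F G : C -> C) (z : C) : Ccontin F (G z) -> Ccontin G z -> Ccontin (fun w => F (G w)) z.
Proof.
  intros HF HG eps He. destruct (HF eps He) as [d [dp Hd]]. destruct (HG d dp) as [e [ep Ke]].
  exists e. split; [exact ep |]. intros w Hw. now apply Hd, Ke.
Qed.

Lemma hol_1_comp (F G : C -> C) : (forall z, hol 1 F z) -> (forall z, hol 1 G z) ->
  forall z, hol 1 (fun w => F (G w)) z.
Proof.
  intros HF HG z. destruct (hol_S_global 0 F HF) as [F1 [DF CF]], (hol_S_global 0 G HG) as [G1 [DG CG]].
  exists (fun w => F1 (G w) * G1 w)%C. split.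
  - exists 1. split; [lra |]. intros w _. apply Cder_comp; [apply DF | apply DG].
  - apply Ccontin_mult; [| apply CG]. apply Ccontin_comp; [apply CF | eapply Cder_contin; apply DG].
Qed.

Lemma Re_cexp (x y : R) : Re (cexp (x, y)) = exp x * cos y.
Proof. unfold cexp, cis, Re, Im; simpl. ring. Qed.

Lemma Im_cexp (x y : R) : Im (cexp (x, y)) = exp x * sin y.
Proof. unfold cexp, cis, Re, Im; simpl. ring. Qed.

Lemma polar (z : C) : z <> RtoC 0 -> 0 <= Im z -> exists y, 0 <= y <= PI /\ z = cexp (ln (Cmod z), y).
Proof.
  intros N I0. pose proof (proj1 (Cmod_gt_0 z) N) as P.
  pose proof (re_le_Cmod z) as rl. apply Rabs_le_between in rl.
  assert (b : -1 <= Re z / Cmod z <= 1).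
  { split; [apply Rle_div_r | apply Rle_div_l]; lra. }
  exists (acos (Re z / Cmod z)). split; [apply acos_bound |].
  apply Re_Im_eq; rewrite ?Re_cexp, ?Im_cexp, exp_ln by exact P.
  - rewrite cos_acos by exact b. field. lra.
  - rewrite sin_acos by exact b.
    assert (E : Im z = Cmod z * sqrt (1 - (Re z / Cmod z)²)).
    { rewrite <- (sqrt_square (Cmod z)) at 1 by lra.
      rewrite <- sqrt_mult_alt by nra.
      replace (Cmod z * Cmod z * (1 - (Re z / Cmod z)²)) with (Im z * Im z).
      - now rewrite sqrt_square.
      - unfold Rsqr. replace (Cmod z * Cmod z * (1 - Re z / Cmod z * (Re z / Cmod z)))
          with (Cmod z * Cmod z - Re z * Re z) by (field; lra).
        rewrite Cmod_sqr. ring. }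
    exact E.
Qed.

Lemma cos_3PI8_le (y : R) : 0 <= y <= PI -> cos (3 * PI / 8) <= cos (3 / 4 * (y - PI / 2)).
Proof.
  intro Hy. pose proof PI_RGT_0.
  destruct (Rle_dec (PI / 2) y) as [h|h].
  - apply cos_decr_1; lra.
  - rewrite <- (cos_neg (3 / 4 * (y - PI / 2))). apply cos_decr_1; lra.
Qed.

Lemma cos_3PI8_pos : 0 < cos (3 * PI / 8).
Proof. pose proof PI_RGT_0. apply cos_gt_0; lra. Qed.

(** In the coordinate [log z] the half-plane outside the unit disc becomes a half-strip of height
    [PI]. The damping factor is [exp (- d (z / i)^(3/4))]: the exponent [3/4] exceeds the order
    [1/2] of [H], and being below 1 it keeps the real part of [(z / i)^(3/4)] positive up to the
    real axis, with constant [cos (3 * PI / 8)]. At the end [d] tends to 0. *)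
Lemma phragmen_lindelof_upper (H : C -> C) (K : R) : (forall z, hol 1 H z) -> order_half H ->
  (forall x : R, Cmod (H (RtoC x)) <= K) ->
  exists K', forall z, 0 <= Im z -> Cmod (H z) <= K'.
Proof.
  intros HH [A [B [A0 [B0 Ho]]]] HK.
  assert (K0 : 0 <= K) by (apply Rle_trans with (2 := HK 0); apply Cmod_ge_0).
  set (K1 := A * exp (B * 2)). set (K' := Rmax K K1).
  assert (AK : A <= K1).
  { unfold K1. pose proof (exp_ineq1_le (B * 2)). nra. }
  assert (small : forall z, Cmod z <= 1 -> Cmod (H z) <= K1).
  { intros z Hz. apply Rle_trans with (1 := Ho z). apply Rmult_le_compat_l; [exact A0 |]. apply exp_mono.
    apply Rmult_le_compat_l; [exact B0 |]. rewrite <- (sqrt_square 2) by lra. apply sqrt_le_1_alt. lra. }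
  exists K'. intros z Hz.
  destruct (Rle_dec (Cmod z) 1) as [le1|gt1].
  { apply Rle_trans with (1 := small z le1). apply Rmax_r. }
  apply Rnot_le_lt in gt1.
  destruct (polar z) as [y [Hy Ez]]; [apply Cmod_gt_0; lra | exact Hz |].
  set (x := ln (Cmod z)) in *.
  assert (x0 : 0 < x) by (unfold x; rewrite <- ln_1; apply ln_increasing; lra).
  set (c := cos (3 * PI / 8)). assert (c0 : 0 < c) by exact cos_3PI8_pos.
  assert (main : forall d, 0 < d -> Cmod (H z) <= K' * exp (d * exp (3 / 4 * x))).
  { intros d d0.
    set (P := fun w => (RtoC (3 / 4) * w + ((0, - (3 / 8 * PI))%R : C))%C).
    set (G := fun w => (H (cexp w) * cexp (RtoC (- d) * cexp (P w)))%C).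
    assert (hP : forall w, hol 1 P w).
    { intro w. apply hol_plus; [| apply hol_const]. apply hol_mult; [apply hol_const | apply hol_id]. }
    assert (hG : forall w, hol 1 G w).
    { intro w. apply hol_mult.
      - exact (hol_1_comp H cexp HH (hol_cexp 1) w).
      - apply (hol_1_comp cexp (fun w => RtoC (- d) * cexp (P w))%C (hol_cexp 1)).
        intro v. apply hol_mult; [apply hol_const |]. exact (hol_1_comp cexp P (hol_cexp 1) hP v). }
    assert (mG : forall u v, Cmod (G (u, v)) =
       Cmod (H (cexp (u, v))) * exp (- d * (exp (3 / 4 * u) * cos (3 / 4 * (v - PI / 2))))).
    { intros u v. unfold G. rewrite Cmod_mult, Cmod_cexp, re_scal_l. f_equal. f_equal. f_equal.
      unfold cexp, cis. rewrite re_scal_l.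
      change (Re (cos (Im (P (u, v))), sin (Im (P (u, v))))) with (cos (Im (P (u, v)))).
      f_equal; f_equal; unfold P; simpl; unfold Re, Im; simpl; field. }
    assert (fac : forall u v, 0 <= v <= PI ->
       exp (- d * (exp (3 / 4 * u) * cos (3 / 4 * (v - PI / 2)))) <= exp (- d * c * exp (3 / 4 * u))).
    { intros u v Hv. apply exp_mono. pose proof (cos_3PI8_le v Hv) as Hc. fold c in Hc.
      pose proof (exp_pos (3 / 4 * u)).
      assert (exp (3 / 4 * u) * c <= exp (3 / 4 * u) * cos (3 / 4 * (v - PI / 2)))
        by (apply Rmult_le_compat_l; lra). nra. }
    assert (fac1 : forall u v, 0 <= v <= PI ->
       exp (- d * (exp (3 / 4 * u) * cos (3 / 4 * (v - PI / 2)))) <= 1).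
    { intros u v Hv. apply Rle_trans with (1 := fac u v Hv). rewrite <- exp_0. apply exp_mono.
      pose proof (exp_pos (3 / 4 * u)). assert (0 < d * c) by nra. nra. }
    (* The right side of the rectangle is placed where the damping [d * c * exp (3 / 4 * L)]
       outweighs the growth exponent [2 * B * exp (L / 2)], and beyond the given [x]. *)
    set (L := Rmax x (4 * (2 * B / (d * c)))).
    assert (Lx : x <= L) by apply Rmax_l.
    assert (LB : 2 * B <= d * c * exp (L / 4)).
    { assert (dc : 0 < d * c) by nra.
      assert (2 * B / (d * c) <= L / 4) by (unfold L; pose proof (Rmax_r x (4 * (2 * B / (d * c)))); lra).
      pose proof (exp_ineq1_le (L / 4)).
      apply Rle_trans with (d * c * (2 * B / (d * c))); [right; field; lra |].
      apply Rmult_le_compat_l; lra. }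
    assert (bnd : Cmod (G (x, y)) <= K').
    { apply (max_principle_rectangle G K' L PI hG); [ | lra | apply PI_RGT_0 | | lra | exact Hy].
      - apply Rle_trans with K; [exact K0 | apply Rmax_l].
      - intros u v Hu Hv bd. rewrite mG.
        assert (triv : forall M, Cmod (H (cexp (u, v))) <= M -> M <= K' ->
          Cmod (H (cexp (u, v))) * exp (- d * (exp (3 / 4 * u) * cos (3 / 4 * (v - PI / 2)))) <= K').
        { intros M h1 h2. pose proof (fac1 u v Hv). pose proof (Cmod_ge_0 (H (cexp (u, v)))).
          pose proof (exp_pos (- d * (exp (3 / 4 * u) * cos (3 / 4 * (v - PI / 2))))). nra. }
        destruct bd as [e|[e|[e|e]]].
        + apply (triv K1); [| apply Rmax_r]. apply small. rewrite Cmod_cexp. subst u.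
          unfold Re; simpl. rewrite exp_0. lra.
        + subst u. apply Rle_trans with (A * 1); [| rewrite Rmult_1_r; apply Rle_trans with K1; [exact AK | apply Rmax_r]].
          apply Rle_trans with (A * exp (B * (2 * exp (L / 2))) * exp (- d * c * exp (3 / 4 * L))).
          * apply Rmult_le_compat; [apply Cmod_ge_0 | left; apply exp_pos | | now apply fac].
            apply Rle_trans with (1 := Ho _). apply Rmult_le_compat_l; [exact A0 |].
            apply exp_mono, Rmult_le_compat_l; [exact B0 |].
            rewrite Cmod_cexp. unfold Re; simpl.
            pose proof (exp_pos (L / 2)).
            rewrite <- (sqrt_square (2 * exp (L / 2))) by lra. apply sqrt_le_1_alt.
            replace (2 * exp (L / 2) * (2 * exp (L / 2))) with (4 * (exp (L / 2) * exp (L / 2))) by ring.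
            rewrite <- exp_plus. replace (L / 2 + L / 2) with L by field.
            pose proof (exp_ineq1_le L). lra.
          * rewrite Rmult_assoc, <- exp_plus. apply Rmult_le_compat_l; [exact A0 |].
            rewrite <- exp_0. apply exp_mono.
            replace (3 / 4 * L) with (L / 4 + L / 2) by field. rewrite exp_plus.
            pose proof (exp_pos (L / 2)).
            assert (2 * B * exp (L / 2) <= d * c * exp (L / 4) * exp (L / 2)) by (apply Rmult_le_compat_r; lra).
            lra.
        + apply (triv K); [| apply Rmax_l]. subst v.
          replace (cexp (u, 0)) with (RtoC (exp u)); [apply HK |].
          unfold cexp, cis. simpl. rewrite cos_0, sin_0. apply Re_Im_eq; simpl; ring.
        + apply (triv K); [| apply Rmax_l]. subst v.
          replace (cexp (u, PI)) with (RtoC (- exp u)); [apply HK |].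
          unfold cexp, cis. simpl. rewrite cos_PI, sin_PI. apply Re_Im_eq; simpl; ring. }
    rewrite mG in bnd. rewrite <- Ez in bnd.
    set (q := exp (3 / 4 * x) * cos (3 / 4 * (y - PI / 2))) in *.
    assert (qe : q <= exp (3 / 4 * x)).
    { unfold q. pose proof (COS_bound (3 / 4 * (y - PI / 2))). pose proof (exp_pos (3 / 4 * x)). nra. }
    apply Rle_trans with (Cmod (H z) * exp (- d * q) * exp (d * q)).
    - right. rewrite Rmult_assoc, <- exp_plus. replace (- d * q + d * q) with 0 by ring. rewrite exp_0. ring.
    - apply Rmult_le_compat; [apply Rmult_le_pos; [apply Cmod_ge_0 | left; apply exp_pos] | left; apply exp_pos | exact bnd |].
      apply exp_mono. apply Rmult_le_compat_l; lra. }
  set (X := exp (3 / 4 * x)) in *. assert (X0 : 0 < X) by apply exp_pos.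
  assert (K'0 : 0 <= K') by (apply Rle_trans with K; [exact K0 | apply Rmax_l]).
  apply Rminus_le. apply Rle_0_of_all_eps. intros eps He.
  (* This makes the loss factor [exp (d * X)] equal to [1 + eps / (K' + 1)]. *)
  set (d := ln (1 + eps / (K' + 1)) / X).
  assert (q0 : 0 < eps / (K' + 1)) by (apply Rdiv_lt_0_compat; lra).
  assert (d0 : 0 < d).
  { apply Rdiv_lt_0_compat; [| exact X0]. rewrite <- ln_1. apply ln_increasing; lra. }
  specialize (main d d0). replace (d * X) with (ln (1 + eps / (K' + 1))) in main by (unfold d; field; lra).
  rewrite exp_ln in main by lra.
  assert (K' * (eps / (K' + 1)) <= (K' + 1) * (eps / (K' + 1))) by (apply Rmult_le_compat_r; lra).
  replace ((K' + 1) * (eps / (K' + 1))) with eps in H0 by (field; lra). lra.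
Qed.

Lemma bounded_on_reals_const (H : C -> C) (K : R) : (forall z, hol 2 H z) -> order_half H ->
  (forall x : R, Cmod (H (RtoC x)) <= K) -> forall z, H z = H (RtoC 0).
Proof.
  intros HH Ho HK.
  assert (H1 : forall z, hol 1 H z) by (intro z; apply hol_pred, HH).
  destruct (phragmen_lindelof_upper H K H1 Ho HK) as [K1 B1].
  destruct (phragmen_lindelof_upper (fun z => H (- z)%C) K) as [K2 B2].
  - apply (hol_1_comp H (fun z => - z)%C H1). intro z. apply hol_opp, hol_id.
  - destruct Ho as [A [B [a [b h]]]]. exists A, B. split; [exact a |]. split; [exact b |].
    intro z. rewrite <- (Cmod_opp z). apply h.
  - intro x. rewrite <- RtoC_opp. apply HK.
  - apply (liouville H (Rmax K1 K2) HH). intro z.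
    destruct (Rle_dec 0 (Im z)) as [h|h].
    + apply Rle_trans with (1 := B1 z h). apply Rmax_l.
    + specialize (B2 (- z)%C). replace (- - z)%C with z in B2 by ring.
      apply Rle_trans with K2; [apply B2 | apply Rmax_r].
      unfold Im in *; simpl. lra.
Qed.

(** * Behaviour as the spectral parameter tends to minus infinity *)

Lemma sqr_le_reg (x y : R) : 0 <= y -> x * x <= y * y -> x <= y.
Proof. intros Hy H. apply Rsqr_incr_0_var; assumption. Qed.

(** As [y] is the difference of the two components divided by [2 * k], the potential couples them
    only with strength [Q / k]. *)
Lemma cdot_potential_bound (al be y : C) (q : C) (k Q : R) : 0 < k -> 0 <= Q -> Cmod q <= Q ->
  (RtoC (2 * k) * y = be - al)%C ->
  Rabs (2 * cdot al (q * y)) <= Q / k * (2 * cdot al al + cdot be be).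
Proof.
  intros k0 Q0 Hq E.
  assert (Ey : 2 * k * Cmod y <= Cmod be + Cmod al).
  { pose proof (Cmod_triangle_minus be al) as T. rewrite <- E, Cmod_mult, Cmod_R, Rabs_pos_eq in T by lra. exact T. }
  rewrite Rabs_mult, (Rabs_pos_eq 2) by lra.
  pose proof (cdot_le al (q * y)%C) as D. rewrite Cmod_mult in D. rewrite !cdot_diag.
  pose proof (Cmod_ge_0 al). pose proof (Cmod_ge_0 be). pose proof (Cmod_ge_0 y).
  set (A := Cmod al) in *. set (B := Cmod be) in *. set (Y := Cmod y) in *.
  assert (Cmod q * Y <= Q * Y) by (now apply Rmult_le_compat_r).
  assert (A * (Cmod q * Y) <= A * (Q * Y)) by (now apply Rmult_le_compat_l).
  apply Rle_trans with (2 * (A * (Q * Y))); [lra |].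
  replace (2 * (A * (Q * Y))) with (Q / k * (A * (2 * k * Y))) by (field; lra).
  apply Rmult_le_compat_l; [apply Rmult_le_pos; [exact Q0 | left; now apply Rinv_0_lt_compat] |].
  assert (A * (2 * k * Y) <= A * (B + A)) by (now apply Rmult_le_compat_l).
  pose proof (Rle_0_sqr (A - B)). unfold Rsqr in *. nra.
Qed.

Section Backward.

Variables (q : R -> C) (a b Q k : R) (y v : R -> C).
Hypothesis ab : a < b.
Hypothesis HQ : forall x, a <= x <= b -> Cmod (q x) <= Q.
Hypothesis k1 : 1 <= k.
Hypothesis kQ : 4 * Q <= k * k.
Hypothesis Sol : is_sol q (RtoC (- (k * k))) y v.

(* Growing to the left and to the right, respectively; alpha - beta = - 2 k y. *)
Let alpha := fun x => (v x - RtoC k * y x)%C.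
Let beta := fun x => (v x + RtoC k * y x)%C.
Let P := fun x => cdot (alpha x) (alpha x).
Let T := fun x => cdot (beta x) (beta x).

Lemma alpha_deriv (x : R) : cderiv alpha x (- RtoC k * alpha x + q x * y x)%C.
Proof.
  destruct Sol as [h1 h2]. unfold alpha. eapply cderiv_eq.
  - apply cderiv_minus; [apply h2 | apply cderiv_scal, h1].
  - rewrite RtoC_opp, RtoC_mult. ring.
Qed.

Lemma beta_deriv (x : R) : cderiv beta x (RtoC k * beta x + q x * y x)%C.
Proof.
  destruct Sol as [h1 h2]. unfold beta. eapply cderiv_eq.
  - apply cderiv_plus; [apply h2 | apply cderiv_scal, h1].
  - rewrite RtoC_opp, RtoC_mult. ring.
Qed.

Lemma alpha_sqr_deriv (x : R) : is_derive P x (- 2 * k * P x + 2 * cdot (alpha x) (q x * y x)%C).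
Proof.
  eapply is_derive_eq; [apply is_derive_cdot; apply alpha_deriv |].
  unfold P, cdot. rewrite !re_plus, !im_plus, !re_mult, !im_mult. simpl. ring.
Qed.

Lemma beta_sqr_deriv (x : R) : is_derive T x (2 * k * T x + 2 * cdot (beta x) (q x * y x)%C).
Proof.
  eapply is_derive_eq; [apply is_derive_cdot; apply beta_deriv |].
  unfold T, cdot. rewrite !re_plus, !im_plus, !re_mult, !im_mult. simpl. ring.
Qed.

Lemma alpha_beta_bounds (x : R) : a <= x <= b ->
  Rabs (2 * cdot (alpha x) (q x * y x)%C) <= Q / k * (2 * P x + T x) /\
  Rabs (2 * cdot (beta x) (q x * y x)%C) <= Q / k * (2 * T x + P x) /\
  0 <= P x /\ 0 <= T x /\ 0 <= Q / k /\ 4 * (Q / k) <= k.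
Proof.
  intro Hx.
  assert (Q0 : 0 <= Q) by (apply Rle_trans with (2 := HQ x Hx); apply Cmod_ge_0).
  split; [| split; [| split; [| split; [| split]]]].
  - apply (cdot_potential_bound (alpha x) (beta x)); [lra | exact Q0 | now apply HQ |].
    unfold alpha, beta. rewrite RtoC_mult. ring.
  - replace (2 * cdot (beta x) (q x * y x)) with (- (2 * cdot (beta x) (q x * (- y x))%C))
      by (unfold cdot; rewrite !re_mult, !im_mult; rewrite ?re_opp, ?im_opp; ring).
    rewrite Rabs_Ropp.
    apply (cdot_potential_bound (beta x) (alpha x)); [lra | exact Q0 | now apply HQ |].
    unfold alpha, beta. rewrite RtoC_mult. ring.
  - apply cdot_ge_0.
  - apply cdot_ge_0.
  - apply Rmult_le_pos; [exact Q0 | left; apply Rinv_0_lt_compat; lra].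
  - replace (4 * (Q / k)) with (4 * Q / k) by (field; lra). apply Rle_div_l; lra.
Qed.

Hypothesis Dominated : T b < 4 * P b.

(** [4 * P - T] decreases in [x], so domination at the right end spreads over the interval. The
    factor 4 leaves room for the data at b_N, where [P = T]. *)
Lemma beta_dominated (x : R) : a <= x <= b -> T x < 4 * P x.
Proof.
  intro Hx.
  assert (D : 4 * P b - T b <= 4 * P x - T x).
  { apply (nonincreasing_of_derive (fun x => 4 * P x - T x)
      (fun x => 4 * (- 2 * k * P x + 2 * cdot (alpha x) (q x * y x)%C)
                - (2 * k * T x + 2 * cdot (beta x) (q x * y x)%C))); [lra | |].
    - intros t _. apply (is_derive_minus (K := R_AbsRing) (V := R_NormedModule) (fun x => 4 * P x) T);
        [| apply beta_sqr_deriv]. apply (is_derive_scal P). apply alpha_sqr_deriv.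
    - intros t Ht. destruct (alpha_beta_bounds t ltac:(lra)) as (h1 & h2 & h3 & h4 & h5 & h6).
      apply Rabs_le_between in h1. apply Rabs_le_between in h2.
      set (u := Q / k) in *. set (X := 2 * cdot (alpha t) (q t * y t)%C) in *.
      set (Z := 2 * cdot (beta t) (q t * y t)%C) in *.
      assert (u * P t * 4 <= k * P t) by nra. assert (u * T t * 4 <= k * T t) by nra.
      assert (0 <= k * P t) by nra. assert (0 <= k * T t) by nra. lra. }
  lra.
Qed.

(** Domination turns [2 * P + T] into at most [6 * P], which closes the differential inequality for
    [P] alone. *)
Lemma alpha_decay (x : R) : a <= x <= b -> P x <= P a * exp ((- 2 * k + 6 * (Q / k)) * (x - a)).
Proof.
  intro Hx. apply (gronwall P (fun x => - 2 * k * P x + 2 * cdot (alpha x) (q x * y x)%C)); [lra | |].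
  - intros; apply alpha_sqr_deriv.
  - intros t Ht. destruct (alpha_beta_bounds t ltac:(lra)) as (h1 & h2 & h3 & h4 & h5 & h6).
    pose proof (beta_dominated t ltac:(lra)). apply Rabs_le_between in h1.
    set (u := Q / k) in *. assert (u * T t <= u * (4 * P t)) by (apply Rmult_le_compat_l; lra). lra.
Qed.

Lemma alpha_mono : P b <= P a.
Proof.
  apply Rle_trans with (1 := alpha_decay b ltac:(lra)).
  destruct (alpha_beta_bounds a ltac:(lra)) as (h1 & h2 & h3 & h4 & h5 & h6).
  rewrite <- (Rmult_1_r (P a)) at 2. apply Rmult_le_compat_l; [exact h3 |].
  rewrite <- exp_0. apply exp_mono. nra.
Qed.

(** [T - tau * P] grows to the right at rate at least [2 * k], while at [b] it is at most
    [4 * P b <= 4 * P a]; hence at [a] it is at most [4 exp (- 2 k (b - a)) P a]. This yields the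
    summand [2 / (b - a)] of the constant, and [tau * P a] the summand [4 * Q]. *)
Lemma beta_small : T a <= (4 * Q + 2 / (b - a)) / k * P a.
Proof.
  destruct (alpha_beta_bounds a ltac:(lra)) as (_ & _ & Pa & Ta & u0 & u1).
  assert (Q0 : 0 <= Q) by (apply Rle_trans with (2 := HQ a ltac:(lra)); apply Cmod_ge_0).
  (* With [tau * k = 4 * Q / k] the term [4 * k * tau * P] amounts to 16 units of [Q / k * P], while
     the potential terms cost at most 15. *)
  set (tau := 4 * (Q / k) / k).
  assert (t0 : 0 <= tau) by (apply Rmult_le_pos; [lra | left; apply Rinv_0_lt_compat; lra]).
  assert (t1 : tau <= 1) by (apply Rle_div_l; lra).
  assert (tk : tau * k = 4 * (Q / k)) by (unfold tau; field; lra).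
  assert (G : - (T b - tau * P b) <= - (T a - tau * P a) * exp (2 * k * (b - a))).
  { apply (gronwall (fun x => - (T x - tau * P x))
      (fun x => - ((2 * k * T x + 2 * cdot (beta x) (q x * y x)%C)
         - tau * (- 2 * k * P x + 2 * cdot (alpha x) (q x * y x)%C)))); [lra | |].
    - intros t _. apply (is_derive_opp (K := R_AbsRing) (V := R_NormedModule) (fun x => T x - tau * P x)).
      apply (is_derive_minus (K := R_AbsRing) (V := R_NormedModule) T (fun x => tau * P x)); [apply beta_sqr_deriv |].
      apply (is_derive_scal P). apply alpha_sqr_deriv.
    - intros t Ht. destruct (alpha_beta_bounds t Ht) as (h1 & h2 & h3 & h4 & h5 & h6).
      pose proof (beta_dominated t Ht) as gd. apply Rabs_le_between in h1. apply Rabs_le_between in h2.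
      set (u := Q / k) in *. set (X := 2 * cdot (alpha t) (q t * y t)%C) in *.
      set (Z := 2 * cdot (beta t) (q t * y t)%C) in *.
      assert (e1 : tau * k * P t = 4 * u * P t) by (rewrite tk; ring).
      assert (e2 : u * T t <= 4 * (u * P t)) by nra.
      assert (e4 : 0 <= u * P t) by nra. assert (e5 : 0 <= u * T t) by nra.
      assert (e3 : tau * X <= tau * (u * (2 * P t + T t))) by (apply Rmult_le_compat_l; lra).
      assert (e6 : tau * (u * (2 * P t + T t)) <= 1 * (u * (2 * P t + T t))) by (apply Rmult_le_compat_r; nra).
      lra. }
  destruct (alpha_beta_bounds b ltac:(lra)) as (_ & _ & Pb & Tb & _ & _).
  pose proof alpha_mono as mono.
  assert (X : (T a - tau * P a) * exp (2 * k * (b - a)) <= 4 * P a) by nra.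
  set (l := b - a) in *. assert (l0 : 0 < l) by (unfold l; lra).
  pose proof (exp_ineq1_le (2 * k * l)) as ee.
  assert (kl : 0 < 2 * k * l) by nra.
  assert (Y : T a - tau * P a <= 2 / l / k * P a).
  { destruct (Rle_dec (T a - tau * P a) 0) as [h|h].
    - apply Rle_trans with (1 := h). repeat apply Rmult_le_pos; try assumption; try lra;
        left; apply Rinv_0_lt_compat; lra.
    - apply Rmult_le_reg_r with (2 * k * l); [exact kl |].
      replace (2 / l / k * P a * (2 * k * l)) with (4 * P a) by (field; lra).
      apply Rle_trans with (2 := X). apply Rmult_le_compat_l; lra. }
  assert (Z : tau * P a <= 4 * Q / k * P a).
  { apply Rmult_le_compat_r; [exact Pa |].
    unfold tau. replace (4 * (Q / k) / k) with (4 * Q / k / k) by (field; lra).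
    apply Rle_div_l; [lra |].
    assert (0 <= 4 * Q / k) by (apply Rmult_le_pos; [lra | left; apply Rinv_0_lt_compat; lra]). nra. }
  replace ((4 * Q + 2 / l) / k * P a) with (4 * Q / k * P a + 2 / l / k * P a) by (field; lra). lra.
Qed.

Hypothesis kc : 4 * (4 * Q + 2 / (b - a)) <= k.

(** The last hypothesis on [k] makes [|beta| <= |alpha| / 2] at [a], so their sum [2 v] and their
    difference [- 2 k y] cannot vanish. The third claim says that [v / y = - k + O(sqrt k)] at
    [a]. *)
Lemma backward_bounds :
  y a <> RtoC 0 /\ v a <> RtoC 0 /\
  Cmod (v a + RtoC k * y a) * Cmod (v a + RtoC k * y a)
    <= 16 * (4 * Q + 2 / (b - a)) * k * (Cmod (y a) * Cmod (y a)) /\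
  forall x, a <= x <= b -> Cmod (y x) <= 6 * exp (3 * Q * (b - a)) * exp (- (k * (x - a))) * Cmod (y a).
Proof.
  set (c := 4 * Q + 2 / (b - a)) in *.
  assert (Q0 : 0 <= Q) by (apply Rle_trans with (2 := HQ a ltac:(lra)); apply Cmod_ge_0).
  assert (c0 : 0 < c).
  { unfold c. assert (0 < 2 / (b - a)) by (apply Rdiv_lt_0_compat; lra). lra. }
  pose proof beta_small as TS. fold c in TS.
  pose proof (beta_dominated a ltac:(lra)) as ga.
  unfold P, T in TS, ga. rewrite !cdot_diag in TS, ga.
  set (A := Cmod (alpha a)) in *. set (B := Cmod (beta a)) in *.
  assert (A0 : 0 <= A) by apply Cmod_ge_0. assert (B0 : 0 <= B) by apply Cmod_ge_0.
  assert (Ap : 0 < A) by nra.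
  assert (ck : c / k <= / 4).
  { apply Rle_div_l; lra. }
  assert (BA : B <= A / 2).
  { apply sqr_le_reg; [lra |]. assert (c / k * (A * A) <= / 4 * (A * A)) by (apply Rmult_le_compat_r; nra). lra. }
  assert (ky : (RtoC (2 * k) * y a = beta a - alpha a)%C) by (unfold alpha, beta; rewrite RtoC_mult; ring).
  assert (vy : (RtoC 2 * v a = alpha a + beta a)%C) by (unfold alpha, beta; ring).
  assert (Ay : A <= 4 * (k * Cmod (y a))).
  { pose proof (Cmod_triangle_rev (alpha a) (beta a)) as t.
    rewrite Cmod_minus_sym, <- ky, Cmod_mult, Cmod_R, Rabs_pos_eq in t by lra. fold A B in t. lra. }
  assert (yp : 0 < Cmod (y a)) by nra.
  assert (vp : 0 < Cmod (v a)).
  { pose proof (Cmod_triangle_rev (alpha a) (- beta a)%C) as t. rewrite Cmod_opp in t.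
    replace (alpha a - - beta a)%C with (RtoC 2 * v a)%C in t by (rewrite vy; ring).
    rewrite Cmod_mult, Cmod_R, Rabs_pos_eq in t by lra. fold A B in t. lra. }
  split; [now apply Cmod_gt_0 |]. split; [now apply Cmod_gt_0 |]. split.
  - fold (beta a). fold B. apply Rle_trans with (1 := TS).
    apply Rle_trans with (c / k * ((4 * (k * Cmod (y a))) * (4 * (k * Cmod (y a))))).
    + apply Rmult_le_compat_l; [left; apply Rdiv_lt_0_compat; lra |].
      apply Rmult_le_compat; assumption.
    + right; field; lra.
  - intros x Hx.
    pose proof (beta_dominated x Hx) as gx. pose proof (alpha_decay x Hx) as dx.
    unfold P, T in gx, dx. rewrite !cdot_diag in gx, dx. fold A in dx.
    set (Ax := Cmod (alpha x)) in *. set (Bx := Cmod (beta x)) in *.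
    assert (Ax0 : 0 <= Ax) by apply Cmod_ge_0. assert (Bx0 : 0 <= Bx) by apply Cmod_ge_0.
    assert (BAx : Bx <= 2 * Ax) by (apply sqr_le_reg; [lra | nra]).
    assert (yx : 2 * k * Cmod (y x) <= 3 * Ax).
    { assert (kyx : (RtoC (2 * k) * y x = beta x - alpha x)%C) by (unfold alpha, beta; rewrite RtoC_mult; ring).
      pose proof (Cmod_triangle_minus (beta x) (alpha x)) as t. rewrite <- kyx, Cmod_mult, Cmod_R, Rabs_pos_eq in t by lra.
      fold Ax Bx in t. lra. }
    set (e1 := exp (3 * Q * (b - a))). set (e2 := exp (- (k * (x - a)))).
    assert (p1 : 0 < e1) by apply exp_pos. assert (p2 : 0 < e2) by apply exp_pos.
    assert (Axb : Ax <= A * (e1 * e2)).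
    { apply sqr_le_reg; [apply Rmult_le_pos; [exact A0 | nra] |].
      apply Rle_trans with (1 := dx).
      replace (A * (e1 * e2) * (A * (e1 * e2))) with (A * A * ((e1 * e2) * (e1 * e2))) by ring.
      apply Rmult_le_compat_l; [nra |]. unfold e1, e2. rewrite <- !exp_plus. apply exp_mono.
      assert (Qk : Q / k <= Q) by (apply Rle_div_l; [lra | nra]).
      assert (Q / k * (x - a) <= Q * (b - a)).
      { apply Rmult_le_compat; [apply Rmult_le_pos; [exact Q0 | left; apply Rinv_0_lt_compat; lra] | lra | exact Qk | lra]. }
      lra. }
    apply Rmult_le_reg_l with (2 * k); [lra |].
    apply Rle_trans with (1 := yx).
    apply Rle_trans with (3 * (4 * (k * Cmod (y a)) * (e1 * e2))).
    + apply Rmult_le_compat_l; [lra |]. apply Rle_trans with (1 := Axb).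
      apply Rmult_le_compat_r; [nra | exact Ay].
    + right; ring.
Qed.

End Backward.

(** In [Vb] the term [d k^2 Y] dominates and in [Yb] the term [d Vb], which gives
    [k |Yb| >= 7 |Vb|]. So [Vb] changes [k Yb] by at most a seventh of its modulus, and
    [(8 / 6)^2 < 4]. *)
Lemma gap_good (Y V qb : C) (d Q k : R) : 0 < d -> 0 <= Q -> Cmod qb <= Q -> 1 + 2 * Q <= k -> 8 <= k * d ->
  Y <> RtoC 0 -> Cmod V <= 2 * k * Cmod Y ->
  let Vb := (V - RtoC d * (qb - RtoC (- (k * k))) * Y)%C in
  let Yb := (Y - RtoC d * Vb)%C in
  cdot (Vb + RtoC k * Yb) (Vb + RtoC k * Yb) < 4 * cdot (Vb - RtoC k * Yb) (Vb - RtoC k * Yb).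
Proof.
  intros d0 Q0 Hq k1 kd NY HV Vb Yb.
  apply Cmod_gt_0 in NY.
  assert (k0 : 1 <= k) by lra.
  assert (V1 : k * Cmod Y <= Cmod Vb).
  { pose proof (Cmod_triangle_rev (RtoC (d * (k * k)) * Y) (V - RtoC d * qb * Y)) as t.
    replace (RtoC (d * (k * k)) * Y - (V - RtoC d * qb * Y))%C with (- Vb)%C in t
      by (unfold Vb; rewrite RtoC_opp, !RtoC_mult; ring).
    rewrite Cmod_opp, Cmod_mult, Cmod_R, Rabs_pos_eq in t by nra.
    pose proof (Cmod_triangle_minus V (RtoC d * qb * Y)) as t2.
    rewrite !Cmod_mult, Cmod_R, Rabs_pos_eq in t2 by lra.
    assert (d * Cmod qb * Cmod Y <= d * Q * Cmod Y) by (apply Rmult_le_compat_r; [lra |]; now apply Rmult_le_compat_l; [lra |]).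
    assert (h : k + 2 * k + d * Q <= d * (k * k)).
    { assert (8 * k <= k * d * k) by nra. assert (2 * Q <= k * k) by nra. assert (d * (2 * Q) <= d * (k * k)) by nra. nra. }
    assert ((k + 2 * k + d * Q) * Cmod Y <= d * (k * k) * Cmod Y) by (apply Rmult_le_compat_r; lra).
    lra. }
  assert (Y1 : 7 * Cmod Vb <= k * Cmod Yb).
  { pose proof (Cmod_triangle_rev (RtoC d * Vb) Y) as t.
    replace (RtoC d * Vb - Y)%C with (- Yb)%C in t by (unfold Yb; ring).
    rewrite Cmod_opp, Cmod_mult, Cmod_R, Rabs_pos_eq in t by lra.
    assert (8 * Cmod Vb <= k * d * Cmod Vb) by (apply Rmult_le_compat_r; [apply Cmod_ge_0 | lra]).
    assert (k * (d * Cmod Vb - Cmod Y) <= k * Cmod Yb) by (apply Rmult_le_compat_l; lra). lra. }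
  assert (Vp : 0 < Cmod Vb) by nra.
  rewrite !cdot_diag.
  pose proof (Cmod_triangle Vb (RtoC k * Yb)) as t1.
  pose proof (Cmod_triangle_rev (RtoC k * Yb) Vb) as t2.
  rewrite Cmod_minus_sym in t2. rewrite Cmod_mult, Cmod_R, Rabs_pos_eq in t1, t2 by lra.
  pose proof (Cmod_ge_0 (Vb + RtoC k * Yb)). nra.
Qed.

(** * The local Borg-Marchenko theorem *)

Lemma fundamental_order_half (q : R -> C) (a b Q x : R) (c c1 s s1 : C -> R -> C) :
  fundamental q a c c1 s s1 -> (forall t, a <= t <= b -> Cmod (q t) <= Q) -> a <= x <= b ->
  order_half (fun l => c l x) /\ order_half (fun l => c1 l x) /\
  order_half (fun l => s l x) /\ order_half (fun l => s1 l x).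
Proof.
  intros F HQ Hx.
  assert (Q0 : 0 <= Q) by (apply Rle_trans with (2 := HQ x Hx); apply Cmod_ge_0).
  assert (B0 : 0 <= (Q + 2) * (x - a)) by (apply Rmult_le_pos; lra).
  assert (K : forall Y V : C -> R -> C, (forall l, is_sol q l (Y l) (V l)) ->
    (forall l, Cmod (Y l a) <= 1) -> (forall l, Cmod (V l a) <= 1) ->
    order_half (fun l => Y l x) /\ order_half (fun l => V l x)).
  { intros Y V HS HY HV.
    assert (Bd : forall l, Cmod (Y l x) <= 2 * exp ((Q + 2) * (x - a) * sqrt (1 + Cmod l)) /\
       Cmod (V l x) <= 2 * sqrt (1 + Cmod l) * exp ((Q + 2) * (x - a) * sqrt (1 + Cmod l))).
    { intro l. apply (sol_bound q l (Y l) (V l) (sqrt (1 + Cmod l)) Q a x (HS l)); auto; try lra.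
      - apply sqrt_1_Cmod.
      - rewrite sqrt_sqrt; pose proof (Cmod_ge_0 l); lra.
      - intros t Ht. apply HQ; lra. }
    split.
    - exists 2, ((Q + 2) * (x - a)). split; [lra |]. split; [exact B0 |]. intro l. apply Bd.
    - exists 2, ((Q + 2) * (x - a) + 1). split; [lra |]. split; [lra |]. intro l.
      apply Rle_trans with (1 := proj2 (Bd l)).
      rewrite (Rmult_plus_distr_r ((Q + 2) * (x - a)) 1), exp_plus, Rmult_assoc. apply Rmult_le_compat_l; [lra |].
      rewrite Rmult_comm. apply Rmult_le_compat_l; [left; apply exp_pos |].
      pose proof (exp_ineq1_le (1 * sqrt (1 + Cmod l))). lra. }
  destruct (K c c1) as [h1 h2]; try (intro l; destruct (F l) as (e1 & e2 & e3 & e4 & e5 & e6)).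
  { exact e1. } { rewrite e3, Cmod_1; lra. } { rewrite e4, Cmod_0; lra. }
  destruct (K s s1) as [h3 h4]; try (intro l; destruct (F l) as (e1 & e2 & e3 & e4 & e5 & e6)).
  { exact e2. } { rewrite e5, Cmod_0; lra. } { rewrite e6, Cmod_1; lra. }
  tauto.
Qed.

Lemma fundamental_ereg (q : R -> C) (a b Q x : R) (c c1 s s1 : C -> R -> C) :
  fundamental q a c c1 s s1 -> (forall t, a <= t <= b -> Cmod (q t) <= Q) -> a <= x <= b ->
  ereg (fun l => c l x) /\ ereg (fun l => c1 l x) /\ ereg (fun l => s l x) /\ ereg (fun l => s1 l x).
Proof.
  intros F HQ Hx.
  assert (K := fundamental_preg q a b Q c c1 s s1 ltac:(lra) F HQ).
  split; [| split; [| split]]; apply (ereg_eval a b x); try exact Hx; intro n; apply (K n).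
Qed.

Lemma fundamental_bounded_pos (q : R -> C) (a b Q x t : R) (c c1 s s1 : C -> R -> C) :
  fundamental q a c c1 s s1 -> (forall t, a <= t <= b -> Cmod (q t) <= Q) -> a <= x <= b -> 1 <= t ->
  Cmod (c (RtoC t) x) <= exp (Q * (b - a)) /\ Cmod (s (RtoC t) x) <= exp (Q * (b - a)).
Proof.
  intros F HQ Hx Ht.
  assert (Q0 : 0 <= Q) by (apply Rle_trans with (2 := HQ x Hx); apply Cmod_ge_0).
  destruct (F (RtoC t)) as (h1 & h2 & e1 & e2 & e3 & e4).
  set (k := sqrt t). assert (kk : k * k = t) by (apply sqrt_sqrt; lra).
  assert (k1 : 1 <= k) by (unfold k; rewrite <- sqrt_1; now apply sqrt_le_1_alt).
  assert (En : forall y v, is_sol q (RtoC t) y v ->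
    Cmod (v x) * Cmod (v x) + t * (Cmod (y x) * Cmod (y x)) <=
    (Cmod (v a) * Cmod (v a) + t * (Cmod (y a) * Cmod (y a))) * exp (Q * (b - a))).
  { intros y v H. rewrite <- kk.
    apply Rle_trans with (1 := sol_energy q (RtoC t) y v k Q a x H ltac:(lra) Q0 ltac:(lra)
      ltac:(intros u Hu; rewrite kk; replace (q u - RtoC t + RtoC t)%C with (q u) by ring; apply HQ; lra)).
    apply Rmult_le_compat_l.
    - apply Rplus_le_le_0_compat; [apply Rmult_le_pos; apply Cmod_ge_0 |].
      apply Rmult_le_pos; [nra | apply Rmult_le_pos; apply Cmod_ge_0].
    - apply exp_mono. assert (Q / k <= Q) by (apply Rle_div_l; [lra | nra]).
      assert (0 <= Q / k) by (apply Rmult_le_pos; [exact Q0 | left; apply Rinv_0_lt_compat; lra]).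
      apply Rmult_le_compat; lra. }
  assert (e1p : 1 <= exp (Q * (b - a))).
  { rewrite <- exp_0. apply exp_mono. apply Rmult_le_pos; lra. }
  set (e := exp (Q * (b - a))) in *.
  pose proof (En _ _ h1) as E1. pose proof (En _ _ h2) as E2.
  rewrite e1, e2, Cmod_0, Cmod_1 in E1. rewrite e3, e4, Cmod_0, Cmod_1 in E2.
  assert (K : forall X Y m, 0 <= m <= t -> X * X + t * (Y * Y) <= m * e -> Y <= e).
  { intros X Y m Hm H. apply sqr_le_reg; [lra |].
    assert (m * e <= t * e) by (apply Rmult_le_compat_r; lra).
    assert (Y * Y <= e) by (apply Rmult_le_reg_l with t; nra). nra. }
  split.
  - apply (K (Cmod (c1 (RtoC t) x)) _ t); lra.
  - apply (K (Cmod (s1 (RtoC t) x)) _ 1); lra.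
Qed.

Lemma fundamental_growth_neg (q : R -> C) (a b Q x k : R) (c c1 s s1 : C -> R -> C) :
  fundamental q a c c1 s s1 -> (forall t, a <= t <= b -> Cmod (q t) <= Q) -> a <= x <= b -> 1 <= k ->
  Cmod (s (RtoC (- (k * k))) x) <= exp (k * (x - a)) * exp (Q * (b - a)) / k.
Proof.
  intros F HQ Hx k1.
  assert (Q0 : 0 <= Q) by (apply Rle_trans with (2 := HQ x Hx); apply Cmod_ge_0).
  set (lam := RtoC (- (k * k))).
  destruct (F lam) as (h1 & h2 & e1 & e2 & e3 & e4).
  pose proof (sol_energy q lam _ _ k (Q + 2 * (k * k)) a x h2 ltac:(lra) ltac:(nra) ltac:(lra)) as E.
  assert (B : forall u, a <= u <= x -> Cmod (q u - lam + RtoC (k * k)) <= Q + 2 * (k * k)).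
  { intros u Hu. unfold lam. rewrite RtoC_opp.
    replace (q u - - RtoC (k * k) + RtoC (k * k))%C with (q u + RtoC (2 * (k * k)))%C
      by (rewrite (RtoC_mult 2); ring).
    apply Rle_trans with (1 := Cmod_triangle _ _). rewrite Cmod_R, Rabs_pos_eq by nra.
    specialize (HQ u ltac:(lra)). lra. }
  specialize (E B). rewrite e3, e4, Cmod_0, Cmod_1 in E.
  apply Rle_div_r; [lra |].
  set (S := Cmod (s lam x)) in *. assert (S0 : 0 <= S) by apply Cmod_ge_0.
  pose proof (exp_pos (k * (x - a))). pose proof (exp_pos (Q * (b - a))).
  apply sqr_le_reg; [nra |].
  apply Rle_trans with (exp ((Q + 2 * (k * k)) / k * (x - a))).
  - pose proof (Cmod_ge_0 (s1 lam x)). nra.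
  - rewrite <- !exp_plus. apply exp_mono.
    replace ((Q + 2 * (k * k)) / k * (x - a)) with (2 * k * (x - a) + Q / k * (x - a)) by (field; lra).
    assert (Q / k <= Q) by (apply Rle_div_l; [lra | nra]).
    assert (0 <= Q / k) by (apply Rmult_le_pos; [exact Q0 | left; apply Rinv_0_lt_compat; lra]).
    assert (Q / k * (x - a) <= Q * (b - a)) by (apply Rmult_le_compat; lra).
    assert (0 <= Q * (b - a)) by nra. lra.
Qed.

Lemma ccont_zero_closed (f : R -> C) (a b : R) : a < b -> ccont f ->
  (forall x, a < x < b -> f x = RtoC 0) -> forall x, a <= x <= b -> f x = RtoC 0.
Proof.
  intros ab cf Z.
  assert (D : forall x, a < x < b -> cderiv f x (RtoC 0)).
  { intros x Hx. apply cderiv_ext_loc with (fun _ => RtoC 0); [| apply cderiv_const].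
    assert (r0 : 0 < Rmin (x - a) (b - x)) by (apply Rmin_glb_lt; lra).
    exists (mkposreal _ r0). intros t Ht. unfold ball in Ht; simpl in Ht. unfold AbsRing_ball, abs, minus, plus, opp in Ht; simpl in Ht.
    pose proof (Rmin_l (x - a) (b - x)). pose proof (Rmin_r (x - a) (b - x)).
    apply Rabs_def2 in Ht. symmetry. apply Z. lra. }
  pose proof (const_of_cderiv_0 f a b D cf) as K.
  intros x Hx. rewrite (K x Hx), <- (K ((a + b) / 2)) by lra. apply Z. lra.
Qed.

Lemma cderiv_interval_ext (f g : R -> C) (a b x : R) (l m : C) : a < x < b ->
  (forall t, a < t < b -> f t = g t) -> cderiv f x l -> cderiv g x m -> l = m.
Proof.
  intros Hx E F G. apply (cderiv_unique g x l m); [| exact G].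
  apply cderiv_ext_loc with f; [| exact F].
  assert (r0 : 0 < Rmin (x - a) (b - x)) by (apply Rmin_glb_lt; lra).
  exists (mkposreal _ r0). intros t Ht. unfold ball in Ht; simpl in Ht. unfold AbsRing_ball, abs, minus, plus, opp in Ht; simpl in Ht.
  pose proof (Rmin_l (x - a) (b - x)). pose proof (Rmin_r (x - a) (b - x)).
  apply Rabs_def2 in Ht. apply E. lra.
Qed.

(* If C St = S Ct then (Ct, St) = p (C, S) for a scalar function p, and comparing Wronskians
   gives p^2 = 1. *)
Lemma potential_from_ratio (q qt : R -> C) (lam : C) (a b : R) (c c1 s s1 ct ct1 st st1 : R -> C) :
  a < b -> ccont q -> ccont qt ->
  is_sol q lam c c1 -> is_sol q lam s s1 -> is_sol qt lam ct ct1 -> is_sol qt lam st st1 ->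
  (forall x, c x * s1 x - c1 x * s x = RtoC 1)%C ->
  (forall x, ct x * st1 x - ct1 x * st x = RtoC 1)%C ->
  c a = RtoC 1 -> ct a = RtoC 1 -> c1 a = RtoC 0 -> s1 a = RtoC 1 -> st a = RtoC 0 ->
  (forall x, a <= x <= b -> (c x * st x = s x * ct x)%C) ->
  forall x, a <= x <= b -> q x = qt x.
Proof.
  intros ab cq cqt Sc Ss Sct Sst W Wt ca cta c1a s1a sta R.
  set (p := fun x => (ct x * s1 x - st x * c1 x)%C).
  assert (Dp : forall x, cderiv p x ((ct1 x * s1 x + ct x * ((q x - lam) * s x)) - (st1 x * c1 x + st x * ((q x - lam) * c x)))%C).
  { intro x. apply cderiv_minus; apply cderiv_mult; [apply Sct | apply Ss | apply Sst | apply Sc]. }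
  assert (pc : forall x, a <= x <= b -> (ct x = p x * c x)%C).
  { intros x Hx. unfold p.
    replace ((ct x * s1 x - st x * c1 x) * c x)%C with (ct x * (c x * s1 x) - c x * st x * c1 x)%C by ring.
    rewrite (R x Hx). replace (ct x * (c x * s1 x) - s x * ct x * c1 x)%C with (ct x * (c x * s1 x - c1 x * s x))%C by ring.
    rewrite W. ring. }
  assert (ps : forall x, a <= x <= b -> (st x = p x * s x)%C).
  { intros x Hx. unfold p.
    replace ((ct x * s1 x - st x * c1 x) * s x)%C with (s x * ct x * s1 x - st x * (c1 x * s x))%C by ring.
    rewrite <- (R x Hx). replace (c x * st x * s1 x - st x * (c1 x * s x))%C with (st x * (c x * s1 x - c1 x * s x))%C by ring.
    rewrite W. ring. }
  assert (R' : forall x, a < x < b -> (c1 x * st x + c x * st1 x = s1 x * ct x + s x * ct1 x)%C).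
  { intros x Hx. apply (cderiv_interval_ext (fun t => c t * st t)%C (fun t => s t * ct t)%C a b x); [exact Hx | | |].
    - intros t Ht. apply R. lra.
    - apply cderiv_mult; [apply Sc | apply Sst].
    - apply cderiv_mult; [apply Ss | apply Sct]. }
  assert (p2 : forall x, a < x < b -> (p x * p x = RtoC 1)%C).
  { intros x Hx.
    assert (pe : p x = (c x * st1 x - s x * ct1 x)%C).
    { unfold p. apply Ceq_minus. specialize (R' x Hx).
      replace (ct x * s1 x - st x * c1 x - (c x * st1 x - s x * ct1 x))%C
        with ((s1 x * ct x + s x * ct1 x) - (c1 x * st x + c x * st1 x))%C by ring.
      rewrite R'. ring. }
    rewrite pe at 2.
    replace (p x * (c x * st1 x - s x * ct1 x))%C with ((p x * c x) * st1 x - (p x * s x) * ct1 x)%C by ring.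
    rewrite <- pc, <- ps by lra. rewrite <- (Wt x). ring. }
  (* Differentiating [p * p = 1] gives [2 p p' = 0], and [p' = (p / 2) (2 p p')] because
     [p * p = 1]. *)
  assert (p0 : forall x, a < x < b -> cderiv p x (RtoC 0)).
  { intros x Hx.
    pose proof (cderiv_interval_ext (fun t => p t * p t)%C (fun _ => RtoC 1) a b x _ _ Hx p2
      (cderiv_mult _ _ _ _ _ (Dp x) (Dp x)) (cderiv_const _ x)) as E.
    set (d := ((ct1 x * s1 x + ct x * ((q x - lam) * s x)) - (st1 x * c1 x + st x * ((q x - lam) * c x)))%C) in *.
    apply cderiv_eq with d; [apply Dp |].
    specialize (p2 x Hx).
    replace d with ((RtoC 1 / RtoC 2) * p x * (d * p x + p x * d))%C.
    - rewrite E. ring.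
    - replace (RtoC 1 / RtoC 2 * p x * (d * p x + p x * d))%C with (d * (p x * p x))%C.
      + rewrite p2. ring.
      + field. }
  assert (p1 : forall x, a <= x <= b -> p x = RtoC 1).
  { intros x Hx. rewrite (const_of_cderiv_0 p a b p0 (ccont_cderiv _ _ Dp) x Hx).
    unfold p. rewrite cta, s1a, sta. ring. }
  assert (ec : forall x, a < x < b -> ct x = c x) by (intros x Hx; rewrite pc, p1 by lra; ring).
  assert (es : forall x, a < x < b -> st x = s x) by (intros x Hx; rewrite ps, p1 by lra; ring).
  assert (ec1 : forall x, a < x < b -> ct1 x = c1 x).
  { intros x Hx. apply (cderiv_interval_ext ct c a b x); [exact Hx | exact ec | apply Sct | apply Sc]. }
  assert (es1 : forall x, a < x < b -> st1 x = s1 x).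
  { intros x Hx. apply (cderiv_interval_ext st s a b x); [exact Hx | exact es | apply Sst | apply Ss]. }
  assert (ec2 : forall x, a < x < b -> ((qt x - lam) * ct x = (q x - lam) * c x)%C).
  { intros x Hx. apply (cderiv_interval_ext ct1 c1 a b x); [exact Hx | exact ec1 | apply Sct | apply Sc]. }
  assert (es2 : forall x, a < x < b -> ((qt x - lam) * st x = (q x - lam) * s x)%C).
  { intros x Hx. apply (cderiv_interval_ext st1 s1 a b x); [exact Hx | exact es1 | apply Sst | apply Ss]. }
  (* Both [(q - qt) c] and [(q - qt) s] vanish; combining them with the Wronskian, which is 1,
     isolates [q - qt]. *)
  assert (Z : forall x, a <= x <= b -> (q x - qt x = RtoC 0)%C).
  { apply ccont_zero_closed; [exact ab | now apply ccont_minus |].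
    intros x Hx. pose proof (ec2 x Hx) as A. pose proof (es2 x Hx) as B. rewrite ec in A by exact Hx. rewrite es in B by exact Hx.
    replace (q x - qt x)%C with ((q x - qt x) * (c x * s1 x - c1 x * s x))%C by (rewrite W; ring).
    replace ((q x - qt x) * (c x * s1 x - c1 x * s x))%C
      with (((q x - lam) * c x - (qt x - lam) * c x) * s1 x - c1 x * ((q x - lam) * s x - (qt x - lam) * s x))%C by ring.
    rewrite A, B. ring. }
  intros x Hx. apply Ceq_minus. now apply Z.
Qed.

(** The decay [exp (- k (x - a))] of [y] is cancelled exactly by the growth of the solution
    vanishing at [a]; what makes [H] tend to 0 is the extra factor [1 / k] in the bound for that
    solution. *)
Lemma borg_marchenko (q qt : R -> C) (a b M K k0 : R) : a < b -> ccont q -> ccont qt ->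
  (forall x, Cmod (q x) <= M) -> (forall x, Cmod (qt x) <= M) ->
  (forall k, k0 <= k -> exists y v yt vt,
     is_sol q (RtoC (- (k * k))) y v /\ is_sol qt (RtoC (- (k * k))) yt vt /\
     y a <> RtoC 0 /\ yt a <> RtoC 0 /\ (y a * vt a = v a * yt a)%C /\
     forall x, a <= x <= b -> Cmod (y x) <= K * exp (- (k * (x - a))) * Cmod (y a) /\
                             Cmod (yt x) <= K * exp (- (k * (x - a))) * Cmod (yt a)) ->
  forall x, a <= x <= b -> q x = qt x.
Proof.
  intros ab cq cqt HM HMt Hyp.
  destruct (fundamental_exists q M a cq HM) as (c & c1 & s & s1 & F).
  destruct (fundamental_exists qt M a cqt HMt) as (ct & ct1 & st & st1 & Ft).
  assert (HQ : forall x, a <= x <= b -> Cmod (q x) <= M) by (intros; apply HM).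
  assert (HQt : forall x, a <= x <= b -> Cmod (qt x) <= M) by (intros; apply HMt).
  assert (M0 : 0 <= M) by (apply Rle_trans with (2 := HM a); apply Cmod_ge_0).
  set (k1 := Rmax 1 k0). assert (k11 : 1 <= k1) by apply Rmax_l. assert (k10 : k0 <= k1) by apply Rmax_r.
  set (E := exp (M * (b - a))). assert (E0 : 0 < E) by apply exp_pos.
  assert (zero : forall x, a <= x <= b -> forall l, (c l x * st l x - s l x * ct l x = RtoC 0)%C).
  { intros x Hx.
    destruct (fundamental_order_half q a b M x _ _ _ _ F HQ Hx) as (o1 & _ & o2 & _).
    destruct (fundamental_order_half qt a b M x _ _ _ _ Ft HQt Hx) as (o3 & _ & o4 & _).
    destruct (fundamental_ereg q a b M x _ _ _ _ F HQ Hx) as (r1 & _ & r2 & _).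
    destruct (fundamental_ereg qt a b M x _ _ _ _ Ft HQt Hx) as (r3 & _ & r4 & _).
    set (H := fun l => (c l x * st l x - s l x * ct l x)%C).
    assert (oH : order_half H) by (apply order_half_minus; now apply order_half_mult).
    assert (rH : ereg H) by (apply ereg_minus; now apply ereg_mult).
    assert (decay : forall k, k1 <= k -> Cmod (H (RtoC (- (k * k)))) <= 2 * K * E / k).
    { intros k Hk. destruct (Hyp k ltac:(lra)) as (y & v & yt & vt & Sy & Syt & Ny & Nyt & W & B).
      set (lam := RtoC (- (k * k))) in *.
      destruct (fundamental_repr q a c c1 s s1 F lam y v x Sy) as [ey _].
      destruct (fundamental_repr qt a ct ct1 st st1 Ft lam yt vt x Syt) as [eyt _].
      assert (id : (y a * yt a * H lam = yt a * (y x * st lam x) - y a * (s lam x * yt x))%C).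
      { unfold H. rewrite ey, eyt. apply Ceq_minus.
        match goal with |- ?z = _ => replace z with ((y a * vt a - v a * yt a) * (s lam x * st lam x))%C by ring end.
        rewrite W. ring. }
      destruct (B x Hx) as [b1 b2].
      pose proof (fundamental_growth_neg q a b M x k c c1 s s1 F HQ Hx ltac:(lra)) as g1.
      pose proof (fundamental_growth_neg qt a b M x k ct ct1 st st1 Ft HQt Hx ltac:(lra)) as g2.
      fold lam in g1, g2. fold E in g1, g2.
      apply Cmod_gt_0 in Ny. apply Cmod_gt_0 in Nyt.
      set (Y := Cmod (y a)) in *. set (Yt := Cmod (yt a)) in *.
      set (em := exp (- (k * (x - a)))) in *. set (ep := exp (k * (x - a))) in *.
      assert (emep : em * ep = 1).
      { unfold em, ep. rewrite <- exp_plus. replace (- (k * (x - a)) + k * (x - a)) with 0 by ring. apply exp_0. }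
      assert (t1 : Cmod (y x) * Cmod (st lam x) <= K * em * Y * (ep * E / k)) by (apply Rmult_le_compat; try apply Cmod_ge_0; assumption).
      assert (t2 : Cmod (s lam x) * Cmod (yt x) <= ep * E / k * (K * em * Yt)) by (apply Rmult_le_compat; try apply Cmod_ge_0; assumption).
      apply (f_equal Cmod) in id. rewrite !Cmod_mult in id.
      apply Rmult_le_reg_l with (Y * Yt); [now apply Rmult_lt_0_compat |].
      fold Y Yt in id. rewrite id.
      apply Rle_trans with (1 := Cmod_triangle_minus _ _). rewrite !Cmod_mult. fold Y Yt.
      assert (u1 : Yt * (Cmod (y x) * Cmod (st lam x)) <= Yt * (K * em * Y * (ep * E / k))) by (apply Rmult_le_compat_l; lra).
      assert (u2 : Y * (Cmod (s lam x) * Cmod (yt x)) <= Y * (ep * E / k * (K * em * Yt))) by (apply Rmult_le_compat_l; lra).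
      replace (Yt * (K * em * Y * (ep * E / k))) with (Y * Yt * (K * E / k) * (em * ep)) in u1 by (field; lra).
      replace (Y * (ep * E / k * (K * em * Yt))) with (Y * Yt * (K * E / k) * (em * ep)) in u2 by (field; lra).
      rewrite emep in u1, u2.
      replace (Y * Yt * (2 * K * E / k)) with (2 * (Y * Yt * (K * E / k))) by (field; lra). lra. }
    assert (KE : 0 <= K * E).
    { pose proof (decay k1 ltac:(lra)) as d1. pose proof (Cmod_ge_0 (H (RtoC (- (k1 * k1))))).
      assert (0 <= 2 * K * E / k1 * k1) by (apply Rmult_le_pos; lra).
      replace (2 * K * E / k1 * k1) with (2 * K * E) in * by (field; lra). lra. }
    pose proof oH as [A [B [A0 [B0 Ho]]]].
    (* Three ranges: for [t >= 1] the energy bound, for [t] below [- k1^2] the decay just shown, and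
       between them the general growth bound on a bounded set. *)
    assert (bdd : forall t : R, Cmod (H (RtoC t)) <= 2 * (E * E) + A * exp (B * sqrt (2 + k1 * k1)) + 2 * K * E).
    { intro t.
      assert (p1 : 0 <= E * E) by nra.
      assert (p2 : 0 <= A * exp (B * sqrt (2 + k1 * k1))) by (apply Rmult_le_pos; [exact A0 | left; apply exp_pos]).
      destruct (Rle_dec 1 t) as [h1|h1].
      - destruct (fundamental_bounded_pos q a b M x t _ _ _ _ F HQ Hx h1) as [g1 g2].
        destruct (fundamental_bounded_pos qt a b M x t _ _ _ _ Ft HQt Hx h1) as [g3 g4].
        fold E in g1, g2, g3, g4. apply Rle_trans with (1 := Cmod_triangle_minus _ _). rewrite !Cmod_mult.
        assert (Cmod (c (RtoC t) x) * Cmod (st (RtoC t) x) <= E * E) by (apply Rmult_le_compat; try apply Cmod_ge_0; assumption).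
        assert (Cmod (s (RtoC t) x) * Cmod (ct (RtoC t) x) <= E * E) by (apply Rmult_le_compat; try apply Cmod_ge_0; assumption).
        lra.
      - destruct (Rle_dec (- (k1 * k1)) t) as [h2|h2].
        + apply Rle_trans with (A * exp (B * sqrt (2 + k1 * k1))); [| lra].
          apply Rle_trans with (1 := Ho _). apply Rmult_le_compat_l; [exact A0 |]. apply exp_mono.
          apply Rmult_le_compat_l; [exact B0 |]. apply sqrt_le_1_alt. rewrite Cmod_R.
          assert (Rabs t <= 1 + k1 * k1) by (apply Rabs_le; nra). lra.
        + set (k := sqrt (- t)). assert (kk : k * k = - t) by (apply sqrt_sqrt; nra).
          assert (kk1 : k1 <= k) by (apply sqr_le_reg; [apply sqrt_pos | lra]).
          pose proof (decay k kk1) as d. rewrite kk, Ropp_involutive in d.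
          assert (2 * K * E / k <= 2 * K * E) by (apply Rle_div_l; nra). lra. }
    pose proof (bounded_on_reals_const H _ (fun z => ereg_hol 2 H z rH) oH bdd) as cst.
    assert (H0 : H (RtoC 0) = RtoC 0).
    { apply Cmod_le_0_eq, Rle_0_of_all_eps. intros eps He.
      set (k := k1 + 2 * K * E / eps).
      assert (0 <= 2 * K * E / eps) by (apply Rmult_le_pos; [lra | left; now apply Rinv_0_lt_compat]).
      rewrite <- (cst (RtoC (- (k * k)))). apply Rle_trans with (1 := decay k ltac:(unfold k; lra)).
      apply Rle_div_l; [unfold k; lra |].
      apply Rle_trans with (eps * (2 * K * E / eps)); [right; field; lra |].
      apply Rmult_le_compat_l; unfold k; lra. }
    intro l. fold (H l). rewrite cst. exact H0. }
  (* The identity holds for all parameters, and a single one already determines the potential. *)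
  set (l := RtoC 0).
  destruct (F l) as (h1 & h2 & e1 & e2 & e3 & e4). destruct (Ft l) as (h1' & h2' & e1' & e2' & e3' & e4').
  apply (potential_from_ratio q qt l a b (c l) (c1 l) (s l) (s1 l) (ct l) (ct1 l) (st l) (st1 l)); auto.
  - intro x. apply (fundamental_wronskian q a c c1 s s1 F).
  - intro x. apply (fundamental_wronskian qt a ct ct1 st st1 Ft).
  - intros x Hx. apply Ceq_minus. now apply zero.
Qed.

(** * Calculus on the time scale *)

(** Retraction onto [[a, b]]: composing with it extends a function on the interval by constants to
    the whole line. *)
Definition clamp (a b x : R) : R := Rmax a (Rmin b x).

Lemma clamp_in (a b x : R) : a <= b -> a <= clamp a b x <= b.
Proof.
  intro ab. unfold clamp. split; [apply Rmax_l |]. apply Rmax_lub; [exact ab | apply Rmin_l].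
Qed.

Lemma clamp_id (a b x : R) : a <= x <= b -> clamp a b x = x.
Proof. intro Hx. unfold clamp. rewrite Rmin_right by lra. apply Rmax_right; lra. Qed.

Lemma clamp_lipschitz (a b x y : R) : Rabs (clamp a b x - clamp a b y) <= Rabs (x - y).
Proof.
  unfold clamp, Rmax, Rmin.
  repeat destruct Rle_dec; unfold Rabs; repeat destruct Rcase_abs; lra.
Qed.

Lemma ccont_eps (f : R -> C) :
  (forall x eps, 0 < eps -> exists d, 0 < d /\ forall t, Rabs (t - x) < d -> Cmod (f t - f x) <= eps) -> ccont f.
Proof.
  intro H.
  assert (K : forall x eps, 0 < eps -> exists d, d > 0 /\ forall t, D_x no_cond x t /\ Rdist t x < d ->
     Rabs (Re (f t) - Re (f x)) < eps /\ Rabs (Im (f t) - Im (f x)) < eps).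
  { intros x eps He. destruct (H x (eps / 2) ltac:(lra)) as [d [dp Hd]]. exists d. split; [exact dp |].
    intros t [_ Ht]. specialize (Hd t Ht).
    pose proof (re_le_Cmod (f t - f x)%C) as r. pose proof (im_le_Cmod (f t - f x)%C) as i.
    change (Re (f t - f x)) with (Re (f t) - Re (f x)) in r.
    change (Im (f t - f x)) with (Im (f t) - Im (f x)) in i. lra. }
  intro x; split; apply continuity_pt_filterlim; intros eps He; destruct (K x eps He) as [d [dp Hd]];
    exists d; (split; [exact dp |]); intros t Ht; apply (Hd t Ht).
Qed.

Lemma ccont_to_eps (f : R -> C) (x eps : R) : ccont f -> 0 < eps ->
  exists d, 0 < d /\ forall t, Rabs (t - x) < d -> Cmod (f t - f x) <= eps.
Proof.
  intros H He. destruct (H x) as [h1 h2].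
  destruct (proj2 (continuity_pt_filterlim _ _) h1 (eps / 2) ltac:(lra)) as [d1 [p1 H1]].
  destruct (proj2 (continuity_pt_filterlim _ _) h2 (eps / 2) ltac:(lra)) as [d2 [p2 H2]].
  exists (Rmin d1 d2). split; [now apply Rmin_glb_lt |]. intros t Ht.
  destruct (Req_dec x t) as [e|n].
  { subst t. replace (f x - f x)%C with (RtoC 0) by ring. rewrite Cmod_0. lra. }
  apply Rle_trans with (1 := Cmod_le_Rabs _).
  specialize (H1 t). specialize (H2 t). simpl in H1, H2. unfold Rdist in H1, H2.
  assert (a1 : Rabs (t - x) < d1) by (apply Rlt_le_trans with (1 := Ht); apply Rmin_l).
  assert (a2 : Rabs (t - x) < d2) by (apply Rlt_le_trans with (1 := Ht); apply Rmin_r).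
  assert (b1 : Rabs (Re (f t) - Re (f x)) < eps / 2) by (apply H1; repeat split; auto).
  assert (b2 : Rabs (Im (f t) - Im (f x)) < eps / 2) by (apply H2; repeat split; auto).
  change (Re (f t - f x)) with (Re (f t) - Re (f x)).
  change (Im (f t - f x)) with (Im (f t) - Im (f x)). lra.
Qed.

Lemma ccont_bounded (f : R -> C) (a b : R) : a <= b -> ccont f ->
  exists M, forall x, a <= x <= b -> Cmod (f x) <= M.
Proof.
  intros ab H.
  destruct (continuity_ab_maj (fun x => Cmod (f x)) a b ab) as [m [Hm _]].
  - intros x _ eps He. destruct (ccont_to_eps f x (eps / 2) H ltac:(lra)) as [d [dp Hd]].
    exists d. split; [exact dp |]. intros t [_ Ht]. simpl in *. unfold Rdist in *. specialize (Hd t Ht).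
    pose proof (Cmod_triangle_rev (f t) (f x)). pose proof (Cmod_triangle_rev (f x) (f t)).
    rewrite (Cmod_minus_sym (f x)) in *. apply Rabs_def1; lra.
  - exists (Cmod (f m)). exact Hm.
Qed.

Lemma delta_derive_ext (T : R -> Prop) (f g : R -> C) (t : R) (l : C) :
  (forall s, T s -> f s = g s) -> T (ts_jump T t) ->
  is_delta_derive T f t l -> is_delta_derive T g t l.
Proof.
  intros E J H eps He. destruct (H eps He) as [d [dp Hd]]. exists d. split; [exact dp |].
  intros s Ts Hs. rewrite <- E, <- E by assumption. now apply Hd.
Qed.

Lemma delta_derive_contin (T : R -> Prop) (f : R -> C) (t : R) (l : C) : T t ->
  is_delta_derive T f t l -> forall eps, 0 < eps -> exists d, 0 < d /\
    forall s, T s -> Rabs (s - t) < d -> Cmod (f s - f t) <= eps.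
Proof.
  intros Tt H eps He. set (u := ts_jump T t) in *.
  set (A := 2 * Rabs (u - t) + 1). assert (A1 : 1 <= A) by (unfold A; pose proof (Rabs_pos (u - t)); lra).
  assert (e0 : 0 < eps / (2 * A)) by (apply Rdiv_lt_0_compat; lra).
  destruct (H _ e0) as [d [dp Hd]]. fold u in Hd.
  pose proof (Cmod_ge_0 l).
  assert (e1 : 0 < eps / (2 * (Cmod l + 1))) by (apply Rdiv_lt_0_compat; lra).
  exists (Rmin (Rmin d 1) (eps / (2 * (Cmod l + 1)))). split; [repeat apply Rmin_glb_lt; lra |].
  intros s Ts Hs.
  assert (s1 : Rabs (s - t) < d).
  { apply Rlt_le_trans with (1 := Hs). apply Rle_trans with (1 := Rmin_l _ _). apply Rmin_l. }
  assert (s2 : Rabs (s - t) < 1).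
  { apply Rlt_le_trans with (1 := Hs). apply Rle_trans with (1 := Rmin_l _ _). apply Rmin_r. }
  assert (s3 : Rabs (s - t) < eps / (2 * (Cmod l + 1))).
  { apply Rlt_le_trans with (1 := Hs). apply Rmin_r. }
  apply Rlt_div_r in s3; [| lra].
  pose proof (Rabs_def2 _ _ s1) as s1'.
  pose proof (Hd s Ts ltac:(lra)) as h1. pose proof (Hd t Tt ltac:(lra)) as h2.
  (* The defining estimate is used at [s] and at [t] itself; their difference eliminates the value
     of [f] at the jump point. *)
  replace (f s - f t)%C
    with ((f u - f t - l * RtoC (u - t)) - (f u - f s - l * RtoC (u - s)) + l * RtoC (s - t))%C
    by (rewrite !RtoC_minus; ring).
  apply Rle_trans with (1 := Cmod_triangle _ _). rewrite Cmod_mult, Cmod_R.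
  pose proof (Cmod_triangle_minus (f u - f t - l * RtoC (u - t)) (f u - f s - l * RtoC (u - s))).
  assert (tr : Rabs (u - s) <= Rabs (u - t) + Rabs (s - t)).
  { replace (u - s) with ((u - t) - (s - t)) by ring. apply Rle_trans with (1 := Rabs_triang _ _).
    rewrite Rabs_Ropp. lra. }
  assert (eps / (2 * A) * Rabs (u - t) + eps / (2 * A) * Rabs (u - s) <= eps / 2).
  { rewrite <- Rmult_plus_distr_l. apply Rle_trans with (eps / (2 * A) * A).
    - apply Rmult_le_compat_l; [lra | unfold A; lra].
    - right; field; lra. }
  pose proof (Rabs_pos (s - t)). nra.
Qed.

(** The admissible choice [s = t] in the definition, for every [eps], forces equality. *)
Lemma delta_derive_jump (T : R -> Prop) (f : R -> C) (t : R) (l : C) : T t ->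
  is_delta_derive T f t l -> f (ts_jump T t) = (f t + l * RtoC (ts_jump T t - t))%C.
Proof.
  intros Tt H. set (u := ts_jump T t) in *. apply Ceq_minus, Cmod_le_0_eq, Rle_0_of_all_eps.
  intros eps He. set (A := Rabs (u - t) + 1). pose proof (Rabs_pos (u - t)).
  assert (e0 : 0 < eps / A) by (apply Rdiv_lt_0_compat; unfold A; lra).
  destruct (H _ e0) as [d [dp Hd]]. fold u in Hd. specialize (Hd t Tt ltac:(lra)).
  replace (f u - (f t + l * RtoC (u - t)))%C with (f u - f t - l * RtoC (u - t))%C by ring.
  apply Rle_trans with (1 := Hd). apply Rle_trans with (eps / A * A).
  - apply Rmult_le_compat_l; [lra | unfold A; lra].
  - right; field. unfold A; lra.
Qed.

Section TimeScale.

Variables (N : nat) (a b : nat -> R).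
Hypothesis hN : (2 <= N)%nat.
Hypothesis hab : forall k : nat, (1 <= k < N)%nat -> a k < b k /\ b k < a (S k) /\ a (S k) < b (S k).

Let T := time_scale N a b.

Lemma ts_ab (k : nat) : (1 <= k <= N)%nat -> a k < b k.
Proof.
  intro Hk. destruct (Nat.eq_dec k N) as [e|n].
  - subst k. destruct N as [|n]; [lia |]. apply (hab n). lia.
  - apply hab. lia.
Qed.

Lemma ts_ba_lt (i j : nat) : (1 <= i)%nat -> (i < j <= N)%nat -> b i < a j.
Proof.
  intros Hi. induction j as [|j IH]; intro Hj; [lia |].
  destruct (Nat.eq_dec i j) as [e|n].
  - subst j. apply hab. lia.
  - assert (b i < a j) by (apply IH; lia). pose proof (hab j ltac:(lia)). lra.
Qed.

Lemma ts_b_le (i j : nat) : (1 <= i)%nat -> (i <= j <= N)%nat -> b i <= b j.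
Proof.
  intros Hi Hj. destruct (Nat.eq_dec i j) as [e|n]; [subst; lra |].
  pose proof (ts_ba_lt i j Hi ltac:(lia)). pose proof (ts_ab j ltac:(lia)). lra.
Qed.

Lemma ts_unique (i j : nat) (x : R) : (1 <= i <= N)%nat -> (1 <= j <= N)%nat ->
  a i <= x <= b i -> a j <= x <= b j -> i = j.
Proof.
  intros Hi Hj xi xj. destruct (Nat.lt_trichotomy i j) as [h|[h|h]]; [| exact h |].
  - pose proof (ts_ba_lt i j ltac:(lia) ltac:(lia)). lra.
  - pose proof (ts_ba_lt j i ltac:(lia) ltac:(lia)). lra.
Qed.

Lemma ts_in (k : nat) (x : R) : (1 <= k <= N)%nat -> a k <= x <= b k -> T x.
Proof. intros Hk Hx. exists k. now split. Qed.

Lemma ts_isolated (k : nat) : (1 <= k <= N)%nat -> exists d, 0 < d /\ forall x s,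
  a k <= x <= b k -> T s -> Rabs (s - x) < d -> a k <= s <= b k.
Proof.
  intro Hk.
  assert (L : exists d, 0 < d /\ forall j, (1 <= j < k)%nat -> b j <= a k - d).
  { destruct (Nat.eq_dec k 1) as [e|n].
    - exists 1. split; [lra |]. intros; lia.
    - exists (a k - b (k - 1)%nat). pose proof (ts_ba_lt (k - 1) k ltac:(lia) ltac:(lia)).
      split; [lra |]. intros j Hj. pose proof (ts_b_le j (k - 1) ltac:(lia) ltac:(lia)). lra. }
  assert (U : exists d, 0 < d /\ forall j, (k < j <= N)%nat -> b k + d <= a j).
  { destruct (Nat.eq_dec k N) as [e|n].
    - exists 1. split; [lra |]. intros; lia.
    - exists (a (S k) - b k). pose proof (hab k ltac:(lia)). split; [lra |].
      intros j Hj. destruct (Nat.eq_dec j (S k)) as [e'|n']; [subst; lra |].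
      pose proof (ts_ba_lt (S k) j ltac:(lia) ltac:(lia)). lra. }
  destruct L as [d1 [p1 L]], U as [d2 [p2 U]]. exists (Rmin d1 d2). split; [now apply Rmin_glb_lt |].
  intros x s Hx [j [Hj Hs]] Hd.
  pose proof (Rmin_l d1 d2). pose proof (Rmin_r d1 d2). apply Rabs_def2 in Hd.
  destruct (Nat.lt_trichotomy j k) as [h|[h|h]].
  - specialize (L j ltac:(lia)). lra.
  - now subst j.
  - specialize (U j ltac:(lia)). lra.
Qed.

Lemma ts_lub : Lub_Rbar T = Finite (b N).
Proof.
  apply is_lub_Rbar_unique. split.
  - intros x [k [Hk Hx]]. simpl. pose proof (ts_b_le k N ltac:(lia) ltac:(lia)). lra.
  - intros u Hu. apply Hu. apply (ts_in N); [lia |]. pose proof (ts_ab N ltac:(lia)). lra.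
Qed.

Lemma ts_jump_end : ts_jump T (b N) = b N.
Proof. unfold ts_jump. rewrite ts_lub. simpl. destruct Req_EM_T as [e|n]; congruence. Qed.

Lemma ts_jump_dense (k : nat) (x : R) : (1 <= k <= N)%nat -> a k <= x < b k -> ts_jump T x = x.
Proof.
  intros Hk Hx. unfold ts_jump. rewrite ts_lub. simpl.
  pose proof (ts_b_le k N ltac:(lia) ltac:(lia)).
  destruct Req_EM_T as [e|n]; [lra |].
  rewrite (is_glb_Rbar_unique _ (Finite x)); [reflexivity |]. split.
  - intros s [_ Hs]. simpl. lra.
  - intros u Hu. destruct u as [u| |]; simpl; [| | exact I].
    + apply Rnot_lt_le. intro h.
      assert (m : x < Rmin u (b k)) by (apply Rmin_glb_lt; lra).
      assert (m1 : Rmin u (b k) <= u) by apply Rmin_l. assert (m2 : Rmin u (b k) <= b k) by apply Rmin_r.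
      specialize (Hu ((x + Rmin u (b k)) / 2)). simpl in Hu.
      assert (u <= (x + Rmin u (b k)) / 2).
      { apply Hu. split; [apply (ts_in k); [exact Hk | lra] | lra]. }
      lra.
    + specialize (Hu (b k)). simpl in Hu. apply Hu. split; [apply (ts_in k); [exact Hk | lra] | lra].
Qed.

Lemma ts_jump_gap (k : nat) : (1 <= k < N)%nat -> ts_jump T (b k) = a (S k).
Proof.
  intros Hk. unfold ts_jump. rewrite ts_lub. simpl.
  pose proof (ts_ba_lt k N ltac:(lia) ltac:(lia)). pose proof (ts_ab N ltac:(lia)).
  pose proof (hab k Hk).
  destruct Req_EM_T as [e|n]; [lra |].
  rewrite (is_glb_Rbar_unique _ (Finite (a (S k)))); [reflexivity |]. split.
  - intros s [[j [Hj Hs]] Hb]. simpl.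
    destruct (Nat.le_gt_cases j k) as [h|h].
    + pose proof (ts_b_le j k ltac:(lia) ltac:(lia)). lra.
    + destruct (Nat.eq_dec j (S k)) as [e'|n']; [subst; lra |].
      pose proof (ts_ba_lt (S k) j ltac:(lia) ltac:(lia)). lra.
  - intros u Hu. apply Hu. split; [apply (ts_in (S k)); [lia | lra] | lra].
Qed.

Lemma ts_jump_in (x : R) : T x -> T (ts_jump T x).
Proof.
  intros [k [Hk Hx]]. destruct (Rlt_dec x (b k)) as [h|h].
  - rewrite (ts_jump_dense k) by (auto; lra). now apply (ts_in k).
  - assert (x = b k) by lra. subst x. destruct (Nat.eq_dec k N) as [e|n].
    + subst k. rewrite ts_jump_end. now apply (ts_in N).
    + rewrite ts_jump_gap by lia. apply (ts_in (S k)); [lia |]. pose proof (hab k ltac:(lia)). lra.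
Qed.

Lemma delta_derive_unique (f : R -> C) (t : R) (l m : C) : T t ->
  is_delta_derive T f t l -> is_delta_derive T f t m -> l = m.
Proof.
  intros Tt H K. apply Ceq_minus, Cmod_le_0_eq, Rle_0_of_all_eps. intros eps He.
  destruct (H (eps / 2) ltac:(lra)) as [d [dp Hd]], (K (eps / 2) ltac:(lra)) as [e [ep Ke]].
  set (u := ts_jump T t) in *.
  (* A point of [T] near [t] other than the jump point: [t] itself if it is right-scattered,
     otherwise a neighbour inside its interval, taken on the left when [t] is the right endpoint. *)
  assert (W : exists s, T s /\ u <> s /\ t - Rmin d e < s < t + Rmin d e).
  { assert (r0 : 0 < Rmin d e) by now apply Rmin_glb_lt.
    destruct (Req_dec u t) as [eq|ne]; [| exists t; repeat split; auto; lra].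
    destruct Tt as [k [Hk Hx]]. pose proof (ts_ab k Hk). rewrite eq.
    destruct (Rlt_dec t (b k)) as [h|h].
    - set (r := Rmin (Rmin d e) (b k - t) / 2).
      assert (0 < Rmin (Rmin d e) (b k - t)) by (apply Rmin_glb_lt; lra).
      pose proof (Rmin_l (Rmin d e) (b k - t)). pose proof (Rmin_r (Rmin d e) (b k - t)).
      exists (t + r). split; [apply (ts_in k); [exact Hk | unfold r; lra] | unfold r; lra].
    - set (r := Rmin (Rmin d e) (t - a k) / 2).
      assert (0 < Rmin (Rmin d e) (t - a k)) by (apply Rmin_glb_lt; lra).
      pose proof (Rmin_l (Rmin d e) (t - a k)). pose proof (Rmin_r (Rmin d e) (t - a k)).
      exists (t - r). split; [apply (ts_in k); [exact Hk | unfold r; lra] | unfold r; lra]. }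
  destruct W as [s [Ts [ne Hs]]].
  pose proof (Rmin_l d e). pose proof (Rmin_r d e).
  specialize (Hd s Ts ltac:(lra)). specialize (Ke s Ts ltac:(lra)).
  apply Rmult_le_reg_r with (Rabs (u - s)); [apply Rabs_pos_lt; lra |].
  rewrite <- Cmod_R, <- Cmod_mult.
  replace ((l - m) * RtoC (u - s))%C with ((f u - f s - m * RtoC (u - s)) - (f u - f s - l * RtoC (u - s)))%C by ring.
  apply Rle_trans with (1 := Cmod_triangle_minus _ _). rewrite Cmod_R. lra.
Qed.

Lemma delta_derive_interior (f : R -> C) (k : nat) (x : R) (l : C) : (1 <= k <= N)%nat -> a k < x < b k ->
  is_delta_derive T f x l -> cderiv f x l.
Proof.
  intros Hk Hx H. apply cderiv_eps. intros eps He. destruct (H eps He) as [d [dp Hd]].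
  rewrite (ts_jump_dense k) in Hd by (auto; lra).
  exists (Rmin d (Rmin (x - a k) (b k - x))). split; [repeat apply Rmin_glb_lt; lra |].
  intros t Ht.
  pose proof (Rmin_l d (Rmin (x - a k) (b k - x))). pose proof (Rmin_r d (Rmin (x - a k) (b k - x))).
  pose proof (Rmin_l (x - a k) (b k - x)). pose proof (Rmin_r (x - a k) (b k - x)).
  pose proof (Rabs_def2 _ _ Ht).
  specialize (Hd t (ts_in k t Hk ltac:(lra)) ltac:(lra)).
  rewrite Rabs_minus_sym in Hd.
  replace (f x - f t - l * RtoC (x - t))%C with (- (f t - f x - l * RtoC (t - x)))%C in Hd
    by (rewrite !RtoC_minus; ring).
  now rewrite Cmod_opp in Hd.
Qed.

Lemma ccont_clamp (f : R -> C) (k : nat) : (1 <= k <= N)%nat ->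
  (forall x, T x -> forall eps, 0 < eps -> exists d, 0 < d /\
     forall s, T s -> Rabs (s - x) < d -> Cmod (f s - f x) <= eps) ->
  ccont (fun x => f (clamp (a k) (b k) x)).
Proof.
  intros Hk H. pose proof (ts_ab k Hk) as kab. apply ccont_eps. intros x eps He.
  assert (Tc : forall t, T (clamp (a k) (b k) t)) by (intro t; apply (ts_in k); [exact Hk | apply clamp_in; lra]).
  destruct (H _ (Tc x) eps He) as [d [dp Hd]].
  exists d. split; [exact dp |]. intros t Ht. apply Hd; [apply Tc |].
  apply Rle_lt_trans with (2 := Ht). apply clamp_lipschitz.
Qed.

Lemma continuous_on_eps (q : R -> C) : continuous_on T q ->
  forall x, T x -> forall eps, 0 < eps -> exists d, 0 < d /\
     forall s, T s -> Rabs (s - x) < d -> Cmod (q s - q x) <= eps.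
Proof.
  intros H x Tx eps He.
  assert (e2 : 0 < eps / 2) by lra.
  destruct (H x Tx (fun z => ball (q x) (mkposreal _ e2) z)) as [d Hd].
  { exists (mkposreal _ e2). intros z Hz. exact Hz. }
  exists d. split; [apply cond_pos |]. intros s Ts Hs.
  specialize (Hd s Hs Ts).
  apply Rle_trans with (1 := Cmod_le_Rabs _).
  destruct Hd as [h1 h2]. unfold ball in h1, h2; simpl in h1, h2.
  unfold AbsRing_ball, abs, minus, plus, opp in h1, h2; simpl in h1, h2.
  unfold Re, Im; simpl. lra.
Qed.

(** * The equation on the time scale *)

Section Equation.

Variables (q : R -> C) (lam : C).

Lemma solution_extract (y : R -> C) : is_solution T q lam y ->
  let v := delta_derive T y in
  (forall x, T x -> is_delta_derive T y x (v x)) /\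
  (forall x, T x -> is_delta_derive T v x ((q x - lam) * y (ts_jump T x))%C).
Proof.
  intros (h1 & h2 & h3) v.
  assert (E : forall f x, ex_delta_derive T f x -> is_delta_derive T f x (delta_derive T f x)).
  { intros f x He. unfold delta_derive. now apply epsilon_spec. }
  split; intros x Tx; [now apply E, h1 |].
  replace ((q x - lam) * y (ts_jump T x))%C with (delta_derive T v x); [now apply E, h2 |].
  specialize (h3 x Tx). fold v in h3.
  replace (delta_derive T v x) with (q x * y (ts_jump T x) - (- delta_derive T v x + q x * y (ts_jump T x)))%C by ring.
  rewrite h3. ring.
Qed.

Lemma solution_intro (y v : R -> C) :
  (forall x, T x -> is_delta_derive T y x (v x)) ->
  (forall x, T x -> is_delta_derive T v x ((q x - lam) * y (ts_jump T x))%C) ->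
  is_solution T q lam y /\ forall x, T x -> delta_derive T y x = v x.
Proof.
  intros h1 h2.
  assert (E : forall f x l, T x -> is_delta_derive T f x l -> delta_derive T f x = l).
  { intros f x l Tx H. apply (delta_derive_unique f x); [exact Tx | | exact H].
    unfold delta_derive. apply epsilon_spec. now exists l. }
  assert (Ev : forall x, T x -> delta_derive T y x = v x) by (intros x Tx; apply E; auto).
  assert (h2' : forall x, T x -> is_delta_derive T (delta_derive T y) x ((q x - lam) * y (ts_jump T x))%C).
  { intros x Tx. apply delta_derive_ext with v; [intros s Ts; symmetry; now apply Ev | now apply ts_jump_in | now apply h2]. }
  split; [| exact Ev]. split; [| split].
  - intros x Tx. exists (v x). now apply h1.
  - intros x Tx. eexists. now apply h2'.
  - intros x Tx. rewrite (E _ x _ Tx (h2' x Tx)). ring.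
Qed.

(** The Wronskian has derivative 0 in the interior, and continuity along [T] carries its value to
    the endpoints. At a right-scattered [b k] the Delta-derivative of [v] is a difference quotient
    across the gap, so differentiation there would be of no use. *)
Lemma solution_wronskian (y z w : R -> C) (k : nat) : (1 <= k <= N)%nat -> is_solution T q lam y ->
  is_sol (fun x => q (clamp (a k) (b k) x)) lam z w ->
  (y (b k) * w (b k) - delta_derive T y (b k) * z (b k) =
   y (a k) * w (a k) - delta_derive T y (a k) * z (a k))%C.
Proof.
  intros Hk Sy Sz. set (v := delta_derive T y).
  destruct (solution_extract y Sy) as [d1 d2]. fold v in d1, d2.
  pose proof (ts_ab k Hk) as kab.
  set (cl := clamp (a k) (b k)).
  assert (cy : ccont (fun x => y (cl x))).
  { apply ccont_clamp; [exact Hk |]. intros x Tx. exact (delta_derive_contin T y x _ Tx (d1 x Tx)). }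
  assert (cv : ccont (fun x => v (cl x))).
  { apply ccont_clamp; [exact Hk |]. intros x Tx. exact (delta_derive_contin T v x _ Tx (d2 x Tx)). }
  destruct (is_sol_ccont _ _ _ _ Sz) as [cz cw].
  assert (K : forall x, a k <= x <= b k ->
    (y (cl x) * w x - v (cl x) * z x = y (cl (a k)) * w (a k) - v (cl (a k)) * z (a k))%C).
  { apply (const_of_cderiv_0 (fun x => y (cl x) * w x - v (cl x) * z x)%C (a k) (b k)).
    - intros x Hx.
      assert (Tx : T x) by (apply (ts_in k); [exact Hk | lra]).
      assert (loc : forall f : R -> C, locally x (fun t => f t = f (cl t))).
      { intro f. assert (r0 : 0 < Rmin (x - a k) (b k - x)) by (apply Rmin_glb_lt; lra).
        exists (mkposreal _ r0). intros t Ht. unfold ball in Ht; simpl in Ht.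
        unfold AbsRing_ball, abs, minus, plus, opp in Ht; simpl in Ht.
        pose proof (Rmin_l (x - a k) (b k - x)). pose proof (Rmin_r (x - a k) (b k - x)).
        apply Rabs_def2 in Ht. unfold cl. rewrite clamp_id; [reflexivity | lra]. }
      assert (Dy : cderiv (fun t => y (cl t)) x (v x)).
      { apply cderiv_ext_loc with y; [apply loc |]. apply (delta_derive_interior y k); auto. }
      assert (Dv : cderiv (fun t => v (cl t)) x ((q x - lam) * y x)%C).
      { apply cderiv_ext_loc with v; [apply loc |].
        pose proof (delta_derive_interior v k x _ Hk Hx (d2 x Tx)) as D.
        rewrite (ts_jump_dense k) in D by (auto; lra). exact D. }
      destruct Sz as [z1 z2]. eapply cderiv_eq.
      + apply cderiv_minus; apply cderiv_mult; [exact Dy | apply z2 | exact Dv | apply z1].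
      + cbv beta. unfold cl. rewrite (clamp_id (a k) (b k) x) by lra. ring.
    - apply ccont_minus; now apply ccont_mult. }
  pose proof (K (b k) ltac:(lra)) as Kb.
  unfold cl in Kb. rewrite !clamp_id in Kb by lra. exact Kb.
Qed.

Lemma solution_gap (y : R -> C) (k : nat) : (1 <= k < N)%nat -> is_solution T q lam y ->
  let d := RtoC (a (S k) - b k) in
  y (a (S k)) = (y (b k) + d * delta_derive T y (b k))%C /\
  delta_derive T y (a (S k)) = (delta_derive T y (b k) + d * (q (b k) - lam) * y (a (S k)))%C.
Proof.
  intros Hk Sy d. destruct (solution_extract y Sy) as [d1 d2].
  assert (Tb : T (b k)) by (apply (ts_in k); [lia |]; pose proof (hab k Hk); lra).
  pose proof (delta_derive_jump T y (b k) _ Tb (d1 _ Tb)) as j1.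
  pose proof (delta_derive_jump T _ (b k) _ Tb (d2 _ Tb)) as j2.
  rewrite (ts_jump_gap k Hk) in j1, j2. fold d in j1, j2. split.
  - rewrite j1. ring.
  - rewrite j2. ring.
Qed.

(* Left-dense points need only the classical derivative, right-scattered ones only continuity. *)
Lemma delta_derive_piece (f g : R -> C) (k : nat) (x : R) (l : C) : (1 <= k <= N)%nat -> a k <= x <= b k ->
  (forall s, a k <= s <= b k -> f s = g s) -> ccont g ->
  (ts_jump T x = x -> cderiv g x l) ->
  (ts_jump T x <> x -> f (ts_jump T x) = (f x + l * RtoC (ts_jump T x - x))%C) ->
  is_delta_derive T f x l.
Proof.
  intros Hk Hx E cg Hd Hs eps He. set (u := ts_jump T x) in *.
  destruct (ts_isolated k Hk) as [d0 [p0 iso]].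
  assert (near : forall s, T s -> Rabs (s - x) < d0 -> f s = g s).
  { intros s Ts Hs'. apply E. exact (iso x s Hx Ts Hs'). }
  destruct (Req_dec u x) as [eq|ne].
  - pose proof (proj1 (cderiv_eps g x l) (Hd eq) eps He) as [d [dp D]].
    exists (Rmin d d0). split; [now apply Rmin_glb_lt |]. intros s Ts Hs'.
    pose proof (Rmin_l d d0). pose proof (Rmin_r d d0).
    assert (sx : Rabs (s - x) < Rmin d d0) by (apply Rabs_def1; lra).
    rewrite eq, (near s Ts) by lra. rewrite (E x Hx).
    specialize (D s ltac:(lra)). rewrite Rabs_minus_sym.
    replace (g x - g s - l * RtoC (x - s))%C with (- (g s - g x - l * RtoC (s - x)))%C by (rewrite !RtoC_minus; ring).
    now rewrite Cmod_opp.
  - specialize (Hs ne). set (h := Rabs (u - x)). assert (h0 : 0 < h) by (apply Rabs_pos_lt; lra).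
    destruct (ccont_to_eps g x (eps * h / 4) cg) as [d [dp D]]; [nra |].
    pose proof (Cmod_ge_0 l).
    assert (q0 : 0 < eps * h / (4 * (Cmod l + 1))) by (apply Rdiv_lt_0_compat; [nra | lra]).
    set (m := Rmin (Rmin d d0) (Rmin (h / 2) (eps * h / (4 * (Cmod l + 1))))).
    assert (m0 : 0 < m) by (repeat apply Rmin_glb_lt; lra).
    assert (mm : m <= d /\ m <= d0 /\ m <= h / 2 /\ m <= eps * h / (4 * (Cmod l + 1))).
    { unfold m. pose proof (Rmin_l (Rmin d d0) (Rmin (h / 2) (eps * h / (4 * (Cmod l + 1))))).
      pose proof (Rmin_r (Rmin d d0) (Rmin (h / 2) (eps * h / (4 * (Cmod l + 1))))).
      pose proof (Rmin_l d d0). pose proof (Rmin_r d d0).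
      pose proof (Rmin_l (h / 2) (eps * h / (4 * (Cmod l + 1)))).
      pose proof (Rmin_r (h / 2) (eps * h / (4 * (Cmod l + 1)))). lra. }
    exists m. split; [exact m0 |]. intros s Ts Hs'.
    assert (sx : Rabs (s - x) < m) by (apply Rabs_def1; lra).
    specialize (D s ltac:(lra)).
    assert (s4 : Rabs (s - x) < eps * h / (4 * (Cmod l + 1))) by lra.
    apply Rlt_div_r in s4; [| lra].
    rewrite Hs, (near s Ts), (E x Hx) by lra.
    replace (g x + l * RtoC (u - x) - g s - l * RtoC (u - s))%C
      with (l * RtoC (s - x) - (g s - g x))%C by (rewrite !RtoC_minus; ring).
    apply Rle_trans with (1 := Cmod_triangle_minus _ _). rewrite Cmod_mult, Cmod_R.
    assert (us : h / 2 <= Rabs (u - s)).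
    { unfold h in *. pose proof (Rabs_triang (u - s) (s - x)) as t.
      replace (u - s + (s - x)) with (u - x) in t by ring. lra. }
    assert (eps * (h / 2) <= eps * Rabs (u - s)) by (apply Rmult_le_compat_l; lra).
    pose proof (Rabs_pos (s - x)). nra.
Qed.

End Equation.

End TimeScale.

(** * Solutions on the time scale *)

Section Solutions.

Variables (N : nat) (a b : nat -> R).
Hypothesis hN : (2 <= N)%nat.
Hypothesis hab : forall k : nat, (1 <= k < N)%nat -> a k < b k /\ b k < a (S k) /\ a (S k) < b (S k).

Let T := time_scale N a b.

Definition clamped (q : R -> C) (k : nat) (x : R) : C := q (clamp (a k) (b k) x).

Definition fundamental_family (q : R -> C) (c c1 s s1 : nat -> C -> R -> C) : Prop :=
  forall k, (1 <= k <= N)%nat -> fundamental (clamped q k) (a k) (c k) (c1 k) (s k) (s1 k).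

Lemma clamped_ccont (q : R -> C) (k : nat) : continuous_on T q -> (1 <= k <= N)%nat -> ccont (clamped q k).
Proof.
  intros hq Hk. apply (ccont_clamp N a b hN hab q k Hk). exact (continuous_on_eps N a b q hq).
Qed.

Lemma clamped_bounded (q : R -> C) (k : nat) : continuous_on T q -> (1 <= k <= N)%nat ->
  exists M, forall x, Cmod (clamped q k x) <= M.
Proof.
  intros hq Hk. pose proof (ts_ab N a b hN hab k Hk).
  destruct (ccont_bounded (clamped q k) (a k) (b k) ltac:(lra) (clamped_ccont q k hq Hk)) as [M HM].
  exists M. intro x. specialize (HM (clamp (a k) (b k) x) (clamp_in (a k) (b k) x ltac:(lra))).
  unfold clamped in *. now rewrite (clamp_id (a k) (b k) (clamp (a k) (b k) x)) in HM by (apply clamp_in; lra).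
Qed.

Lemma fundamental_family_exists (q : R -> C) : continuous_on T q ->
  exists c c1 s s1, fundamental_family q c c1 s s1.
Proof.
  intro hq.
  destruct (choice (fun k (F : (C -> R -> C) * (C -> R -> C) * (C -> R -> C) * (C -> R -> C)) =>
    (1 <= k <= N)%nat -> fundamental (clamped q k) (a k) (fst (fst (fst F))) (snd (fst (fst F))) (snd (fst F)) (snd F)))
    as [F HF].
  - intro k. destruct (classic (1 <= k <= N)%nat) as [Hk|Hk].
    + destruct (clamped_bounded q k hq Hk) as [M HM].
      destruct (fundamental_exists (clamped q k) M (a k) (clamped_ccont q k hq Hk) HM) as (c & c1 & s & s1 & H).
      exists (c, c1, s, s1). now intros _.
    + exists (fun _ _ => RtoC 0, fun _ _ => RtoC 0, fun _ _ => RtoC 0, fun _ _ => RtoC 0). tauto.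
  - exists (fun k => fst (fst (fst (F k)))), (fun k => snd (fst (fst (F k)))), (fun k => snd (fst (F k))), (fun k => snd (F k)).
    exact HF.
Qed.

Variables (q : R -> C) (c c1 s s1 : nat -> C -> R -> C).
Hypothesis hq : continuous_on T q.
Hypothesis F : fundamental_family q c c1 s s1.

Definition gap (k : nat) : C := RtoC (a (S k) - b k).

Definition piece (p : C * C) (k : nat) (lam : C) (x : R) : C := (fst p * c k lam x + snd p * s k lam x)%C.
Definition piece1 (p : C * C) (k : nat) (lam : C) (x : R) : C := (fst p * c1 k lam x + snd p * s1 k lam x)%C.

Lemma piece_sol (p : C * C) (k : nat) (lam : C) : (1 <= k <= N)%nat ->
  is_sol (clamped q k) lam (piece p k lam) (piece1 p k lam) /\
  piece p k lam (a k) = fst p /\ piece1 p k lam (a k) = snd p.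
Proof.
  intro Hk. destruct (F k Hk lam) as (h1 & h2 & e1 & e2 & e3 & e4).
  split; [now apply is_sol_lin |]. unfold piece, piece1. rewrite e1, e2, e3, e4. split; ring.
Qed.

(** Shifted index: the value at [n] is the pair of initial data at [a (S n)]. *)
Fixpoint forward_data (p : C * C) (lam : C) (n : nat) : C * C :=
  match n with
  | O => p
  | S m =>
      let r := forward_data p lam m in
      let Y := (piece r (S m) lam (b (S m)) + gap (S m) * piece1 r (S m) lam (b (S m)))%C in
      (Y, (piece1 r (S m) lam (b (S m)) + gap (S m) * (q (b (S m)) - lam) * Y)%C)
  end.

Lemma solution_exists (p : C * C) (lam : C) : exists y, is_solution T q lam y /\
  y (a 1%nat) = fst p /\ delta_derive T y (a 1%nat) = snd p.
Proof.
  destruct (choice (fun x k => T x -> (1 <= k <= N)%nat /\ a k <= x <= b k)) as [idx Hidx].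
  { intro x. destruct (classic (T x)) as [[k Hk]|n]; [exists k; now intros _ | exists O; tauto]. }
  set (D := fun k => forward_data p lam (k - 1)).
  set (y := fun x => piece (D (idx x)) (idx x) lam x). set (v := fun x => piece1 (D (idx x)) (idx x) lam x).
  assert (idx_eq : forall k x, (1 <= k <= N)%nat -> a k <= x <= b k -> idx x = k).
  { intros k x Hk Hx. destruct (Hidx x (ex_intro _ k (conj Hk Hx))) as [Hi Hxi].
    exact (ts_unique N a b hN hab _ _ x Hi Hk Hxi Hx). }
  assert (yE : forall k x, (1 <= k <= N)%nat -> a k <= x <= b k -> y x = piece (D k) k lam x).
  { intros k x Hk Hx. unfold y. now rewrite (idx_eq k x Hk Hx). }
  assert (vE : forall k x, (1 <= k <= N)%nat -> a k <= x <= b k -> v x = piece1 (D k) k lam x).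
  { intros k x Hk Hx. unfold v. now rewrite (idx_eq k x Hk Hx). }
  assert (jump : forall k x, (1 <= k <= N)%nat -> a k <= x <= b k -> ts_jump T x <> x ->
    (1 <= k < N)%nat /\ x = b k /\ ts_jump T x = a (S k)).
  { intros k x Hk Hx ne. destruct (Rlt_dec x (b k)) as [h|h].
    - exfalso. apply ne. apply (ts_jump_dense N a b hN hab k); [exact Hk | lra].
    - assert (e : x = b k) by lra. destruct (Nat.eq_dec k N) as [eN|n].
      + exfalso. apply ne. rewrite e, eN. exact (ts_jump_end N a b hN hab).
      + split; [lia |]. split; [exact e |]. rewrite e. apply (ts_jump_gap N a b hN hab). lia. }
  assert (next : forall k, (1 <= k < N)%nat ->
    y (a (S k)) = (y (b k) + gap k * v (b k))%C /\
    v (a (S k)) = (v (b k) + gap k * (q (b k) - lam) * y (a (S k)))%C).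
  { intros k Hk. pose proof (hab k Hk).
    rewrite (yE (S k) (a (S k))), (vE (S k) (a (S k))), (yE k (b k)), (vE k (b k)) by (lia || lra).
    destruct (piece_sol (D (S k)) (S k) lam ltac:(lia)) as (_ & p1 & p2). rewrite p1, p2.
    unfold D. replace (S k - 1)%nat with (S (k - 1)) by lia. simpl.
    replace (S (k - 1)) with k by lia. split; reflexivity. }
  destruct (solution_intro N a b hN hab q lam y v) as [Sy Ev].
  - intros x [k [Hk Hx]]. destruct (piece_sol (D k) k lam Hk) as (ps & _ & _).
    apply (delta_derive_piece N a b hN hab y (piece (D k) k lam) k x); try assumption.
    + intros t Ht. now apply yE.
    + exact (proj1 (is_sol_ccont _ _ _ _ ps)).
    + intros _. rewrite (vE k x Hk Hx). apply ps.
    + intro ne. destruct (jump k x Hk Hx ne) as (Hk' & ex & ej). fold T. rewrite ej, ex.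
      rewrite (proj1 (next k Hk')). unfold gap. ring.
  - intros x [k [Hk Hx]]. destruct (piece_sol (D k) k lam Hk) as (ps & _ & _).
    apply (delta_derive_piece N a b hN hab v (piece1 (D k) k lam) k x); try assumption.
    + intros t Ht. now apply vE.
    + exact (proj2 (is_sol_ccont _ _ _ _ ps)).
    + intro e. rewrite e, (yE k x Hk Hx). destruct ps as [_ ps]. eapply cderiv_eq; [apply ps |].
      unfold clamped. now rewrite clamp_id.
    + intro ne. destruct (jump k x Hk Hx ne) as (Hk' & ex & ej). fold T. rewrite ej, ex.
      rewrite (proj2 (next k Hk')). unfold gap. ring.
  - exists y. split; [exact Sy |].
    assert (H1 : (1 <= 1 <= N)%nat) by lia. pose proof (ts_ab N a b hN hab 1 H1).
    destruct (piece_sol (D 1%nat) 1 lam H1) as (_ & p1 & p2).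
    split.
    + rewrite (yE 1%nat) by (lia || lra). exact p1.
    + rewrite Ev by (exists 1%nat; split; [lia | lra]). rewrite (vE 1%nat) by (lia || lra). exact p2.
Qed.

(* Data of the solution vanishing at b_N: bdata n at b_(N-n), adata n at a_(N-n). *)
Definition transfer_inv (k : nat) (lam : C) (p : C * C) : C * C :=
  (s1 k lam (b k) * fst p - s k lam (b k) * snd p, c k lam (b k) * snd p - c1 k lam (b k) * fst p)%C.

(** The jump relations of [solution_gap] solved for the data at [b k]. *)
Definition gap_inv (k : nat) (lam : C) (p : C * C) : C * C :=
  (fst p - gap k * (snd p - gap k * (q (b k) - lam) * fst p),
   snd p - gap k * (q (b k) - lam) * fst p)%C.

Fixpoint bdata (n : nat) (lam : C) : C * C :=
  match n with
  | O => (RtoC 0, (- RtoC 1)%C)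
  | S m => gap_inv (N - S m) lam (transfer_inv (N - m) lam (bdata m lam))
  end.

Definition adata (n : nat) (lam : C) : C * C := transfer_inv (N - n) lam (bdata n lam).

Lemma transfer_inv_sol (k : nat) (lam : C) (p : C * C) : (1 <= k <= N)%nat ->
  piece (transfer_inv k lam p) k lam (b k) = fst p /\ piece1 (transfer_inv k lam p) k lam (b k) = snd p.
Proof.
  intro Hk. pose proof (fundamental_wronskian _ _ _ _ _ _ (F k Hk) lam (b k)) as W.
  unfold piece, piece1, transfer_inv. simpl fst. simpl snd. split.
  - replace (fst p) with (fst p * (c k lam (b k) * s1 k lam (b k) - c1 k lam (b k) * s k lam (b k)))%C at 3
      by (rewrite W; ring). ring.
  - replace (snd p) with (snd p * (c k lam (b k) * s1 k lam (b k) - c1 k lam (b k) * s k lam (b k)))%C at 3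
      by (rewrite W; ring). ring.
Qed.

(** The Wronskian of [y] with the data of psi is [- y (b N)] at [b N] and is preserved by intervals
    and gaps. This holds for every solution, hence for the ones selected by [epsilon] in [S_sol] and
    [C_sol]. *)
Lemma solution_adata (y : R -> C) (lam : C) : is_solution T q lam y -> forall n, (n < N)%nat ->
  (y (a (N - n)%nat) * snd (adata n lam) - delta_derive T y (a (N - n)%nat) * fst (adata n lam) = - y (b N))%C.
Proof.
  intros Sy.
  assert (step : forall n, (n < N)%nat ->
    (y (b (N - n)%nat) * snd (bdata n lam) - delta_derive T y (b (N - n)%nat) * fst (bdata n lam) = - y (b N))%C ->
    (y (a (N - n)%nat) * snd (adata n lam) - delta_derive T y (a (N - n)%nat) * fst (adata n lam) = - y (b N))%C).
  { intros n Hn H. assert (Hk : (1 <= N - n <= N)%nat) by lia.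
    destruct (piece_sol (adata n lam) (N - n) lam Hk) as (ps & p1 & p2).
    destruct (transfer_inv_sol (N - n) lam (bdata n lam) Hk) as (t1 & t2). fold (adata n lam) in t1, t2.
    pose proof (solution_wronskian N a b hN hab q lam y _ _ (N - n) Hk Sy ps) as W.
    rewrite p1, p2, t1, t2 in W. fold T in W. rewrite <- W. exact H. }
  induction n as [|n IH]; intro Hn; apply step; try exact Hn.
  - simpl. replace (N - 0)%nat with N by lia. ring.
  - rewrite <- (IH ltac:(lia)).
    assert (Hk : (1 <= N - S n < N)%nat) by lia.
    destruct (solution_gap N a b hN hab q lam y (N - S n) Hk Sy) as [g1 g2].
    replace (S (N - S n)) with (N - n)%nat in g1, g2 by lia. fold T in g1, g2.
    rewrite g2. cbn [bdata]. fold (adata n lam). unfold gap_inv. simpl fst; simpl snd.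
    unfold gap. replace (S (N - S n)) with (N - n)%nat by lia.
    rewrite g1. ring.
Qed.

Lemma Delta0_eq (lam : C) : Delta0 N a b q lam = fst (adata (N - 1) lam).
Proof.
  unfold Delta0, S_sol. cbv zeta.
  destruct (epsilon_spec (inhabits (fun _ : R => RtoC 0))
    (fun y => is_solution T q lam y /\ y (a 1%nat) = RtoC 0 /\ delta_derive T y (a 1%nat) = RtoC 1)
    (solution_exists (RtoC 0, RtoC 1) lam)) as (Sy & y0 & y1).
  fold T. set (y := epsilon _ _) in *.
  pose proof (solution_adata y lam Sy (N - 1) ltac:(lia)) as W.
  replace (N - (N - 1))%nat with 1%nat in W by lia. rewrite y0, y1 in W.
  replace (y (b N)) with (- - y (b N))%C by ring. rewrite <- W. ring.
Qed.

Lemma Delta1_eq (lam : C) : Delta1 N a b q lam = (- snd (adata (N - 1) lam))%C.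
Proof.
  unfold Delta1, C_sol. cbv zeta.
  destruct (epsilon_spec (inhabits (fun _ : R => RtoC 0))
    (fun y => is_solution T q lam y /\ y (a 1%nat) = RtoC 1 /\ delta_derive T y (a 1%nat) = RtoC 0)
    (solution_exists (RtoC 1, RtoC 0) lam)) as (Sy & y0 & y1).
  fold T. set (y := epsilon _ _) in *.
  pose proof (solution_adata y lam Sy (N - 1) ltac:(lia)) as W.
  replace (N - (N - 1))%nat with 1%nat in W by lia. rewrite y0, y1 in W.
  replace (y (b N)) with (- - y (b N))%C by ring. rewrite <- W. ring.
Qed.

(** * Growth and asymptotics of the data of psi *)

Definition nice (f : C -> C) : Prop := ereg f /\ order_half f.

Lemma nice_mult (f g : C -> C) : nice f -> nice g -> nice (fun l => f l * g l)%C.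
Proof. intros [a1 a2] [b1 b2]; split; [now apply ereg_mult | now apply order_half_mult]. Qed.

Lemma nice_minus (f g : C -> C) : nice f -> nice g -> nice (fun l => f l - g l)%C.
Proof. intros [a1 a2] [b1 b2]; split; [now apply ereg_minus | now apply order_half_minus]. Qed.

Lemma nice_const (k : C) : nice (fun _ => k).
Proof. split; [apply ereg_const | apply order_half_const]. Qed.

Lemma nice_id : nice (fun l => l).
Proof. split; [apply ereg_id | apply order_half_id]. Qed.

Lemma nice_transfer (k : nat) : (1 <= k <= N)%nat ->
  nice (fun l => c k l (b k)) /\ nice (fun l => c1 k l (b k)) /\
  nice (fun l => s k l (b k)) /\ nice (fun l => s1 k l (b k)).
Proof.
  intro Hk. destruct (clamped_bounded q k hq Hk) as [M HM]. pose proof (ts_ab N a b hN hab k Hk).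
  assert (HQ : forall t, a k <= t <= b k -> Cmod (clamped q k t) <= M) by (intros; apply HM).
  destruct (fundamental_order_half _ (a k) (b k) M (b k) _ _ _ _ (F k Hk) HQ ltac:(lra)) as (o1 & o2 & o3 & o4).
  destruct (fundamental_ereg _ (a k) (b k) M (b k) _ _ _ _ (F k Hk) HQ ltac:(lra)) as (r1 & r2 & r3 & r4).
  unfold nice. tauto.
Qed.

Lemma nice_transfer_inv (k : nat) (p : C -> C * C) : (1 <= k <= N)%nat ->
  nice (fun l => fst (p l)) -> nice (fun l => snd (p l)) ->
  nice (fun l => fst (transfer_inv k l (p l))) /\ nice (fun l => snd (transfer_inv k l (p l))).
Proof.
  intros Hk p1 p2. destruct (nice_transfer k Hk) as (n1 & n2 & n3 & n4).
  unfold transfer_inv; simpl fst; simpl snd. split; apply nice_minus; now apply nice_mult.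
Qed.

Lemma nice_gap_inv (k : nat) (p : C -> C * C) :
  nice (fun l => fst (p l)) -> nice (fun l => snd (p l)) ->
  nice (fun l => fst (gap_inv k l (p l))) /\ nice (fun l => snd (gap_inv k l (p l))).
Proof.
  intros p1 p2.
  assert (n2 : nice (fun l => snd (p l) - gap k * (q (b k) - l) * fst (p l))%C).
  { apply nice_minus; [exact p2 |]. apply (nice_mult (fun l => gap k * (q (b k) - l))%C); [| exact p1].
    apply (nice_mult (fun _ => gap k)); [apply nice_const |].
    apply (nice_minus (fun _ => q (b k))); [apply nice_const | apply nice_id]. }
  unfold gap_inv; simpl fst; simpl snd. split; [| exact n2].
  apply nice_minus; [exact p1 |]. apply (nice_mult (fun _ => gap k)); [apply nice_const | exact n2].
Qed.

Lemma nice_adata (n : nat) : (n < N)%nat -> nice (fun l => fst (adata n l)) /\ nice (fun l => snd (adata n l)).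
Proof.
  intro Hn.
  assert (B : nice (fun l => fst (bdata n l)) /\ nice (fun l => snd (bdata n l))).
  { induction n as [|n IH].
    - simpl. split; apply nice_const.
    - destruct (IH ltac:(lia)) as [b1 b2].
      destruct (nice_transfer_inv (N - n) (bdata n) ltac:(lia) b1 b2) as [t1 t2].
      exact (nice_gap_inv (N - S n) (fun l => transfer_inv (N - n) l (bdata n l)) t1 t2). }
  exact (nice_transfer_inv (N - n) (bdata n) ltac:(lia) (proj1 B) (proj2 B)).
Qed.

(* The data at b_(N-n) are dominated by the component growing to the left. *)
Definition good_bdata (n : nat) : Prop := exists k0, forall k, k0 <= k ->
  let p := bdata n (RtoC (- (k * k))) in
  cdot (snd p + RtoC k * fst p) (snd p + RtoC k * fst p) < 4 * cdot (snd p - RtoC k * fst p) (snd p - RtoC k * fst p).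

(** The third clause says that the quotient of the data is [- k + O(sqrt k)]: it serves both the
    passage over the next gap and the comparison of the proportionality constants. The last clause
    is the decay required by [borg_marchenko]. *)
Definition asymptotics (n : nat) : Prop := exists k0 K C0, 1 <= k0 /\ 0 <= C0 /\ forall k, k0 <= k ->
  let lam := RtoC (- (k * k)) in let p := adata n lam in
  fst p <> RtoC 0 /\ snd p <> RtoC 0 /\
  Cmod (snd p + RtoC k * fst p) * Cmod (snd p + RtoC k * fst p) <= C0 * k * (Cmod (fst p) * Cmod (fst p)) /\
  forall x, a (N - n)%nat <= x <= b (N - n)%nat ->
    Cmod (piece p (N - n) lam x) <= K * exp (- (k * (x - a (N - n)%nat))) * Cmod (fst p).

Lemma asymptotics_of_good (n : nat) : (n < N)%nat -> good_bdata n -> asymptotics n.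
Proof.
  intros Hn [k0 G]. set (m := (N - n)%nat) in *. assert (Hm : (1 <= m <= N)%nat) by (unfold m; lia).
  pose proof (ts_ab N a b hN hab m Hm) as ab.
  destruct (clamped_bounded q m hq Hm) as [Q HQ].
  assert (Q0 : 0 <= Q) by (apply Rle_trans with (2 := HQ 0); apply Cmod_ge_0).
  set (C1 := 4 * Q + 2 / (b m - a m)).
  assert (C1p : 0 < C1) by (unfold C1; assert (0 < 2 / (b m - a m)) by (apply Rdiv_lt_0_compat; lra); lra).
  exists (Rmax (Rmax 1 k0) (Rmax (1 + 4 * Q) (4 * C1))), (6 * exp (3 * Q * (b m - a m))), (16 * C1).
  split; [apply Rle_trans with (1 := Rmax_l 1 k0); apply Rmax_l |]. split; [lra |].
  intros k Hk.
  assert (h1 : 1 <= k).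
  { apply Rle_trans with (2 := Hk). apply Rle_trans with (1 := Rmax_l 1 k0). apply Rmax_l. }
  assert (h2 : k0 <= k).
  { apply Rle_trans with (2 := Hk). apply Rle_trans with (1 := Rmax_r 1 k0). apply Rmax_l. }
  assert (h3 : 1 + 4 * Q <= k).
  { apply Rle_trans with (2 := Hk). apply Rle_trans with (1 := Rmax_l (1 + 4 * Q) (4 * C1)). apply Rmax_r. }
  assert (h4 : 4 * C1 <= k).
  { apply Rle_trans with (2 := Hk). apply Rle_trans with (1 := Rmax_r (1 + 4 * Q) (4 * C1)). apply Rmax_r. }
  intros lam p. specialize (G k h2). cbv zeta in G. fold lam in G.
  destruct (piece_sol p m lam Hm) as (ps & p1 & p2).
  destruct (transfer_inv_sol m lam (bdata n lam) Hm) as (t1 & t2).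
  change (transfer_inv m lam (bdata n lam)) with p in t1, t2.
  rewrite <- t1, <- t2 in G.
  destruct (backward_bounds (clamped q m) (a m) (b m) Q k (piece p m lam) (piece1 p m lam)) as (r1 & r2 & r3 & r4); auto.
  - nra.
  - rewrite p1 in r1. rewrite p2 in r2. rewrite p1, p2 in r3.
    split; [exact r1 |]. split; [exact r2 |]. split; [exact r3 |].
    intros x Hx. rewrite <- p1. now apply r4.
Qed.

Lemma good_of_asymptotics (n : nat) : (S n < N)%nat -> asymptotics n -> good_bdata (S n).
Proof.
  intros Hn (k0 & K & C0 & k01 & C00 & A). set (m := (N - S n)%nat). assert (Hm : (1 <= m < N)%nat) by (unfold m; lia).
  pose proof (hab m Hm) as hm.
  set (d := a (S m) - b m). assert (d0 : 0 < d) by (unfold d; lra).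
  set (Q := Cmod (q (b m))). assert (Q0 : 0 <= Q) by apply Cmod_ge_0.
  exists (Rmax (Rmax k0 C0) (Rmax (1 + 2 * Q) (8 / d))). intros k Hk.
  assert (h1 : k0 <= k).
  { apply Rle_trans with (2 := Hk). apply Rle_trans with (1 := Rmax_l k0 C0). apply Rmax_l. }
  assert (h2 : C0 <= k).
  { apply Rle_trans with (2 := Hk). apply Rle_trans with (1 := Rmax_r k0 C0). apply Rmax_l. }
  assert (h3 : 1 + 2 * Q <= k).
  { apply Rle_trans with (2 := Hk). apply Rle_trans with (1 := Rmax_l (1 + 2 * Q) (8 / d)). apply Rmax_r. }
  assert (h4 : 8 / d <= k).
  { apply Rle_trans with (2 := Hk). apply Rle_trans with (1 := Rmax_r (1 + 2 * Q) (8 / d)). apply Rmax_r. }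
  specialize (A k h1). cbv zeta in A. destruct A as (n1 & n2 & n3 & _).
  cbn [bdata]. fold (adata n (RtoC (- (k * k)))). fold m.
  set (p := adata n (RtoC (- (k * k)))) in *.
  apply (gap_good (fst p) (snd p) (q (b m)) d Q k); auto.
  - apply Rle_refl.
  - apply Rle_div_l in h4; lra.
  (* For [k >= C0] the asymptotics give [|v + k y| <= k |y|], hence the bound [|v| <= 2 k |y|] that
     [gap_good] takes. *)
  - apply Cmod_gt_0 in n1.
    assert (e : Cmod (snd p + RtoC k * fst p) <= k * Cmod (fst p)).
    { apply sqr_le_reg; [nra |]. apply Rle_trans with (1 := n3).
      replace (k * Cmod (fst p) * (k * Cmod (fst p))) with (k * k * (Cmod (fst p) * Cmod (fst p))) by ring.
      apply Rmult_le_compat_r; nra. }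
    replace (snd p) with ((snd p + RtoC k * fst p) - RtoC k * fst p)%C by ring.
    apply Rle_trans with (1 := Cmod_triangle_minus _ _). rewrite Cmod_mult, Cmod_R, Rabs_pos_eq by lra. lra.
Qed.

Lemma adata_asymptotics (n : nat) : (n < N)%nat -> asymptotics n.
Proof.
  induction n as [|n IH]; intro Hn; apply asymptotics_of_good; try exact Hn.
  (* For the data [(0, -1)] at [b N] both inner products equal 1. *)
  - exists 1. intros k Hk p. unfold p, bdata, cdot, Re, Im. simpl. nra.
  - apply good_of_asymptotics; [exact Hn |]. apply IH. lia.
Qed.

End Solutions.

(* Both quotients V / Y and Vt / Yt are asymptotic to -k. *)
Lemma proportionality_constants_eq (Y V Yt Vt : R -> C) (c0 c1 : C) (k0 C0 : R) : 1 <= k0 -> 0 <= C0 ->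
  (forall k, Y k = (c0 * Yt k)%C) -> (forall k, V k = (c1 * Vt k)%C) ->
  (forall k, k0 <= k -> Yt k <> RtoC 0 /\
    Cmod (V k + RtoC k * Y k) * Cmod (V k + RtoC k * Y k) <= C0 * k * (Cmod (Y k) * Cmod (Y k)) /\
    Cmod (Vt k + RtoC k * Yt k) * Cmod (Vt k + RtoC k * Yt k) <= C0 * k * (Cmod (Yt k) * Cmod (Yt k))) ->
  c0 = c1.
Proof.
  intros k01 C00 EY EV H.
  set (B := Cmod c0 + Cmod c1). assert (B0 : 0 <= B) by (unfold B; pose proof (Cmod_ge_0 c0); pose proof (Cmod_ge_0 c1); lra).
  apply Ceq_minus, Cmod_le_0_eq.
  (* Substituting [k = r^2] removes the root from the error [O(sqrt k)], and [C0 + 1] serves as a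
     bound for the root of [C0]. *)
  assert (K : forall r, k0 <= r -> r * (r * Cmod (c0 - c1)) <= B * (C0 + 1) * r).
  { intros r Hr. set (k := r * r). assert (kk : k0 <= k) by (unfold k; nra).
    destruct (H k kk) as (N & h1 & h2). apply Cmod_gt_0 in N.
    set (y := Cmod (Yt k)) in *.
    assert (b2 : Cmod (Vt k + RtoC k * Yt k) <= (C0 + 1) * r * y).
    { apply sqr_le_reg; [apply Rmult_le_pos; nra |]. apply Rle_trans with (1 := h2).
      replace ((C0 + 1) * r * y * ((C0 + 1) * r * y)) with ((C0 + 1) * (C0 + 1) * k * (y * y)) by (unfold k; ring).
      apply Rmult_le_compat_r; [nra |]. apply Rmult_le_compat_r; nra. }
    assert (b1 : Cmod (V k + RtoC k * Y k) <= Cmod c0 * ((C0 + 1) * r * y)).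
    { pose proof (Cmod_ge_0 c0) as g. apply sqr_le_reg; [apply Rmult_le_pos; [exact g | apply Rmult_le_pos; nra] |].
      apply Rle_trans with (1 := h1). rewrite EY, Cmod_mult. fold y.
      replace (Cmod c0 * ((C0 + 1) * r * y) * (Cmod c0 * ((C0 + 1) * r * y)))
        with ((C0 + 1) * (C0 + 1) * k * (Cmod c0 * y * (Cmod c0 * y))) by (unfold k; ring).
      apply Rmult_le_compat_r; [nra |]. apply Rmult_le_compat_r; nra. }
    assert (id : (RtoC k * (c0 - c1) * Yt k = (V k + RtoC k * Y k) - c1 * (Vt k + RtoC k * Yt k))%C)
      by (rewrite EY, EV; ring).
    apply (f_equal Cmod) in id. rewrite !Cmod_mult, Cmod_R, Rabs_pos_eq in id by lra. fold y in id.
    pose proof (Cmod_triangle_minus (V k + RtoC k * Y k) (c1 * (Vt k + RtoC k * Yt k))) as t.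
    rewrite <- id, Cmod_mult in t.
    assert (Cmod c1 * Cmod (Vt k + RtoC k * Yt k) <= Cmod c1 * ((C0 + 1) * r * y))
      by (apply Rmult_le_compat_l; [apply Cmod_ge_0 | exact b2]).
    apply Rmult_le_reg_r with y; [exact N |].
    replace (r * (r * Cmod (c0 - c1)) * y) with (k * Cmod (c0 - c1) * y) by (unfold k; ring).
    replace (B * (C0 + 1) * r * y) with (Cmod c0 * ((C0 + 1) * r * y) + Cmod c1 * ((C0 + 1) * r * y)) by (unfold B; ring).
    lra. }
  apply Rle_0_of_all_eps. intros eps He.
  set (D := B * (C0 + 1)). assert (D0 : 0 <= D) by (unfold D; nra).
  set (r := k0 + D / eps). assert (De : 0 <= D / eps) by (apply Rmult_le_pos; [exact D0 | left; now apply Rinv_0_lt_compat]).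
  specialize (K r ltac:(unfold r; lra)). fold D in K.
  assert (r0 : 0 < r) by (unfold r; lra).
  assert (rc : r * Cmod (c0 - c1) <= D) by (apply Rmult_le_reg_l with r; lra).
  apply Rmult_le_reg_l with r; [exact r0 |]. apply Rle_trans with (1 := rc).
  replace D with (D / eps * eps) by (field; lra). apply Rmult_le_compat_r; unfold r; lra.
Qed.

(** Crossing a gap has determinant 1 and involves the potential only through its value at [b k],
    where both potentials already agree when the gap is reached. *)
Lemma gap_inv_wronskian (a b : nat -> R) (q qt : R -> C) (k : nat) (lam : C) (p pt : C * C) :
  q (b k) = qt (b k) ->
  (fst (gap_inv a b q k lam p) * snd (gap_inv a b qt k lam pt)
     - snd (gap_inv a b q k lam p) * fst (gap_inv a b qt k lam pt) = fst p * snd pt - snd p * fst pt)%C.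
Proof. intro E. unfold gap_inv. simpl. rewrite E. ring. Qed.

Theorem theorem2 (N : nat) (a b : nat -> R)
  (hN : (2 <= N)%nat)
  (hab : forall k : nat, (1 <= k < N)%nat ->
     (a k < b k)%R /\ (b k < a (S k))%R /\ (a (S k) < b (S k))%R)
  (q qt : R -> C)
  (hq : continuous_on (time_scale N a b) q)
  (hqt : continuous_on (time_scale N a b) qt)
  (h0 : same_zeros (Delta0 N a b q) (Delta0 N a b qt))
  (h1 : same_zeros (Delta1 N a b q) (Delta1 N a b qt)) :
  forall x : R, time_scale N a b x -> q x = qt x.
Proof.
  destruct (fundamental_family_exists N a b hN hab q hq) as (c & c1 & s & s1 & F).
  destruct (fundamental_family_exists N a b hN hab qt hqt) as (ct & ct1 & st & st1 & Ft).
  set (A := adata N a b q c c1 s s1). set (At := adata N a b qt ct ct1 st st1).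
  assert (As := adata_asymptotics N a b hN hab q c c1 s s1 hq F).
  assert (Ast := adata_asymptotics N a b hN hab qt ct ct1 st st1 hqt Ft).
  assert (Nice := nice_adata N a b hN hab q c c1 s s1 hq F).
  assert (Nicet := nice_adata N a b hN hab qt ct ct1 st st1 hqt Ft).
  assert (W1 : forall lam, (fst (A (N - 1)%nat lam) * snd (At (N - 1)%nat lam) =
                            snd (A (N - 1)%nat lam) * fst (At (N - 1)%nat lam))%C).
  { set (n := (N - 1)%nat). assert (Hn : (n < N)%nat) by (unfold n; lia).
    destruct (Nice n Hn) as [[Y1 Y2] [V1 V2]]. destruct (Nicet n Hn) as [[Y1t Y2t] [V1t V2t]].
    destruct (As n Hn) as (k0 & K & C0 & k01 & C00 & L). destruct (Ast n Hn) as (k0t & Kt & C0t & k01t & C00t & Lt).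
    fold (A n) in *. fold (At n) in *.
    assert (D0 : Delta0 N a b q = fun l => fst (A n l)).
    { apply functional_extensionality. intro l. exact (Delta0_eq N a b hN hab q c c1 s s1 F l). }
    assert (D0t : Delta0 N a b qt = fun l => fst (At n l)).
    { apply functional_extensionality. intro l. exact (Delta0_eq N a b hN hab qt ct ct1 st st1 Ft l). }
    (* The sign is written as a difference with 0, to which [ereg_minus] and [order_half_minus]
       apply. *)
    assert (D1 : Delta1 N a b q = fun l => (RtoC 0 - snd (A n l))%C).
    { apply functional_extensionality. intro l.
      transitivity (- snd (A n l))%C; [exact (Delta1_eq N a b hN hab q c c1 s s1 F l) | ring]. }
    assert (D1t : Delta1 N a b qt = fun l => (RtoC 0 - snd (At n l))%C).
    { apply functional_extensionality. intro l.
      transitivity (- snd (At n l))%C; [exact (Delta1_eq N a b hN hab qt ct ct1 st st1 Ft l) | ring]. }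
    rewrite D0, D0t in h0. rewrite D1, D1t in h1.
    pose proof (L k0 (Rle_refl _)) as L0. cbv zeta in L0. destruct L0 as (NY & NV & _).
    pose proof (Lt k0t (Rle_refl _)) as L0t. cbv zeta in L0t. destruct L0t as (NYt & NVt & _).
    fold (A n) in NY, NV. fold (At n) in NYt, NVt.
    assert (neg : forall z : C, z <> RtoC 0 -> (RtoC 0 - z)%C <> RtoC 0).
    { intros z nz e. apply nz. replace z with (RtoC 0 - (RtoC 0 - z))%C by ring. rewrite e. ring. }
    destruct (same_zeros_proportional _ _ _ _ Y1 Y1t Y2 Y2t NY NYt h0) as (e0 & _ & E0).
    destruct (same_zeros_proportional (fun l => RtoC 0 - snd (A n l))%C (fun l => RtoC 0 - snd (At n l))%C
       (RtoC (- (k0 * k0))) (RtoC (- (k0t * k0t)))) as (e1 & _ & E1); auto.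
    { apply ereg_minus; [apply ereg_const | exact V1]. } { apply ereg_minus; [apply ereg_const | exact V1t]. }
    { apply order_half_minus; [apply order_half_const | exact V2]. } { apply order_half_minus; [apply order_half_const | exact V2t]. }
    assert (E1' : forall z, snd (A n z) = (e1 * snd (At n z))%C).
    { intro z. specialize (E1 z). cbv beta in E1.
      replace (snd (A n z)) with (RtoC 0 - (RtoC 0 - snd (A n z)))%C by ring. rewrite E1. ring. }
    assert (e : e0 = e1).
    { apply (proportionality_constants_eq
        (fun k => fst (A n (RtoC (- (k * k))))) (fun k => snd (A n (RtoC (- (k * k)))))
        (fun k => fst (At n (RtoC (- (k * k))))) (fun k => snd (At n (RtoC (- (k * k)))))
        e0 e1 (Rmax k0 k0t) (Rmax C0 C0t)).
      - apply Rle_trans with (1 := k01). apply Rmax_l.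
      - apply Rle_trans with (1 := C00). apply Rmax_l.
      - intro k. apply E0.
      - intro k. apply E1'.
      - intros k Hk. pose proof (Rmax_l k0 k0t). pose proof (Rmax_r k0 k0t).
        pose proof (Rmax_l C0 C0t). pose proof (Rmax_r C0 C0t).
        pose proof (L k ltac:(lra)) as l1. pose proof (Lt k ltac:(lra)) as l2. cbv zeta in l1, l2.
        destruct l1 as (_ & _ & l1 & _). destruct l2 as (l0 & _ & l2 & _).
        split; [exact l0 |].
        assert (mono : forall u z, u <= Rmax C0 C0t -> u * k * (Cmod z * Cmod z) <= Rmax C0 C0t * k * (Cmod z * Cmod z)).
        { intros u z Hu. apply Rmult_le_compat_r; [pose proof (Cmod_ge_0 z); nra |]. apply Rmult_le_compat_r; lra. }
        split; [apply Rle_trans with (1 := l1) | apply Rle_trans with (1 := l2)]; now apply mono. }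
    intro lam. rewrite E0, E1', <- e. ring. }
  assert (interval : forall k, (1 <= k <= N)%nat ->
    (forall lam, (fst (A (N - k)%nat lam) * snd (At (N - k)%nat lam) =
                  snd (A (N - k)%nat lam) * fst (At (N - k)%nat lam))%C) ->
    forall x, a k <= x <= b k -> q x = qt x).
  { intros k Hk W.
    destruct (As (N - k)%nat ltac:(lia)) as (k0 & K & C0 & k01 & C00 & L).
    destruct (Ast (N - k)%nat ltac:(lia)) as (k0t & Kt & C0t & k01t & C00t & Lt).
    replace (N - (N - k))%nat with k in L, Lt by lia.
    destruct (clamped_bounded N a b hN hab q k hq Hk) as [M HM].
    destruct (clamped_bounded N a b hN hab qt k hqt Hk) as [Mt HMt].
    pose proof (ts_ab N a b hN hab k Hk) as kab.
    assert (E : forall x, a k <= x <= b k -> clamped a b q k x = clamped a b qt k x).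
    { apply (borg_marchenko _ _ (a k) (b k) (Rmax M Mt) (Rmax K Kt) (Rmax k0 k0t) kab).
      - exact (clamped_ccont N a b hN hab q k hq Hk).
      - exact (clamped_ccont N a b hN hab qt k hqt Hk).
      - intro x. apply Rle_trans with (1 := HM x). apply Rmax_l.
      - intro x. apply Rle_trans with (1 := HMt x). apply Rmax_r.
      - intros r Hr. set (lam := RtoC (- (r * r))).
        pose proof (Rmax_l k0 k0t). pose proof (Rmax_r k0 k0t).
        pose proof (L r ltac:(lra)) as l1. pose proof (Lt r ltac:(lra)) as l2. cbv zeta in l1, l2. fold lam in l1, l2.
        destruct l1 as (n1 & _ & _ & d1). destruct l2 as (n2 & _ & _ & d2).
        fold (A (N - k)%nat) in n1, d1. fold (At (N - k)%nat) in n2, d2.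
        destruct (piece_sol N a b q c c1 s s1 F (A (N - k)%nat lam) k lam Hk) as (S1 & u1 & u2).
        destruct (piece_sol N a b qt ct ct1 st st1 Ft (At (N - k)%nat lam) k lam Hk) as (S2 & v1 & v2).
        exists (piece c s (A (N - k)%nat lam) k lam), (piece1 c1 s1 (A (N - k)%nat lam) k lam),
               (piece ct st (At (N - k)%nat lam) k lam), (piece1 ct1 st1 (At (N - k)%nat lam) k lam).
        rewrite u1, u2, v1, v2. repeat (split; [assumption |]). split; [apply W |].
        assert (mono : forall u x z, u <= Rmax K Kt ->
          u * exp (- (r * (x - a k))) * Cmod z <= Rmax K Kt * exp (- (r * (x - a k))) * Cmod z).
        { intros u x z Hu. apply Rmult_le_compat_r; [apply Cmod_ge_0 |].
          apply Rmult_le_compat_r; [left; apply exp_pos | exact Hu]. }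
        intros x Hx. split.
        + apply Rle_trans with (1 := d1 x Hx). apply mono, Rmax_l.
        + apply Rle_trans with (1 := d2 x Hx). apply mono, Rmax_r. }
    intros x Hx. specialize (E x Hx). unfold clamped in E. now rewrite clamp_id in E. }
  (* The induction runs from the left while [A] and [At] count intervals from the right, hence the
     index [N - k]. *)
  assert (W : forall k, (1 <= k <= N)%nat -> forall lam,
    (fst (A (N - k)%nat lam) * snd (At (N - k)%nat lam) = snd (A (N - k)%nat lam) * fst (At (N - k)%nat lam))%C).
  { induction k as [|k IH]; intro Hk; [lia |].
    destruct k as [|k]; [exact W1 |].
    assert (Hk' : (1 <= S k < N)%nat) by lia. specialize (IH ltac:(lia)).
    pose proof (interval (S k) ltac:(lia) IH) as Eq.
    pose proof (hab (S k) Hk') as hk.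
    intro lam.
    set (m := (N - S (S k))%nat). replace (N - S k)%nat with (S m) in IH by (unfold m; lia).
    destruct (piece_sol N a b q c c1 s s1 F (A (S m) lam) (S k) lam ltac:(lia)) as (S1 & u1 & u2).
    destruct (piece_sol N a b qt ct ct1 st st1 Ft (At (S m) lam) (S k) lam ltac:(lia)) as (S2 & v1 & v2).
    (* On an interval where the potentials already agree, the two psi solve the same equation, so
       the vanishing of their Wronskian passes from [a] to [b]. *)
    pose proof (wronskian_const _ _ lam _ _ _ _ (a (S k)) (b (S k)) S1 S2) as Wc.
    specialize (Wc ltac:(intros x Hx; unfold clamped; rewrite clamp_id by exact Hx; now apply Eq) (b (S k)) ltac:(lra)).
    rewrite u1, u2, v1, v2, IH in Wc.
    assert (Ek : S k = (N - S m)%nat) by (unfold m; lia).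
    destruct (transfer_inv_sol N a b q c c1 s s1 F (S k) lam (bdata N a b q c c1 s s1 (S m) lam) ltac:(lia)) as (t1 & t2).
    destruct (transfer_inv_sol N a b qt ct ct1 st st1 Ft (S k) lam (bdata N a b qt ct ct1 st st1 (S m) lam) ltac:(lia)) as (t3 & t4).
    assert (EA : A (S m) lam = transfer_inv b c c1 s s1 (S k) lam (bdata N a b q c c1 s s1 (S m) lam))
      by (unfold A, adata; now rewrite <- Ek).
    assert (EAt : At (S m) lam = transfer_inv b ct ct1 st st1 (S k) lam (bdata N a b qt ct ct1 st st1 (S m) lam))
      by (unfold At, adata; now rewrite <- Ek).
    rewrite EA, EAt, t1, t2, t3, t4 in Wc.
    cbn [bdata] in Wc.
    fold (adata N a b q c c1 s s1 m lam) in Wc. fold (adata N a b qt ct ct1 st st1 m lam) in Wc.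
    fold A in Wc. fold At in Wc. rewrite <- Ek in Wc.
    rewrite gap_inv_wronskian in Wc by (apply Eq; lra).
    apply Ceq_minus. rewrite Wc. ring. }
  intros x [k [Hk Hx]]. exact (interval k Hk (W k Hk) x Hx).
Qed.
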